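(* Let $M$ be a connected smooth $n$-dimensional manifold, let $g$ be a complete Riemannian metric on $M$, and let $\eta$ be a closed non-zero $1$-form on $M$ which is parallel with respect to $g$, i.e. $\nabla\eta=0$, where $\nabla$ is the Levi-Civita connection of $g$. Then $\mathcal{H}^{k}_{(2),\eta}(M)=\{0\}$ for every $k$.
   Context: $\Omega^{k}(M)$ denotes the smooth real $k$-forms on $M$, and $\Omega^{k}_{(2)}(M)=\{\alpha\in\Omega^{k}(M):\int_{M}|\alpha|^{2}\,d\mathrm{Vol}<\infty\}$, with pointwise norm and volume induced by $g$. $d$ is the exterior derivative and $\delta$ its formal adjoint with respect to the $L^2$ inner product of $g$. For a closed $1$-form $\eta$, the Morse-Novikov differential is $d_{\eta}\alpha=d\alpha+\eta\wedge\alpha$. Let $U$ be the vector field on $M$ determined by $\eta(X)=g(X,U)$ for all vector fields $X$, let $i_{U}$ be contraction by $U$, and set $\delta_{\eta}=\delta+i_{U}$; it is the formal adjoint of $d_{\eta}$. The space of $L^{2}$ Morse-Novikov harmonic $k$-forms is $$\mathcal{H}^{k}_{(2),\eta}(M)=\{\alpha\in\Omega^{k}_{(2)}(M): d_{\eta}\alpha=0,\ \delta_{\eta}\alpha=0\}.$$ *)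

(* Defs.v *)
From HB Require Import structures.
From mathcomp Require Import all_boot all_order all_algebra.
From mathcomp Require Import ring lra.
From mathcomp Require Import all_classical all_reals all_analysis.

Set Implicit Arguments.
Unset Strict Implicit.
Unset Printing Implicit Defensive.

Import Order.TTheory GRing.Theory Num.Theory.
Import numFieldNormedType.Exports.
Local Open Scope classical_set_scope.
Local Open Scope ring_scope.

Section Euclidean.
Context (R : realType).

Definition stdvec n (a : 'I_n) : 'rV[R]_n := delta_mx 0 a.

Definition partial n (a : 'I_n) (f : 'rV[R]_n -> R) : 'rV[R]_n -> R :=
  fun y => 'D_(stdvec a) f y.

(* C^oo on an open set: every iterated partial derivative exists and is
   continuous there. *)
Definition smooth_on n (O : set 'rV[R]_n) (f : 'rV[R]_n -> R) : Prop :=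
  forall (s : seq 'I_n) (y : 'rV[R]_n), O y ->
    {for y, continuous (foldr (@partial n) f s)} /\
    forall a : 'I_n, derivable (foldr (@partial n) f s) y (stdvec a).

(* By Tonelli, on nonnegative Borel functions this is the integral against
   n-dimensional Lebesgue measure. *)
Fixpoint lebesgue_integral_rV n : ('rV[R]_n -> \bar R) -> \bar R :=
  match n with
  | 0 => fun f => f 0
  | n'.+1 => fun f =>
      (\int[@lebesgue_measure R]_t
         lebesgue_integral_rV
           (fun y : 'rV[R]_n' => f (row_mx (const_mx t : 'rV_1) y)))%E
  end.

End Euclidean.

(* Smooth manifolds without boundary, of dimension n, Hausdorff and second
   countable.  [phi i] and [psi i] are total functions that are mutually
   inverse homeomorphisms between [dom i] and its image; their values elsewhere
   are irrelevant.  [chart_at x] selects a preferred chart around x; any choice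
   will do. *)
Record smoothManifold (R : realType) (n : nat) := SmoothManifold {
  carrier :> ptopologicalType;
  chart : Type;
  dom : chart -> set carrier;
  phi : chart -> carrier -> 'rV[R]_n;
  psi : chart -> 'rV[R]_n -> carrier;
  chart_at : carrier -> chart;
  manifold_hausdorff : hausdorff_space carrier;
  manifold_second_countable : @second_countable carrier;
  dom_open : forall i, open (dom i);
  cod_open : forall i, open (phi i @` dom i);
  phiK : forall i x, dom i x -> psi i (phi i x) = x;
  phi_continuous : forall i x, dom i x -> {for x, continuous (phi i)};
  psi_continuous :
    forall i y, (phi i @` dom i) y -> {for y, continuous (psi i)};
  chart_atP : forall x, dom (chart_at x) x;
  transition_smooth : forall i j (b : 'I_n),
    smooth_on (phi i @` (dom i `&` dom j)) (fun y => phi j (psi i y) 0 b)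
}.

Section Tensors.
Context (R : realType) (n : nat) (M : smoothManifold R n).

(* The tangent space at x is identified with R^n (row vectors) by means of the
   chart [chart_at x].  The rows of [frame i x] are the coordinate vectors of
   the chart i at x under this identification. *)
Definition frame (i : chart M) (x : M) : 'M[R]_n :=
  jacobian (fun y => phi (chart_at x) (psi i y)) (phi i x).

(* A field of real functions of k tangent vectors, given as the rows of a
   k x n matrix. *)
Definition kfield (k : nat) := M -> 'M[R]_(k, n) -> R.

Definition vfield := M -> 'rV[R]_n.

Definition localf k (i : chart M) (alpha : kfield k)
    (y : 'rV[R]_n) (B : 'M[R]_(k, n)) : R :=
  alpha (psi i y) (B *m frame i (psi i y)).

Definition multilinear_rows k (w : 'M[R]_(k, n) -> R) : Prop :=
  forall (A B C : 'M[R]_(k, n)) (l : 'I_k) (b c : R),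
    row l A = b *: row l B + c *: row l C ->
    row' l B = row' l A -> row' l C = row' l A ->
    w A = b * w B + c * w C.

Definition alternating_rows k (w : 'M[R]_(k, n) -> R) : Prop :=
  forall (A : 'M[R]_(k, n)) (l m : 'I_k),
    l != m -> row l A = row m A -> w A = 0.

(* Smooth real k-forms. *)
Definition Omega (k : nat) : set (kfield k) :=
  [set alpha | [/\ forall x, multilinear_rows (alpha x),
                   forall x, alternating_rows (alpha x)
                 & forall (i : chart M) (B : 'M[R]_(k, n)),
                     smooth_on (phi i @` dom i) (fun y => localf i alpha y B)]].

(* dw(v_0, ..., v_k) = sum_j (-1)^j D_{v_j} w(v_0, ..., ^v_j, ..., v_k) for
   constant vector fields in a chart; this does not depend on the chart, and is
   evaluated at x in the chart [chart_at x]. *)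
Definition ext_d k (alpha : kfield k) : kfield k.+1 :=
  fun x A => \sum_(j < k.+1) (-1) ^+ j *
    'D_(row j A) (fun y => localf (chart_at x) alpha y (row' j A))
      (phi (chart_at x) x).

Definition wedge1 k (eta : kfield 1) (alpha : kfield k) : kfield k.+1 :=
  fun x A => \sum_(j < k.+1)
    (-1) ^+ j * eta x (row j A) * alpha x (row' j A).

Definition contract k (U : vfield) (alpha : kfield k.+1) : kfield k :=
  fun x A => alpha x (col_mx (U x) A : 'M[R]_(1 + k, n)).

Definition compactly_supported k (alpha : kfield k) : Prop :=
  exists2 K : set M, compact K & forall x, ~ K x -> alpha x = 0.

(* [g x] is the Gram matrix of the metric on the tangent space at x. *)
Definition gdot (g : M -> 'M[R]_n) (x : M) (v w : 'rV[R]_n) : R :=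
  (v *m g x *m w^T) 0 0.

Definition local_metric (g : M -> 'M[R]_n) (i : chart M) (y : 'rV[R]_n) :
    'M[R]_n :=
  frame i (psi i y) *m g (psi i y) *m (frame i (psi i y))^T.

Definition riemannian_metric (g : M -> 'M[R]_n) : Prop :=
  [/\ forall x v w, gdot g x v w = gdot g x w v,
      forall x v, v != 0 -> 0 < gdot g x v v
    & forall (i : chart M) (a b : 'I_n),
        smooth_on (phi i @` dom i) (fun y => local_metric g i y a b)].

Section Metric.
Variable g : M -> 'M[R]_n.

Definition christoffel (i : chart M) (a b c : 'I_n) (y : 'rV[R]_n) : R :=
  2^-1 * \sum_(e < n) invmx (local_metric g i y) c e *
    (partial a (fun z => local_metric g i z b e) y +
     partial b (fun z => local_metric g i z a e) y -
     partial e (fun z => local_metric g i z a b) y).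

(* (nabla_a eta)_b, for the Levi-Civita connection nabla of g, in the chart i;
   see [christoffel_torsion_free] and [christoffel_metric_compatible]. *)
Definition nabla1 (eta : kfield 1) (i : chart M) (a b : 'I_n)
    (y : 'rV[R]_n) : R :=
  partial a (fun z => localf i eta z (stdvec R b)) y -
  \sum_(c < n) christoffel i a b c y * localf i eta y (stdvec R c).

Definition parallel (eta : kfield 1) : Prop :=
  forall (i : chart M) (y : 'rV[R]_n), (phi i @` dom i) y ->
    forall a b : 'I_n, nabla1 eta i a b y = 0.

Definition c1_curve (c : R -> M) : Prop :=
  continuous c /\
  forall (i : chart M) (t : R), dom i (c t) ->
    derivable (fun s => phi i (c s)) t 1 /\
    {for t, continuous (derive1 (fun s => phi i (c s)))}.

Definition velocity (c : R -> M) (t : R) : 'rV[R]_n :=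
  derive1 (fun s => phi (chart_at (c t)) (c s)) t.

Definition curve_length (c : R -> M) : \bar R :=
  (\int[@lebesgue_measure R]_(t in `[0%R, 1%R])
     (Num.sqrt (gdot g (c t) (velocity c t) (velocity c t)))%:E)%E.

(* [pw_c1_path x y L]: some piecewise C^1 path, a concatenation of finitely many
   C^1 curves parametrized by [0, 1], goes from x to y and has length L. *)
Inductive pw_c1_path : M -> M -> \bar R -> Prop :=
| pw_c1_path_nil x : pw_c1_path x x 0%E
| pw_c1_path_cons (c : R -> M) z L :
    c1_curve c -> pw_c1_path (c 1) z L ->
    pw_c1_path (c 0) z (curve_length c + L)%E.

Definition riemannian_dist (x y : M) : \bar R :=
  ereal_inf [set L | pw_c1_path x y L].

Definition complete_metric : Prop :=
  forall u : nat -> M,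
    (forall e : R, 0 < e -> exists N : nat, forall p q : nat,
       (N <= p)%N -> (N <= q)%N -> (riemannian_dist (u p) (u q) < e%:E)%E) ->
    exists x : M, (fun p => riemannian_dist (u p) x) @ \oo --> 0%E.

Definition borelM := g_sigma_algebraType (@open M).

(* dVol = sqrt (det g) dy^1 ... dy^n in every chart.  This determines the Borel
   measure [vol], as countably many charts cover M. *)
Definition riemannian_volume
    (vol : {measure set borelM -> \bar R}) : Prop :=
  forall (i : chart M) (A : set borelM), measurable A -> A `<=` @dom R n M i ->
    vol A = lebesgue_integral_rV (fun y =>
      (\1_(phi i @` A) y * Num.sqrt (\det (local_metric g i y)))%:E).

Definition stdrows k (I : {ffun 'I_k -> 'I_n}) : 'M[R]_(k, n) :=
  \matrix_(l, c) (c == I l)%:R.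

(* Normalized so that e^{i_1} /\ ... /\ e^{i_k}, i_1 < ... < i_k, is an
   orthonormal family whenever the coframe (e^i) is orthonormal. *)
Definition form_dot k (alpha beta : kfield k) (x : M) : R :=
  (k`!%:R)^-1 *
  \sum_(I : {ffun 'I_k -> 'I_n}) \sum_(J : {ffun 'I_k -> 'I_n})
    (\prod_(l < k) invmx (g x) (I l) (J l)) *
    alpha x (stdrows I) * beta x (stdrows J).

(* eta^a = g^{ab} eta_b; see [sharpP] *)
Definition sharp (eta : kfield 1) : vfield :=
  fun x => (\row_b eta x (stdvec R b)) *m invmx (g x).

Lemma metric_unitmx x : riemannian_metric g -> g x \in unitmx.
Proof.
case=> _ gpos _; rewrite -row_free_unit -kermx_eq0; apply/eqP/row_matrixP => i.
rewrite row0; apply/eqP; apply: contraT => /(gpos x).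
by rewrite /gdot (sub_kermxP (row_sub i (kermx (g x)))) mul0mx mxE ltxx.
Qed.

Lemma metric_sym x : riemannian_metric g -> (g x)^T = g x.
Proof.
case=> gsym _ _; apply/matrixP => a b; rewrite mxE.
have E c e : gdot g x (stdvec R c) (stdvec R e) = g x c e.
  by rewrite /gdot /stdvec -rowE trmx_delta -colE !mxE.
by rewrite -!E gsym.
Qed.

Lemma oneform_sum (w : 'M[R]_(1, n) -> R) (v : 'rV[R]_n) :
  multilinear_rows w -> w v = \sum_b v 0 b * w (stdvec R b).
Proof.
move=> wlin.
have row'0 (A B : 'rV[R]_n) : row' 0 A = row' 0 B.
  by apply/matrixP => -[].
have wD (b c : R) (A B : 'rV[R]_n) : w (b *: A + c *: B) = b * w A + c * w B.
  apply: (wlin _ _ _ 0); [by rewrite linearD !linearZ | exact: row'0..].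
have w0 : w 0 = 0 by rewrite -[X in w X](addr0 0) -{1}(scale0r 0)
  -[X in w (_ + X)](scale0r 0) wD !mul0r addr0.
rewrite {1}(row_sum_delta v).
elim/big_rec2: _ => [|b y z _ <-]; first exact: w0.
by rewrite -[X in w (_ + X)]scale1r wD mul1r.
Qed.

Lemma sharpP (eta : kfield 1) (x : M) (X : 'rV[R]_n) :
  riemannian_metric g -> Omega eta -> eta x X = gdot g x X (sharp eta x).
Proof.
move=> gm [etalin _ _].
rewrite (oneform_sum X (etalin x)) /gdot /sharp trmx_mul trmx_inv metric_sym//.
rewrite mulmxA -(mulmxA X) mulmxV ?metric_unitmx// mulmx1 mxE.
by apply: eq_bigr => b _; rewrite !mxE.
Qed.

Lemma local_metric_sym i y a b : riemannian_metric g ->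
  local_metric g i y a b = local_metric g i y b a.
Proof.
move=> gm; have gT : (local_metric g i y)^T = local_metric g i y.
  by rewrite /local_metric !trmx_mul trmxK metric_sym// mulmxA.
by rewrite -{1}gT mxE.
Qed.

Lemma christoffel_torsion_free i a b c y : riemannian_metric g ->
  christoffel i a b c y = christoffel i b a c y.
Proof.
move=> gm; rewrite /christoffel; congr (_ * _); apply: eq_bigr => e _.
congr (_ * (_ - _)); first by rewrite addrC.
by congr (partial _ _ _); apply/funext => z; exact: local_metric_sym.
Qed.

Lemma christoffel_metric_compatible i a b c y :
    riemannian_metric g -> local_metric g i y \in unitmx ->
  partial c (fun z => local_metric g i z a b) y =
  \sum_(e < n) (christoffel i c a e y * local_metric g i y e b +
                christoffel i c b e y * local_metric g i y a e).
Proof.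
move=> gm gu.
pose D a b c := partial c (fun z => local_metric g i z a b) y.
have Dsym a' b' c' : D a' b' c' = D b' a' c'.
  by congr (partial _ _ _); apply/funext => z; exact: local_metric_sym.
have GT u v : local_metric g i y u v = local_metric g i y v u.
  exact: local_metric_sym.
under eq_bigr => e _ do rewrite (GT a e).
have CE p q e : christoffel i p q e y = 2^-1 * \sum_(f < n)
    invmx (local_metric g i y) e f * (D q f p + D p f q - D p q f).
  by [].
rewrite -[LHS]/(D a b c).
under eq_bigr => e _ do rewrite !CE.
move: (local_metric g i y) gu GT D Dsym {CE} => G gu GT D Dsym.
have K p q r : \sum_(e < n) (2^-1 * \sum_(f < n) invmx G e f *
    (D q f p + D p f q - D p q f)) * G e r =
    2^-1 * (D q r p + D p r q - D p q r).
  under eq_bigr => e _ do rewrite -mulrA mulr_suml.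
  rewrite -mulr_sumr exchange_big/=; congr (_ * _).
  have W f : \sum_(e < n) invmx G e f * (D q f p + D p f q - D p q f) * G e r
      = (D q f p + D p f q - D p q f) * (r == f)%:R.
    have /matrixP/(_ r f) := mulmxV gu; rewrite !mxE => <-.
    by rewrite mulr_sumr; apply: eq_bigr => e _; rewrite (GT e r); ring.
  rewrite (eq_bigr _ (fun f _ => W f)) (bigD1 r)//= eqxx mulr1 big1 ?addr0//.
  by move=> f /negbTE fr; rewrite eq_sym fr mulr0.
rewrite big_split/= !K (Dsym b a c) (Dsym c b a) (Dsym c a b).
by field.
Qed.

Definition d_eta k (eta : kfield 1) (alpha : kfield k) : kfield k.+1 :=
  ext_d alpha + wedge1 eta alpha.

Section Volume.
Variable vol : {measure set borelM -> \bar R}.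

Definition L2_dot k (alpha beta : kfield k) : \bar R :=
  (\int[vol]_x (form_dot alpha beta x)%:E)%E.

Definition Omega2 k : set (kfield k) :=
  [set alpha | Omega alpha /\ (L2_dot alpha alpha < +oo)%E].

(* gamma = delta beta, for delta the formal adjoint of d *)
Definition codifferential k (beta : kfield k.+1) (gamma : kfield k) : Prop :=
  Omega gamma /\
  forall alpha : kfield k, Omega alpha -> compactly_supported alpha ->
    L2_dot (ext_d alpha) beta = L2_dot alpha gamma.

(* gamma = delta_eta beta, where delta_eta = delta + i_U *)
Definition delta_eta k (eta : kfield 1) (beta : kfield k.+1)
    (gamma : kfield k) : Prop :=
  exists2 gamma' : kfield k, codifferential beta gamma' &
    gamma = gamma' + contract (sharp eta) beta.

(* On 0-forms delta_eta is zero, its target being the (-1)-forms. *)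
Definition delta_eta_closed (eta : kfield 1) k : kfield k -> Prop :=
  match k with
  | 0 => fun=> True
  | k'.+1 => fun alpha => delta_eta eta alpha 0
  end.

Definition harmonic2 (eta : kfield 1) k : set (kfield k) :=
  [set alpha | [/\ Omega2 alpha, d_eta eta alpha = 0
                 & delta_eta_closed eta alpha]].

End Volume.
End Metric.
End Tensors.
Arguments harmonic2 {R n M} g vol eta k _.

(* Main.v *)
Require Import Defs.
From HB Require Import structures.
From mathcomp Require Import all_boot all_order all_algebra.
From mathcomp Require Import perm ring lra zify.
From mathcomp Require Import all_classical all_reals all_analysis measurable_realfun.

(* Let U be the dual of eta, c = |eta|^2 (a positive constant), alpha harmonic
   and beta = i_U alpha.  A parallel field is Killing, so L_U preserves the
   metric and Cartan's formula together with d alpha = - eta /\ alpha gives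
       d beta = L_U alpha + c alpha - eta /\ beta,
       <L_U alpha, alpha> = 1/2 U |alpha|^2.
   Pairing d (h beta) with alpha for a compactly supported h >= 0, and using
   delta alpha = - beta (from delta_eta alpha = 0), the terms in |beta|^2 cancel:
       int <beta, i_(grad h) alpha> + 1/2 h U |alpha|^2 + c h |alpha|^2 = 0.
   As U is divergence free, the middle term equals - 1/2 int (U h) |alpha|^2, so
   |grad h| <= 1 yields c int h |alpha|^2 <= C int |alpha|^2 with C independent
   of h.  On a complete manifold some such h exceeds any prescribed value at a
   given point, hence alpha = 0. *)

Set Implicit Arguments.
Unset Strict Implicit.
Unset Printing Implicit Defensive.

Import Order.TTheory GRing.Theory Num.Theory.
Import numFieldNormedType.Exports.
Local Open Scope classical_set_scope.
Local Open Scope ring_scope.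

(** * Calculus on open subsets of R^n *)

(** The form [alpha] is only square integrable and its codifferential is known only weakly, through
    compactly supported test forms. This forces the cut-off h, and derivatives have to be moved onto
    h because nothing is known about the integrability of derivatives of [alpha]. Parallelism enters
    twice: it makes the norm of [eta] locally constant, whence c, and it makes U Killing, whence
    both the formula for <L_U alpha, alpha> and the vanishing divergence. Keeping |grad h| below 1
    and letting h grow at one point amounts, after scaling, to the usual cut-offs of height 1 with
    small gradient. Such h are not built from the distance function, which need not be smooth and
    whose balls are not yet known to be relatively compact: completeness is used directly on Cauchy
    sequences, in a variational argument of Ekeland type. Degree 0 has no beta; there d alpha
    evaluated on U gives the identity pointwise, without integration by parts. *)

Section Calculus.
Context {R : realType}.

Lemma rV_norm_coord n (v : 'rV[R]_n) a : `|v 0 a| <= `|v|.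
Proof.
by rewrite [leRHS]/Num.norm /= mx_normrE; apply/bigmax_geP; right => /=; exists (0, a).
Qed.

Lemma rV_norm_le n (v : 'rV[R]_n) r :
  0 <= r -> (forall a, `|v 0 a| <= r) -> `|v| <= r.
Proof.
move=> r0 vr; rewrite /Num.norm /= mx_normrE; apply/bigmax_leP; split => //= -[i a] _ /=.
by rewrite (ord1 i).
Qed.

Lemma is_derive_line n (f : 'rV[R]_n -> R) (z v : 'rV[R]_n) (t : R) :
  derivable f (z + t *: v) v ->
  is_derive t 1 (fun s : R => f (z + s *: v)) ('D_v f (z + t *: v)).
Proof.
move=> df.
have E : (fun h : R => h^-1 *: (f (z + (h *: 1 + t) *: v) - f (z + t *: v))) =
    (fun h : R => h^-1 *: (f (h *: v + (z + t *: v)) - f (z + t *: v))).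
  apply/funext => h; congr (_ *: (f _ - _)).
  by rewrite scalerDl [h *: 1]mulr1 addrCA.
split; first by move: df; rewrite /derivable /= E.
by rewrite /derive /= E.
Qed.

Lemma MVT_line n (f : 'rV[R]_n -> R) (z v : 'rV[R]_n) :
  (forall t : R, 0 <= t <= 1 -> derivable f (z + t *: v) v) ->
  exists2 t : R, 0 <= t <= 1 & f (z + v) - f z = 'D_v f (z + t *: v).
Proof.
move=> df.
have H (t : R) : t \in `[0, 1]%R -> is_derive t 1 (fun s : R => f (z + s *: v)) ('D_v f (z + t *: v)).
  by rewrite in_itv /= => t01; apply: is_derive_line; exact: df.
have H1 (t : R) : t \in `]0, 1[%R -> is_derive t 1 (fun s : R => f (z + s *: v)) ('D_v f (z + t *: v)).
  by move=> t01; apply: H; apply: subset_itv_oo_cc.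
have H2 : {within `[0, 1], continuous (fun s : R => f (z + s *: v))}.
  by apply: derivable_within_continuous => t /H[].
have [t t01] := @MVT_segment R (fun s : R => f (z + s *: v)) (fun t : R => 'D_v f (z + t *: v)) 0 1 ler01 H1 H2.
rewrite scale1r scale0r addr0 subr0 mulr1 => ->; exists t => //.
Qed.

Lemma is_derive_scale n (f : 'rV[R]_n -> R) (x v : 'rV[R]_n) (c : R) :
  derivable f x v -> is_derive x (c *: v) f (c * 'D_v f x).
Proof.
move=> df.
have df' : derivable f (x + 0 *: v) v by rewrite scale0r addr0.
have D := is_derive_line df'.
have Dc : is_derive (0 : R) 1 (fun s : R => c * s) c.
  by rewrite -[X in is_derive _ _ _ X]mulr1; exact: (is_deriveZ c (is_derive_id (0 : R) 1)).
have D0 : is_derive (c * 0) 1 (fun s : R => f (x + s *: v)) ('D_v f x).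
  by rewrite mulr0; move: D; rewrite scale0r addr0.
have [D1 D2] := is_derive1_comp D0 Dc.
have E : (fun h : R => f (h *: (c *: v) + x)) =
    (fun s : R => f (x + s *: v)) \o (fun s : R => c * s).
  by apply/funext => h /=; rewrite addrC scalerA mulrC.
have Q : (fun h : R => h^-1 *: ((f \o shift x) (h *: (c *: v)) - f x)) =
    (fun h : R => h^-1 *: (((fun s : R => f (x + s *: v)) \o *%R c) (h *: 1 + 0) -
       ((fun s : R => f (x + s *: v)) \o *%R c) 0)).
  apply/funext => h; rewrite -E /=; congr (_ *: (f _ - f _)).
    by rewrite [h *: 1]mulr1 addr0.
  by rewrite scale0r add0r.
rewrite mulrC -D2; split; last by rewrite /derive Q.
by rewrite /derivable Q.
Qed.

(** The candidate differential with gradient [D], registered as a linear map so that uniqueness of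
    the differential applies to it. *)
Definition dotg n (D v : 'rV[R]_n) : R := \sum_a v 0 a * D 0 a.

Lemma dotg_is_linear n (D : 'rV[R]_n) : linear (dotg D : 'rV[R]_n -> R^o).
Proof.
move=> c u v; rewrite /dotg scaler_sumr -big_split; apply: eq_bigr => a _ /=.
by rewrite !mxE mulrDl -mulrA.
Qed.

HB.instance Definition _ n (D : 'rV[R]_n) :=
  GRing.isLinear.Build R 'rV[R]_n R^o _ (dotg D) (dotg_is_linear D).

Lemma dotg_continuous n (D : 'rV[R]_n) : continuous (dotg D).
Proof.
move=> y; have -> : dotg D = \sum_a (fun v : 'rV[R]_n => v 0 a * D 0 a).
  by apply/funext => v; rewrite /dotg fct_sumE.
apply: differentiable_continuous; apply: differentiable_sum => a.
apply: differentiableM; first exact: differentiable_coord.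
exact: differentiable_cst.
Qed.

Lemma differentiable_deriveE n (f : 'rV[R]_n -> R) (y v : 'rV[R]_n) :
  differentiable f y -> 'D_v f y = \sum_a v 0 a * partial a f y.
Proof.
move=> df; rewrite deriveE// {1}(row_sum_delta v) linear_sum; apply: eq_bigr => a _.
by rewrite linearZ /partial deriveE.
Qed.

(** The increment from y to y + h is made one coordinate at a time; the mean value theorem turns
    each step into a partial derivative at a point within |h| of y, where continuity at y controls
    it. *)
Lemma C1_differentiable n (O : set 'rV[R]_n) (f : 'rV[R]_n -> R) (y : 'rV[R]_n) :
  open O -> O y -> (forall z a, O z -> derivable f z (stdvec R a)) ->
  (forall a, {for y, continuous (partial a f)}) -> differentiable f y.
Proof.
move=> Oop Oy df cf.
pose D : 'rV[R]_n := \row_a partial a f y.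
suff H : (f \o shift y : 'rV[R]_n -> R) = cst (f y) + (dotg D : 'rV[R]_n -> R) +o_ (0 : 'rV[R]_n) id.
  have E := diff_unique (df := dotg D) (@dotg_continuous n D) H.
  by apply/diff_locallyP; rewrite E; split => //; exact: dotg_continuous.
apply/eqaddoP => e e0.
(* There are n coordinate steps, each allowed this error; [n.+1] avoids a division by 0 when n =
   0. *)
have e1 : 0 < e / n.+1%:R by rewrite divr_gt0.
have : \forall z \near y, O z /\ forall a, `|partial a f y - partial a f z| < e / n.+1%:R.
  apply: filterI; first exact: open_nbhs_nbhs.
  apply: (@filter_forall _ _ (fun a z => `|partial a f y - partial a f z| < e / n.+1%:R) (nbhs y)) => a.
  by have /cvgrPdist_lt/(_ _ e1) := cf a.
move=> /nbhs_normP[r /= r0 yr].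
have h0 : \forall h \near (0 : 'rV[R]_n), `|h| < r by exact: nbhs0_lt.
suff main (h : 'rV[R]_n) : `|h| < r ->
    `|(f \o shift y - (cst (f y) + dotg D)) h| <= e * `|h|.
  by move: h0; apply: filterS => h /main.
move=> hr.
(* Truncation of h to its first k coordinates: the vertices of the path from y to y + h. *)
pose tr k : 'rV[R]_n := \row_a (if (a < k)%N then h 0 a else 0).
have trn : tr n = h by apply/rowP => a; rewrite mxE ltn_ord.
have tr0 : tr 0%N = 0 by apply/rowP => a; rewrite !mxE.
have trS (k : 'I_n) : tr k.+1 = tr k + h 0 k *: stdvec R k.
  apply/rowP => a; rewrite !mxE eqxx /= ltnS leq_eqVlt.
  have [->|ak] := eqVneq a k; first by rewrite eqxx ltnn /= add0r mulr1.
  by rewrite (_ : (a == k :> nat) = false) /= ?mulr0 ?addr0//; apply/negbTE.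
have trb (k : 'I_n) t : 0 <= t <= 1 -> `|tr k + t *: (h 0 k *: stdvec R k)| <= `|h|.
  move=> /andP[t0 t1]; apply: rV_norm_le => // a; rewrite !mxE eqxx /=.
  have [->|ak] := eqVneq a k.
    rewrite ltnn add0r mulr1 normrM (ger0_norm t0) (le_trans _ (rV_norm_coord h k))//.
    by rewrite ler_piMl.
  rewrite !mulr0 addr0; case: ifP => _; first exact: rV_norm_coord.
  by rewrite normr0.
have step (k : 'I_n) : exists2 z, `|z - y| <= `|h| &
    f (y + tr k.+1) - f (y + tr k) = h 0 k * partial k f z.
  have [t t01|t t01] := @MVT_line n f (y + tr k) (h 0 k *: stdvec R k).
    apply/ex_derive/is_derive_scale; apply: df.
    apply: (proj1 (yr _ _)); rewrite /= -addrA opprD addNKr normrN.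
    exact: le_lt_trans (trb _ _ t01) hr.
  rewrite -addrA -trS => ->.
  exists (y + tr k + t *: (h 0 k *: stdvec R k)).
    set w := _ *: _; have -> : y + tr k + w - y = tr k + w by rewrite addrC !addrA addNr add0r.
    exact: trb.
  apply: derive_val; apply: is_derive_scale; apply: df.
  apply: (proj1 (yr _ _)); rewrite /= -addrA opprD addNKr normrN.
  exact: le_lt_trans (trb _ _ t01) hr.
have -> : (f \o shift y - (cst (f y) + dotg D)) h =
    \sum_(k < n) (f (y + tr k.+1) - f (y + tr k) - h 0 k * partial k f y).
  rewrite sumrB -(big_mkord xpredT (fun k => f (y + tr k.+1) - f (y + tr k))).
  rewrite telescope_sumr// trn tr0 addr0 opprD addrA [y + h]addrC; congr (_ - _).
  by apply: eq_bigr => a _; rewrite mxE.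
apply: (le_trans (ler_norm_sum _ _ _)).
apply: (@le_trans _ _ (\sum_(k < n) `|h| * (e / n.+1%:R))).
  apply: ler_sum => k _; have [z zh ->] := step k.
  rewrite -mulrBr normrM ler_pM//; first exact: rV_norm_coord.
  rewrite distrC ltW//; apply: (proj2 (yr _ _)).
  by rewrite /= distrC (le_lt_trans zh).
rewrite sumr_const card_ord -[leLHS]mulr_natr -mulrA mulrC ler_wpM2r//=.
rewrite mulrAC ler_pdivrMr// ler_wpM2l//; first exact: ltW.
by rewrite ler_nat ltnW.
Qed.

Lemma derive_comp1 n (f : 'rV[R]_n -> R) (F : R -> R) (a : R) (y v : 'rV[R]_n) :
  differentiable f y -> is_derive (f y) 1 F a ->
  differentiable (fun z => F (f z)) y /\ 'D_v (fun z => F (f z)) y = a * 'D_v f y.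
Proof.
move=> df [dF <-].
have dF' : differentiable F (f y) by apply/derivable1_diffP.
have dc : differentiable (F \o f) y by exact: differentiable_comp.
split => //; rewrite !deriveE// diff_comp//= diff1E//= mulrC derive1E deriveE//.
by rewrite scale1r.
Qed.

Lemma differentiable_rV n m (h : 'rV[R]_n -> 'rV[R]_m) (y : 'rV[R]_n) :
  (forall b, differentiable (fun z => h z 0 b) y) -> differentiable h y.
Proof.
move=> dh; have -> : h = \sum_b (fun z => h z 0 b *: stdvec R b).
  by apply/funext => z; rewrite fct_sumE -row_sum_delta.
by apply: differentiable_sum => b; exact: differentiableZl.
Qed.

Lemma derive_compn n m (f : 'rV[R]_m -> R) (h : 'rV[R]_n -> 'rV[R]_m)
    (y v : 'rV[R]_n) :
  differentiable h y -> differentiable f (h y) ->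
  differentiable (fun z => f (h z)) y /\
  'D_v (fun z => f (h z)) y = 'D_('D_v h y) f (h y).
Proof.
move=> dh df; have dc : differentiable (f \o h) y by exact: differentiable_comp.
by split => //; rewrite !deriveE// diff_comp.
Qed.

Lemma derive_coordf n m (h : 'rV[R]_n -> 'rV[R]_m) (y v : 'rV[R]_n) b :
  differentiable h y -> ('D_v h y) 0 b = 'D_v (fun z => h z 0 b) y.
Proof.
move=> dh.
have E w : dotg (stdvec R b) w = w 0 b.
  rewrite /dotg (bigD1 b)//= big1 ?addr0 => [|a ab]; first by rewrite mxE !eqxx mulr1.
  by rewrite mxE (negbTE ab) andbF mulr0.
have dd : differentiable (dotg (stdvec R b) : _ -> R) (h y).
  exact: linear_differentiable (@dotg_continuous _ _) .
have [_] := derive_compn v dh dd.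
rewrite [X in _ = X]deriveE// diff_lin; last exact: dotg_continuous.
rewrite [X in _ = X -> _]E => <-; congr ('D_v _ y).
by apply/funext => z; rewrite E.
Qed.

(* The derivatives of exp(- tau / s), extended by 0, are all of this form. *)
Definition flatp (tau : R) (p : {poly R}) (s : R) : R :=
  if 0 < s then p.[s^-1] * expR (- tau * s^-1) else 0.

(** As exp(tau x) is the (j+1)-st power of exp(tau x / (j+1)), the inequality exp z >= 1 + z bounds
    x, and raising to the power j+1 gives the constant. *)
Lemma monomial_expR_le (tau : R) (j : nat) : 0 < tau ->
  exists2 C : R, 0 <= C & forall x, 0 < x -> x ^+ j.+1 * expR (- tau * x) <= C.
Proof.
move=> t0; exists ((j.+1%:R / tau) ^+ j.+1) => [|x x0].
  by rewrite exprn_ge0// divr_ge0// ltW.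
rewrite mulNr expRN ler_pdivrMr ?expR_gt0//.
have -> : tau * x = j.+1%:R * (tau * x / j.+1%:R) by field.
rewrite expRM_natl -exprMn.
have H : x <= j.+1%:R / tau * expR (tau * x / j.+1%:R).
  rewrite -ler_pdivrMl ?divr_gt0// invf_div.
  by apply: le_trans (expR_ge1Dx _); rewrite mulrAC lerDr.
apply: lerXn2r H; rewrite nnegrE; first exact: ltW.
by rewrite mulr_ge0// ?expR_ge0// divr_ge0// ltW.
Qed.

(** Substituting x = 1/s turns this into a bound on polynomials times exp(- tau x). The square makes
    the difference quotient at 0 tend to 0. *)
Lemma flatp_le (tau : R) (p : {poly R}) : 0 < tau ->
  exists2 C : R, 0 <= C & forall s, `|flatp tau p s| <= C * s ^+ 2.
Proof.
move=> t0.
suff [C C0 H] : exists2 C : R, 0 <= C &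
    forall x, 0 < x -> `|p.[x]| * expR (- tau * x) * x ^+ 2 <= C.
  exists C => // s; rewrite /flatp; case: ifP => [s0|_]; last first.
    by rewrite normr0 mulr_ge0// sqr_ge0.
  have sV : 0 < s^-1 by rewrite invr_gt0.
  rewrite normrM (ger0_norm (expR_ge0 _)).
  by rewrite -ler_pdivrMr ?exprn_gt0// -exprVn H.
have Cj j := cid2 (@monomial_expR_le tau j t0).
pose C := \sum_(i < size p) `|p`_i| * s2val (Cj i.+1).
have Cge j : 0 <= s2val (Cj j) by case: (Cj j).
exists C => [|x x0]; first by apply: sumr_ge0 => i _; rewrite mulr_ge0.
rewrite horner_coef.
apply: (@le_trans _ _ ((\sum_(i < size p) `|p`_i * x ^+ i|) * expR (- tau * x) * x ^+ 2)).
  rewrite ler_wpM2r ?sqr_ge0// ler_wpM2r ?expR_ge0//; exact: ler_norm_sum.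
rewrite !mulr_suml; apply: ler_sum => i _.
rewrite normrM -!mulrA ler_wpM2l// normrX (ger0_norm (ltW x0)) mulrCA mulrC -exprD.
by rewrite addn2; case: (Cj i.+1) => c c0 /= /(_ _ x0).
Qed.

(** For s > 0 the inner derivative of 1/s is - 1/s^2, which gives the factor ['X ^+ 2]; the
    exponential contributes tau p and the polynomial - p'. At s = 0 the quadratic bound [flatp_le]
    forces derivative 0, which is also the value of the new member of the family. *)
Lemma flatp_derive (tau : R) (p : {poly R}) (s : R) : 0 < tau ->
  is_derive s 1 (flatp tau p) (flatp tau ('X ^+ 2 * (tau *: p - p^`())) s).
Proof.
move=> t0; have [s0|s0|s0] := ltrgtP s 0.
- have E : \near s, cst 0 s = flatp tau p s.
    near=> z; rewrite /flatp /= ltNge ltW//.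
    by near: z; exact: lt_nbhsl.
  rewrite /flatp ltNge ltW//=; apply: (near_eq_is_derive E).
- have E : \near s, (fun s => p.[s^-1] * expR (- tau * s^-1)) s = flatp tau p s.
    near=> z; rewrite /flatp /= ifT//.
    by near: z; exact: lt_nbhsr.
  apply: (near_eq_is_derive E).
  have sn : s != 0 by rewrite gt_eqF.
  have dV : is_derive s 1 (fun s : R => s^-1) (- s ^- 2).
    have := is_deriveV sn (is_derive_id s 1).
    by rewrite [_ *: _]mulr1.
  have d1 := is_derive1_comp (is_derive_poly p s^-1) dV.
  have d2 := @is_derive1_comp R expR (fun s : R => - tau * s^-1) s _ _
    (is_derive_expR (- tau * s^-1)) (is_deriveZ (- tau) dV).
  refine (is_derive_eq (is_deriveM d1 d2) _).
  rewrite /flatp s0 !hornerE /=.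
  by rewrite /GRing.scale /=; field.
- have [C C0 HC] := flatp_le p t0.
  have q0 q : flatp tau q 0 = 0 by rewrite /flatp ltxx.
  have H : (fun h : R => h^-1 *: ((flatp tau p \o shift 0) (h *: 1) - flatp tau p 0)) @ 0^' --> (0 : R).
    rewrite q0.
    apply/cvgr0Pnorm_le => e e0; near=> h.
    rewrite /= [h *: 1]mulr1 addr0 subr0 normrM normfV.
    have hn : h != 0 by near: h; exact: nbhs_dnbhs_neq.
    rewrite ler_pdivrMl ?normr_gt0//; apply: (le_trans (HC h)).
    rewrite -[h ^+ 2]real_normK ?num_real// expr2 mulrCA ler_wpM2l//.
    have : `|h| < e / (C + 1).
      near: h; apply: dnbhs0_lt; rewrite divr_gt0//; lra.
    rewrite ltr_pdivlMr; last lra.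
    move=> /ltW; apply: le_trans; rewrite mulrC ler_wpM2l//; lra.
  by rewrite s0 q0; split; [apply/cvg_ex; exists 0|exact: cvg_lim].
Unshelve. all: by end_near. Qed.

(** * Closure properties of smooth functions on an open set *)

Lemma smooth_on_derivable n (O : set 'rV[R]_n) f y a :
  smooth_on O f -> O y -> derivable f y (stdvec R a).
Proof. by move=> sf Oy; have [_] := sf [::] y Oy; exact. Qed.

Lemma smooth_on_partial n (O : set 'rV[R]_n) f a :
  smooth_on O f -> smooth_on O (partial a f).
Proof. by move=> sf s y Oy; have := sf (rcons s a) y Oy; rewrite foldr_rcons. Qed.

Lemma smooth_on_differentiable n (O : set 'rV[R]_n) f y :
  open O -> smooth_on O f -> O y -> differentiable f y.
Proof.
move=> Oop sf Oy; apply: (C1_differentiable Oop Oy) => [z a Oz|a].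
  exact: smooth_on_derivable Oz.
by have [] := sf [:: a] y Oy.
Qed.

Lemma smooth_onS n (O O' : set 'rV[R]_n) f :
  O' `<=` O -> smooth_on O f -> smooth_on O' f.
Proof. by move=> OO' sf s y /OO'; exact: sf. Qed.

Lemma smooth_on_cst n (O : set 'rV[R]_n) (c : R) : smooth_on O (cst c).
Proof.
have H s : exists c' : R, foldr (@partial R n) (cst c) s = cst c'.
  elim: s => [|a s [c' IH]]; first by exists c.
  by exists 0; rewrite /= IH; apply/funext => z; rewrite /partial derive_cst.
move=> s y _; have [c' ->] := H s; split.
  exact/differentiable_continuous/differentiable_cst.
by move=> a; exact: derivable_cst.
Qed.

Lemma partial_eq_on n (O : set 'rV[R]_n) (f g : 'rV[R]_n -> R) a y :
  open O -> (forall z, O z -> f z = g z) -> O y -> partial a f y = partial a g y.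
Proof.
move=> Oop fg Oy; apply: near_eq_derive.
by apply: filterS (open_nbhs_nbhs (conj Oop Oy)) => z; exact: fg.
Qed.

Lemma near_eq_differentiable n (f g : 'rV[R]_n -> R) y :
  (\near y, f y = g y) -> differentiable f y -> differentiable g y.
Proof.
move=> fg df.
have fgy : f y = g y := nbhs_singleton fg.
have [cf Ef] := (diff_locallyP _ _).1 df.
pose D : {linear 'rV[R]_n -> R^o} := 'd f y.
suff H : (g \o shift y : 'rV[R]_n -> R) = cst (g y) + (D : 'rV[R]_n -> R) +o_ (0 : 'rV[R]_n) id.
  by apply/diff_locallyP; rewrite (diff_unique cf H).
move/eqaddoP: Ef => Ef; apply/eqaddoP => e e0.
have fg0 : \forall x \near (0 : 'rV[R]_n), f (x + y) = g (x + y).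
  move/nbhs_normP: fg => [r /= r0 fg]; apply: filterS (nbhs0_lt r0) => x xr.
  by apply: fg; rewrite /= opprD addrCA subrr addr0 normrN.
apply: filterS2 fg0 (Ef e e0) => x fgx.
change (`|f (x + y) - (f y + 'd f y x)| <= e * `|x| ->
  `|g (x + y) - (g y + 'd f y x)| <= e * `|x|).
by rewrite fgx fgy.
Qed.

(* Closed under partial derivatives and made of differentiable functions, hence
   contained in [smooth_on O]: this gives all closure properties at once. *)
Inductive smooth_gen n (O : set 'rV[R]_n) : ('rV[R]_n -> R) -> Prop :=
| sg_base f : smooth_on O f -> smooth_gen O f
| sg_add f g : smooth_gen O f -> smooth_gen O g -> smooth_gen O (fun y => f y + g y)
| sg_mul f g : smooth_gen O f -> smooth_gen O g -> smooth_gen O (fun y => f y * g y)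
| sg_inv f : smooth_gen O f -> (forall y, O y -> f y != 0) ->
    smooth_gen O (fun y => (f y)^-1)
| sg_sqrt f : smooth_gen O f -> (forall y, O y -> 0 < f y) ->
    smooth_gen O (fun y => Num.sqrt (f y))
| sg_flat tau p f : 0 < tau -> smooth_gen O f -> smooth_gen O (fun y => flatp tau p (f y))
| sg_comp m (O' : set 'rV[R]_m) f (h : 'rV[R]_n -> 'rV[R]_m) :
    open O' -> smooth_on O' f -> (forall b, smooth_gen O (fun y => h y 0 b)) ->
    (forall y, O y -> O' (h y)) -> smooth_gen O (fun y => f (h y))
| sg_eq f g : (forall y, O y -> f y = g y) -> smooth_gen O f -> smooth_gen O g.

Lemma sg_sum n (O : set 'rV[R]_n) (I : Type) (r : seq I) (P : pred I)
    (F : I -> 'rV[R]_n -> R) : (forall i, P i -> smooth_gen O (F i)) ->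
  smooth_gen O (fun y => \sum_(i <- r | P i) F i y).
Proof.
move=> H; elim: r => [|i r IH].
  apply: (@sg_eq _ _ (cst 0)) => [y _|]; first by rewrite big_nil.
  exact/sg_base/smooth_on_cst.
case Pi : (P i); last by apply: sg_eq IH => y _; rewrite big_cons Pi.
by apply: (sg_eq _ (sg_add (H i Pi) IH)) => y _; rewrite big_cons Pi.
Qed.

(** Induction over the generators: the sum, product and chain rules express each partial derivative
    through generators again. In the [sg_flat] and [sg_comp] cases the derivative replaces p,
    respectively f, which is why these are arbitrary in the constructors. *)
Lemma smooth_genP n (O : set 'rV[R]_n) f : open O -> smooth_gen O f ->
  (forall y, O y -> differentiable f y) /\ forall a, smooth_gen O (partial a f).
Proof.
move=> Oop; elim => {f}.
- move=> f sf; split=> [y|a]; first exact: smooth_on_differentiable.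
  exact/sg_base/smooth_on_partial.
- move=> f g gf [df pf] gg [dg pg]; split=> [y Oy|a].
    by apply: differentiableD; [exact: df|exact: dg].
  apply: (sg_eq _ (sg_add (pf a) (pg a))) => y Oy.
  have dfy := @diff_derivable _ _ _ _ _ (stdvec R a) (df y Oy).
  exact: esym (deriveD dfy (@diff_derivable _ _ _ _ _ (stdvec R a) (dg y Oy))).
- move=> f g gf [df pf] gg [dg pg]; split=> [y Oy|a].
    by apply: differentiableM; [exact: df|exact: dg].
  apply: (sg_eq _ (sg_add (sg_mul gf (pg a)) (sg_mul gg (pf a)))) => y Oy.
  have dfy := @diff_derivable _ _ _ _ _ (stdvec R a) (df y Oy).
  exact: esym (deriveM dfy (@diff_derivable _ _ _ _ _ (stdvec R a) (dg y Oy))).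
- move=> f gf [df pf] f0; split=> [y Oy|a].
    by apply: differentiableV; [exact: df|exact: f0].
  have gV := sg_inv gf f0.
  apply: (@sg_eq _ _ (fun y => -1 * (partial a f y * ((f y)^-1 * (f y)^-1)))) => [y Oy|].
    rewrite /partial deriveV; [|exact: f0|exact/diff_derivable/df].
    by rewrite mulN1r /GRing.scale /= mulNr expr2 invfM mulrC.
  apply: (@sg_mul n O (fun=> -1)); first exact/sg_base/smooth_on_cst.
  by apply: sg_mul => //; exact: sg_mul.
- move=> f gf [df pf] f0.
  have d y (Oy : O y) v := derive_comp1 v (df y Oy) (is_derive1_sqrt (f0 y Oy)).
  split=> [y Oy|a]; first by case: (d y Oy 0).
  have fn y : O y -> Num.sqrt (f y) != 0 by move=> Oy; rewrite gt_eqF// sqrtr_gt0 f0.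
  have gV := sg_inv (sg_sqrt gf f0) fn.
  apply: (@sg_eq _ _ (fun y => 2^-1 * (partial a f y * (Num.sqrt (f y))^-1))) => [y Oy|].
    case: (d y Oy (stdvec R a)) => _; rewrite /partial => ->.
    by rewrite invfM mulrCA mulrC -mulrA.
  apply: (@sg_mul n O (fun=> 2^-1)); first exact/sg_base/smooth_on_cst.
  exact: sg_mul.
- move=> tau p f t0 gf [df pf].
  have d y (Oy : O y) v := derive_comp1 v (df y Oy) (flatp_derive p (f y) t0).
  split=> [y Oy|a]; first by case: (d y Oy 0).
  apply: (sg_eq _ (sg_mul (sg_flat ('X ^+ 2 * (tau *: p - p^`())) t0 gf) (pf a))) => y Oy /=.
  by case: (d y Oy (stdvec R a)) => _; rewrite /partial => ->.
- move=> m O' f h O'op sf gh Hh hO.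
  have dh y : O y -> differentiable h y.
    by move=> Oy; apply: differentiable_rV => b; apply: (Hh b).1.
  have df y : O y -> differentiable f (h y).
    by move=> Oy; apply: smooth_on_differentiable (hO _ Oy).
  split=> [y Oy|a]; first by case: (derive_compn 0 (dh _ Oy) (df _ Oy)).
  apply: (@sg_eq _ _ (fun y => \sum_(b < m) partial a (fun y => h y 0 b) y * partial b f (h y))).
    move=> y Oy; rewrite /partial (derive_compn _ (dh _ Oy) (df _ Oy)).2.
    rewrite differentiable_deriveE; last exact: df.
    by apply: eq_bigr => b _; rewrite derive_coordf//; exact: dh.
  apply: sg_sum => b _; apply: sg_mul; first exact: (Hh b).2.
  exact: sg_comp O'op (smooth_on_partial b sf) gh hO.
- move=> f g fg gf [df pf]; split=> [y Oy|a].
    apply: near_eq_differentiable (df y Oy).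
    by apply: filterS (open_nbhs_nbhs (conj Oop Oy)) => z; exact: fg.
  by apply: sg_eq (pf a) => y Oy; exact: partial_eq_on fg Oy.
Qed.

Lemma smooth_on_gen n (O : set 'rV[R]_n) f : open O -> smooth_gen O f -> smooth_on O f.
Proof.
move=> Oop gf s.
have gs : smooth_gen O (foldr (@partial R n) f s).
  by elim: s => //= a s IH; exact: (smooth_genP Oop IH).2.
move=> y Oy; have d := (smooth_genP Oop gs).1 y Oy.
by split=> [|a]; [exact: differentiable_continuous|exact: diff_derivable].
Qed.

Section SmoothOn.
Context (n : nat) (O : set 'rV[R]_n) (Oop : open O).
Implicit Types f g : 'rV[R]_n -> R.

Lemma smooth_eq f g : (forall y, O y -> f y = g y) -> smooth_on O f -> smooth_on O g.
Proof. by move=> fg sf; apply: smooth_on_gen => //; apply: sg_eq fg _; exact: sg_base. Qed.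

Lemma smoothD f g : smooth_on O f -> smooth_on O g -> smooth_on O (fun y => f y + g y).
Proof. by move=> sf sg; apply: smooth_on_gen => //; apply: sg_add; exact: sg_base. Qed.

Lemma smoothM f g : smooth_on O f -> smooth_on O g -> smooth_on O (fun y => f y * g y).
Proof. by move=> sf sg; apply: smooth_on_gen => //; apply: sg_mul; exact: sg_base. Qed.

Lemma smoothV f : smooth_on O f -> (forall y, O y -> f y != 0) ->
  smooth_on O (fun y => (f y)^-1).
Proof. by move=> sf f0; apply: smooth_on_gen => //; apply: sg_inv => //; exact: sg_base. Qed.

Lemma smooth_sqrt f : smooth_on O f -> (forall y, O y -> 0 < f y) ->
  smooth_on O (fun y => Num.sqrt (f y)).
Proof. by move=> sf f0; apply: smooth_on_gen => //; apply: sg_sqrt => //; exact: sg_base. Qed.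

Lemma smooth_flatp tau p f : 0 < tau -> smooth_on O f ->
  smooth_on O (fun y => flatp tau p (f y)).
Proof. by move=> t0 sf; apply: smooth_on_gen => //; apply: sg_flat => //; exact: sg_base. Qed.

Lemma smooth_comp m (O' : set 'rV[R]_m) (f : 'rV[R]_m -> R) (h : 'rV[R]_n -> 'rV[R]_m) :
  open O' -> smooth_on O' f -> (forall b, smooth_on O (fun y => h y 0 b)) ->
  (forall y, O y -> O' (h y)) -> smooth_on O (fun y => f (h y)).
Proof.
move=> O'op sf sh hO; apply: smooth_on_gen => //; apply: sg_comp hO => // b.
exact: sg_base.
Qed.

Lemma smoothB f g : smooth_on O f -> smooth_on O g -> smooth_on O (fun y => f y - g y).
Proof.
move=> sf sg; apply: (@smooth_eq (fun y => f y + (-1) * g y)) => [y _|].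
  by rewrite mulN1r.
apply: (@smoothD f (fun y => -1 * g y) sf).
by apply: (@smoothM (fun=> -1) g _ sg); exact: smooth_on_cst.
Qed.

Lemma smooth_sum (I : Type) (r : seq I) (P : pred I) (F : I -> 'rV[R]_n -> R) :
  (forall i, P i -> smooth_on O (F i)) ->
  smooth_on O (fun y => \sum_(i <- r | P i) F i y).
Proof.
by move=> sF; apply: smooth_on_gen => //; apply: sg_sum => i Pi; apply/sg_base/sF.
Qed.

Lemma smooth_prod (I : Type) (r : seq I) (P : pred I) (F : I -> 'rV[R]_n -> R) :
  (forall i, P i -> smooth_on O (F i)) ->
  smooth_on O (fun y => \prod_(i <- r | P i) F i y).
Proof.
move=> H; elim: r => [|i r IH].
  apply: (@smooth_eq (cst 1)) => [y _|]; first by rewrite big_nil.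
  exact/smooth_on_cst.
case Pi : (P i); last by apply: smooth_eq IH => y _; rewrite big_cons Pi.
by apply: (smooth_eq _ (smoothM (H i Pi) IH)) => y _; rewrite big_cons Pi.
Qed.

Lemma smooth_coord a : smooth_on O (fun y => y 0 a).
Proof.
have E b y : 'D_(stdvec R b) (fun z : 'rV[R]_n => z 0 a) y = (stdvec R b) 0 a.
  rewrite -(@derive_coordf n n id y (stdvec R b) a); first by rewrite derive_id.
  by case: (@is_diff_id R 'rV[R]_n y).
have P b : partial b (fun y : 'rV[R]_n => y 0 a) = cst ((stdvec R b) 0 a).
  by apply/funext => y; exact: E.
move=> s y Oy; case: (lastP s) => [|r b].
  split=> [|b]; first exact/differentiable_continuous/differentiable_coord.
  exact/diff_derivable/differentiable_coord.
by rewrite foldr_rcons P; exact: (@smooth_on_cst n O).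
Qed.

End SmoothOn.

(* s exp(- tau / s) is a smooth 1-Lipschitz function of s, close to max(s, 0). *)
Definition theta (tau s : R) : R := s * flatp tau 1 s.

Section Theta.
Variables (tau : R) (tau0 : 0 < tau).

Lemma flatp1 (s : R) : 0 < s -> flatp tau 1 s = expR (- (tau / s)).
Proof. by move=> s0; rewrite /flatp s0 -polyC1 hornerC mul1r mulNr. Qed.

Definition theta' (s : R) : R := flatp tau 1 s + s * flatp tau ('X ^+ 2 * (tau *: 1)) s.

Lemma theta'E s : theta' s = if 0 < s then (1 + tau / s) * expR (- (tau / s)) else 0.
Proof.
rewrite /theta' /flatp; case: ifP => s0; last by rewrite mulr0 addr0.
rewrite !hornerE /= mulNr; have sn : s != 0 by rewrite gt_eqF.
by field.
Qed.

Lemma theta_derive (s : R) : is_derive s 1 (theta tau) (theta' s).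
Proof.
have D := flatp_derive 1 s tau0.
refine (is_derive_eq (is_deriveM (is_derive_id s 1) D) _).
rewrite derivC subr0 /theta' addrC; congr (_ + _).
by rewrite /GRing.scale /= mulr1.
Qed.

(** The upper bound is 1 + x <= exp x at x = tau / s. Composing with [theta] therefore never
    increases a gradient. *)
Lemma theta'_itv s : 0 <= theta' s <= 1.
Proof.
rewrite theta'E; case: ifP => s0; last by rewrite lexx ler01.
have ts : 0 <= tau / s by rewrite divr_ge0// ltW.
apply/andP; split; first by rewrite mulr_ge0// ?expR_ge0// addr_ge0.
by rewrite expRN ler_pdivrMr ?expR_gt0// mul1r expR_ge1Dx.
Qed.

Lemma theta_le0 s : s <= 0 -> theta tau s = 0.
Proof. by rewrite /theta /flatp ltNge => ->; rewrite mulr0. Qed.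

Lemma theta_gt0 s : 0 < s -> 0 < theta tau s.
Proof. by move=> s0; rewrite /theta flatp1// mulr_gt0// expR_gt0. Qed.

Lemma theta_ge0 s : 0 <= theta tau s.
Proof. by have [/theta_le0->//|/theta_gt0/ltW] := leP s 0. Qed.

Lemma theta'_le0 s : s <= 0 -> theta' s = 0.
Proof. by rewrite theta'E ltNge => ->. Qed.

(** By exp(- x) >= 1 - x at x = tau / s, the loss against max(s, 0) is at most tau. *)
Lemma theta_ge s : s - tau <= theta tau s.
Proof.
have [s0|s0] := leP s 0; first by rewrite theta_le0// subr_le0 (le_trans s0)// ltW.
rewrite /theta flatp1//.
have : s * (1 - tau / s) <= s * expR (- (tau / s)).
  by apply: ler_wpM2l; [exact: ltW|exact: expR_ge1Dx].
by apply: le_trans; rewrite mulrBr mulr1 mulrCA divff ?gt_eqF// mulr1.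
Qed.

End Theta.

Lemma smooth_theta n (O : set 'rV[R]_n) tau f : open O -> 0 < tau ->
  smooth_on O f -> smooth_on O (fun y => theta tau (f y)).
Proof. by move=> Oop t0 sf; apply: (smoothM Oop sf); exact: smooth_flatp. Qed.

Lemma nbhs_norm_lt n (y : 'rV[R]_n) (r : R) : 0 < r -> nbhs y [set z | `|z - y| < r].
Proof.
move=> r0; have := nbhsx_ballx y r r0; apply: filterS => z.
by rewrite -ball_normE /= distrC.
Qed.

Lemma nbhs_norm_ex n (y : 'rV[R]_n) (A : set 'rV[R]_n) : nbhs y A ->
  exists2 r : R, 0 < r & forall z, `|z - y| < r -> A z.
Proof.
move=> /nbhs_normP[r /= r0 yr]; exists r => // z zr; apply: yr.
by rewrite /= distrC.
Qed.

Lemma open_norm_lt n (y : 'rV[R]_n) (r : R) : open [set z | `|z - y| < r].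
Proof.
rewrite openE => z /= zr; have e0 : 0 < r - `|z - y| by rewrite subr_gt0.
apply: filterS (nbhs_norm_lt z e0) => w /= wz.
by have := ler_distD z w y; lra.
Qed.

Lemma compact_norm_le n (y : 'rV[R]_n) (r : R) : compact [set z : 'rV[R]_n | `|z - y| <= r].
Proof.
apply: bounded_closed_compact.
  exists (r + `|y|); split; [exact: num_real|move=> x rx z /= zr].
  by have := ler_distD y z 0; rewrite !subr0; lra.
rewrite (_ : [set _ | _] = ~` [set z | r < `|z - y|]); last first.
  by apply/seteqP; split => z /=; rewrite leNgt => /negP.
apply: open_closedC; rewrite openE => z /= zr; have e0 : 0 < `|z - y| - r by rewrite subr_gt0.
apply: filterS (nbhs_norm_lt z e0) => w /= wz.
by have := ler_distD w z y; rewrite [`|z - w|]distrC; lra.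
Qed.

End Calculus.

(** * Multilinear algebra *)

Section Algebra.
Context {R : realType} {n : nat}.

(** Inverse to the pair [row j], [row' j]. It lets any row be singled out without casts; position 0
    is the [col_mx] of [contract]. *)
Definition ins_row k (j : 'I_k.+1) (v : 'rV[R]_n) (B : 'M[R]_(k, n)) : 'M[R]_(k.+1, n) :=
  \matrix_(l, c) (if unlift j l is Some l' then B l' c else v 0 c).

Lemma row_ins k (j : 'I_k.+1) v (B : 'M[R]_(k, n)) : row j (ins_row j v B) = v.
Proof. by apply/rowP => c; rewrite !mxE unlift_none. Qed.

Lemma row'_ins k (j : 'I_k.+1) v (B : 'M[R]_(k, n)) : row' j (ins_row j v B) = B.
Proof. by apply/matrixP => l c; rewrite !mxE liftK. Qed.

Lemma ins_rowK k (j : 'I_k.+1) (A : 'M[R]_(k.+1, n)) : ins_row j (row j A) (row' j A) = A.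
Proof.
by apply/matrixP => l c; rewrite mxE; case: unliftP => [l'|] ->; rewrite !mxE.
Qed.

Lemma ins_row0 k v (B : 'M[R]_(k, n)) : ins_row 0 v B = col_mx v B.
Proof.
apply/matrixP => l c; rewrite !mxE; case: unliftP => [l'|] ->.
  case: splitP => [j /= /eqP|j /= [jl]]; first by rewrite (ord1 j).
  by congr (B _ _); apply: val_inj.
case: splitP => [j _|j //]; by rewrite (ord1 j).
Qed.

Lemma mul_ins_row k (j : 'I_k.+1) v (B : 'M[R]_(k, n)) (P : 'M[R]_n) :
  ins_row j v B *m P = ins_row j (v *m P) (B *m P).
Proof.
apply/matrixP => l c; rewrite !mxE; case: unliftP => [l'|] ->.
  by rewrite !mxE; apply: eq_bigr => a _; rewrite !mxE liftK.
by apply: eq_bigr => a _; rewrite !mxE unlift_none.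
Qed.

Lemma row0_col_mx k (v : 'rV[R]_n) (B : 'M[R]_(k, n)) : row 0 (col_mx v B) = v.
Proof. by rewrite -ins_row0 row_ins. Qed.

Lemma row'0_col_mx k (v : 'rV[R]_n) (B : 'M[R]_(k, n)) : row' 0 (col_mx v B) = B.
Proof. by rewrite -ins_row0 row'_ins. Qed.

Section Multilinear.
Variables (k : nat) (w : 'M[R]_(k.+1, n) -> R).
Hypothesis wlin : multilinear_rows w.

Lemma w_ins_lin j (b c : R) (u v : 'rV[R]_n) B :
  w (ins_row j (b *: u + c *: v) B) = b * w (ins_row j u B) + c * w (ins_row j v B).
Proof. by apply: (wlin (l := j)); rewrite ?row_ins ?row'_ins. Qed.

Lemma w_insD j (u v : 'rV[R]_n) B :
  w (ins_row j (u + v) B) = w (ins_row j u B) + w (ins_row j v B).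
Proof. by have := w_ins_lin j 1 1 u v B; rewrite !scale1r !mul1r. Qed.

Lemma w_insZ j b (u : 'rV[R]_n) B : w (ins_row j (b *: u) B) = b * w (ins_row j u B).
Proof. by have := w_ins_lin j b 0 u u B; rewrite scale0r mul0r !addr0. Qed.

Lemma w_ins0 j B : w (ins_row j 0 B) = 0.
Proof. by rewrite -(scale0r 0) w_insZ mul0r. Qed.

Lemma w_ins_sum j (I : Type) (r : seq I) (P : pred I) (F : I -> 'rV[R]_n) B :
  w (ins_row j (\sum_(i <- r | P i) F i) B) = \sum_(i <- r | P i) w (ins_row j (F i) B).
Proof.
by elim/big_rec2: _ => [|i y z _ <-]; [exact: w_ins0|rewrite w_insD].
Qed.

Lemma w_ins_basis j v B :
  w (ins_row j v B) = \sum_a v 0 a * w (ins_row j (stdvec R a) B).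
Proof.
by rewrite {1}(row_sum_delta v) w_ins_sum; apply: eq_bigr => a _; rewrite w_insZ.
Qed.

End Multilinear.

Lemma row_ins_lift k (j : 'I_k.+1) l v (B : 'M[R]_(k, n)) :
  row (lift j l) (ins_row j v B) = row l B.
Proof. by apply/rowP => c; rewrite !mxE liftK. Qed.

Lemma row'_ins_eq k (j : 'I_k.+2) (l : 'I_k.+1) v (A B : 'M[R]_(k.+1, n)) :
  row' l A = row' l B -> row' (lift j l) (ins_row j v A) = row' (lift j l) (ins_row j v B).
Proof.
move=> AB; apply/matrixP => m c; rewrite !mxE; case: unliftP => [m' Em|//].
have ml : l != m'.
  by apply/eqP => E; move: Em; rewrite -E => /esym/eqP; rewrite (negbTE (neq_lift _ _)).
have [p Ep _] := unlift_some ml; rewrite Ep.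
by have /matrixP/(_ p c) := AB; rewrite !mxE.
Qed.

Lemma multilinear_ins k (w : 'M[R]_(k.+1, n) -> R) j v :
  multilinear_rows w -> multilinear_rows (fun B : 'M[R]_(k, n) => w (ins_row j v B)).
Proof.
case: k w j v => [|k] w j v wl A B C l b c; first by case: l.
move=> rA rB rC; apply: (wl _ _ _ (lift j l)); rewrite ?row_ins_lift//; exact: row'_ins_eq.
Qed.

Lemma alternating_ins k (w : 'M[R]_(k.+1, n) -> R) j v :
  alternating_rows w -> alternating_rows (fun B : 'M[R]_(k, n) => w (ins_row j v B)).
Proof.
move=> wa A l m lm rA; apply: (wa _ (lift j l) (lift j m)).
  by rewrite (inj_eq lift_inj).
by rewrite !row_ins_lift.
Qed.

Definition consi k (j : 'I_k.+1) (a : 'I_n) (I : {ffun 'I_k -> 'I_n}) : {ffun 'I_k.+1 -> 'I_n} :=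
  [ffun l => if unlift j l is Some l' then I l' else a].

Lemma stdrows_consi k j a (I : {ffun 'I_k -> 'I_n}) :
  stdrows R (consi j a I) = ins_row j (stdvec R a) (stdrows R I).
Proof.
apply/matrixP => l c; rewrite !mxE ffunE; case: unliftP => [l'|] _; first by rewrite mxE.
by rewrite eqxx.
Qed.

Lemma sum_consi k (j : 'I_k.+1) (F : {ffun 'I_k.+1 -> 'I_n} -> R) :
  \sum_I F I = \sum_a \sum_I F (consi j a I).
Proof.
rewrite pair_big/=.
pose h (p : 'I_n * {ffun 'I_k -> 'I_n}) := consi j p.1 p.2.
pose g (I : {ffun 'I_k.+1 -> 'I_n}) : 'I_n * {ffun 'I_k -> 'I_n} := (I j, [ffun l => I (lift j l)]).
rewrite (reindex h)//=; exists g => [[a I] _|I _].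
  rewrite /g /h /= ffunE unlift_none; congr pair.
  by apply/ffunP => l; rewrite !ffunE liftK.
by apply/ffunP => l; rewrite /g /h ffunE /=; case: unliftP => [l'|] ->; rewrite ?ffunE.
Qed.

Lemma sum_ffun0 (F : {ffun 'I_0 -> 'I_n} -> R) : \sum_I F I = F (ffun0 (card_ord 0)).
Proof.
rewrite (big_pred1 (ffun0 (card_ord 0)))// => I; apply/esym/eqP.
by apply/ffunP => -[].
Qed.

Lemma multilinear_expand k (w : 'M[R]_(k, n) -> R) : multilinear_rows w ->
  forall B, w B = \sum_(I : {ffun 'I_k -> 'I_n}) (\prod_l B l (I l)) * w (stdrows R I).
Proof.
elim: k w => [|k IH] w wl B.
  by rewrite sum_ffun0 big_ord0 mul1r; congr w; rewrite flatmx0 [RHS]flatmx0.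
rewrite (sum_consi 0) -{1}(ins_rowK 0 B) w_ins_basis//.
apply: eq_bigr => a _; rewrite mxE (IH (fun B => w (ins_row 0 (stdvec R a) B))); last exact: multilinear_ins.
rewrite mulr_sumr; apply: eq_bigr => I _; rewrite stdrows_consi mulrA; congr (_ * _).
rewrite big_ord_recl; congr (_ * _); first by rewrite ffunE unlift_none.
by apply: eq_bigr => l _; rewrite ffunE liftK !mxE.
Qed.

(** The inner product on covariant k-tensors induced by the inverse metric [H], without the factor
    1/k! of [form_dot]. *)
Definition Sdot k (H : 'M[R]_n) (w w' : 'M[R]_(k, n) -> R) : R :=
  \sum_(I : {ffun 'I_k -> 'I_n}) \sum_(J : {ffun 'I_k -> 'I_n})
    (\prod_(l < k) H (I l) (J l)) * w (stdrows R I) * w' (stdrows R J).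

Lemma Sdot_rec k (j : 'I_k.+1) H (w w' : 'M[R]_(k.+1, n) -> R) :
  Sdot H w w' = \sum_a \sum_b H a b *
    Sdot H (fun B => w (ins_row j (stdvec R a) B)) (fun B => w' (ins_row j (stdvec R b) B)).
Proof.
rewrite /Sdot (sum_consi j); apply: eq_bigr => a _.
under eq_bigr do rewrite (sum_consi j).
rewrite exchange_big; apply: eq_bigr => b _; rewrite mulr_sumr; apply: eq_bigr => I _.
rewrite mulr_sumr; apply: eq_bigr => J _.
rewrite !stdrows_consi !mulrA; congr (_ * _ * _).
rewrite (bigD1_ord j)//= !ffunE !unlift_none; congr (_ * _).
by apply: eq_bigr => l _; rewrite !ffunE !liftK.
Qed.

Lemma Sdot_suml k H (I : Type) (r : seq I) (P : pred I) (c : I -> R)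
    (w : I -> 'M[R]_(k, n) -> R) w' :
  Sdot H (fun B => \sum_(i <- r | P i) c i * w i B) w' =
  \sum_(i <- r | P i) c i * Sdot H (w i) w'.
Proof.
rewrite /Sdot.
under [RHS]eq_bigr => i _ do rewrite mulr_sumr.
rewrite [RHS]exchange_big; apply: eq_bigr => I0 _.
under [RHS]eq_bigr => i _ do rewrite mulr_sumr.
rewrite [RHS]exchange_big; apply: eq_bigr => J0 _.
rewrite mulr_sumr mulr_suml; apply: eq_bigr => i _.
by rewrite !mulrA [_ * c i]mulrC.
Qed.

Lemma Sdot_sumr k H (I : Type) (r : seq I) (P : pred I) (c : I -> R)
    (w : 'M[R]_(k, n) -> R) w' :
  Sdot H w (fun B => \sum_(i <- r | P i) c i * w' i B) =
  \sum_(i <- r | P i) c i * Sdot H w (w' i).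
Proof.
rewrite /Sdot.
under [RHS]eq_bigr => i _ do rewrite mulr_sumr.
rewrite [RHS]exchange_big; apply: eq_bigr => I0 _.
under [RHS]eq_bigr => i _ do rewrite mulr_sumr.
rewrite [RHS]exchange_big; apply: eq_bigr => J0 _.
by rewrite mulr_sumr; apply: eq_bigr => i _; rewrite mulrCA.
Qed.

Lemma SdotZl k H c (w w' : 'M[R]_(k, n) -> R) :
  Sdot H (fun B => c * w B) w' = c * Sdot H w w'.
Proof.
have := Sdot_suml H [:: tt] xpredT (fun=> c) (fun=> w) w'.
rewrite big_seq1 => <-; congr (Sdot _ _ _); apply/funext => B.
by rewrite big_seq1.
Qed.

Lemma SdotDl k H (u w w' : 'M[R]_(k, n) -> R) :
  Sdot H (fun B => u B + w B) w' = Sdot H u w' + Sdot H w w'.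
Proof.
have := Sdot_suml H [:: true; false] xpredT (fun=> 1) (fun b => if b then u else w) w'.
rewrite !big_cons !big_nil /= !mul1r !addr0 => <-; congr (Sdot _ _ _); apply/funext => B.
by rewrite !big_cons big_nil !mul1r addr0.
Qed.

Lemma SdotZr k H c (w w' : 'M[R]_(k, n) -> R) :
  Sdot H w (fun B => c * w' B) = c * Sdot H w w'.
Proof.
have := Sdot_sumr H [:: tt] xpredT (fun=> c) w (fun=> w').
rewrite big_seq1 => <-; congr (Sdot _ _ _); apply/funext => B.
by rewrite big_seq1.
Qed.

Lemma SdotDr k H (u w w' : 'M[R]_(k, n) -> R) :
  Sdot H w' (fun B => u B + w B) = Sdot H w' u + Sdot H w' w.
Proof.
have := Sdot_sumr H [:: true; false] xpredT (fun=> 1) w' (fun b => if b then u else w).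
rewrite !big_cons !big_nil /= !mul1r !addr0 => <-; congr (Sdot _ _ _); apply/funext => B.
by rewrite !big_cons big_nil !mul1r addr0.
Qed.

Lemma Sdot_trmx k (H : 'M[R]_n) (w w' : 'M[R]_(k, n) -> R) : Sdot H^T w w' = Sdot H w' w.
Proof.
rewrite /Sdot exchange_big; apply: eq_bigr => I _; apply: eq_bigr => J _.
rewrite mulrAC; congr (_ * _ * _); apply: eq_bigr => l _; by rewrite mxE.
Qed.

(** Taking a frame for [P] shows that the inner product does not depend on the chart; taking a
    square root of the inverse metric reduces it to a sum of squares. Each induction step peels off
    row 0 and expands it in the standard basis. *)
Lemma Sdot_base_change k (H P : 'M[R]_n) (w w' : 'M[R]_(k, n) -> R) :
  multilinear_rows w -> multilinear_rows w' ->
  Sdot (P^T *m H *m P) w w' = Sdot H (fun B => w (B *m P)) (fun B => w' (B *m P)).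
Proof.
elim: k w w' => [|k IH] w w' wl wl'.
  by rewrite /Sdot !sum_ffun0 !big_ord0; congr (_ * w _ * w' _);
    rewrite flatmx0 [RHS]flatmx0.
rewrite !(Sdot_rec 0).
have E (c d : 'I_n) : Sdot H (fun B => w (ins_row 0 (stdvec R c) B *m P))
      (fun B => w' (ins_row 0 (stdvec R d) B *m P)) =
    \sum_a P c a * \sum_b P d b * Sdot H (fun B => w (ins_row 0 (stdvec R a) (B *m P)))
      (fun B => w' (ins_row 0 (stdvec R b) (B *m P))).
  have Ew (u : 'M[R]_(k.+1, n) -> R) (ul : multilinear_rows u) e :
      (fun B => u (ins_row 0 (stdvec R e) B *m P)) =
      (fun B => \sum_a P e a * u (ins_row 0 (stdvec R a) (B *m P))).
    apply/funext => B; rewrite mul_ins_row -rowE w_ins_basis//.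
    by apply: eq_bigr => b _; rewrite mxE.
  rewrite !Ew// Sdot_suml; apply: eq_bigr => a _; congr (_ * _).
  by rewrite Sdot_sumr.
under [RHS]eq_bigr => c _ do under eq_bigr => d _ do rewrite E.
have E2 a b : Sdot (P^T *m H *m P) (fun B => w (ins_row 0 (stdvec R a) B))
    (fun B => w' (ins_row 0 (stdvec R b) B)) =
    Sdot H (fun B => w (ins_row 0 (stdvec R a) (B *m P)))
      (fun B => w' (ins_row 0 (stdvec R b) (B *m P))).
  by apply: IH; exact: multilinear_ins.
set T := fun a b => Sdot H (fun B => w (ins_row 0 (stdvec R a) (B *m P)))
      (fun B => w' (ins_row 0 (stdvec R b) (B *m P))).
transitivity (\sum_a \sum_b \sum_c \sum_d H c d * (P c a * (P d b * T a b))).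
  apply: eq_bigr => a _; apply: eq_bigr => b _; rewrite E2 -/(T a b) [in LHS]mxE mulr_suml [RHS]exchange_big.
  apply: eq_bigr => d _; rewrite mxE !mulr_suml; apply: eq_bigr => c _.
  by rewrite mxE; ring.
transitivity (\sum_c \sum_d \sum_a \sum_b H c d * (P c a * (P d b * T a b))).
  rewrite [RHS](eq_bigr (fun c => \sum_a \sum_b \sum_d H c d * (P c a * (P d b * T a b)))).
    rewrite [RHS]exchange_big; apply: eq_bigr => a _.
    by rewrite [RHS]exchange_big; apply: eq_bigr => b _.
  move=> c _; rewrite exchange_big; apply: eq_bigr => a _.
  by rewrite exchange_big.
apply: eq_bigr => c _; apply: eq_bigr => d _; rewrite mulr_sumr; apply: eq_bigr => a _.
by rewrite !mulr_sumr.
Qed.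

(** Polarization: as a function of the two rows alone, [w] is biadditive and vanishes on equal rows,
    so expanding it at (u + v, u + v) leaves the two mixed terms with sum 0. *)
Lemma alternating_swap k (w : 'M[R]_(k, n) -> R) (i j : 'I_k) (A : 'M[R]_(k, n)) :
  multilinear_rows w -> alternating_rows w -> i != j -> w (xrow i j A) = - w A.
Proof.
case: k w i j A => [|k] w i j A wl wa ij; first by case: i ij.
(* Here u sits in row i and v in row j, the other rows being those of [A]. *)
pose X (u v : 'rV[R]_n) := w (ins_row i u (row' i (ins_row j v (row' j A)))).
have ji : j != i by rewrite eq_sym.
have [p Ep _] := unlift_some ij.
have rowi u v : row i (ins_row i u (row' i (ins_row j v (row' j A)))) = u by rewrite row_ins.
have rowj u v : row j (ins_row i u (row' i (ins_row j v (row' j A)))) = v.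
  by rewrite {1}Ep row_ins_lift; apply/rowP => c; rewrite !mxE -Ep unlift_none.
have other u v m : m != i -> m != j ->
    row m (ins_row i u (row' i (ins_row j v (row' j A)))) = row m A.
  move=> mi mj; apply/rowP => c; rewrite !mxE.
  rewrite eq_sym in mi; rewrite eq_sym in mj.
  have [q Eq ->] := unlift_some mi; rewrite !mxE -Eq.
  by have [r Er ->] := unlift_some mj; rewrite !mxE -Er.
have XE u v (B : 'M[R]_(k.+1, n)) : row i B = u -> row j B = v ->
   (forall m, m != i -> m != j -> row m B = row m A) -> w B = X u v.
  move=> Bi Bj Bo; congr w; apply/row_matrixP => m.
  have [->|mi] := eqVneq m i; first by rewrite rowi.
  have [->|mj] := eqVneq m j; first by rewrite rowj.
  by rewrite other// Bo.
have -> : w (xrow i j A) = X (row j A) (row i A).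
  apply: XE => [||m mi mj]; apply/rowP => c; rewrite !mxE.
  - by rewrite tpermL.
  - by rewrite tpermR.
  - by rewrite tpermD// eq_sym.
have -> : w A = X (row i A) (row j A) by exact: XE.
have X0 u : X u u = 0 by rewrite /X (wa _ i j)// rowi rowj.
have Xl u v u' : X (u + v) u' = X u u' + X v u' by rewrite /X w_insD.
have Xr u v u' : X u' (u + v) = X u' u + X u' v.
  have Xj u0 : X u' u0 = w (ins_row j u0 (row' j (ins_row i u' (row' i A)))).
    apply/esym; apply: XE => [||m mi mj]; last 1 first.
    - apply/rowP => c; rewrite !mxE.
      rewrite eq_sym in mi; rewrite eq_sym in mj.
      have [q Eq ->] := unlift_some mj; rewrite !mxE -Eq.
      by have [r Er ->] := unlift_some mi; rewrite !mxE -Er.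
    - have [q Eq _] := unlift_some ji.
      by rewrite {1}Eq row_ins_lift; apply/rowP => c; rewrite !mxE -Eq unlift_none.
    - by rewrite row_ins.
  by rewrite !Xj w_insD.
apply/eqP; rewrite -addr_eq0; apply/eqP.
have := X0 (row i A + row j A); rewrite Xl !Xr !X0 add0r addr0 => <-.
by rewrite addrC.
Qed.

(** Moving the inserted row to the top takes j adjacent transpositions, each of which changes the
    sign. *)
Lemma alternating_ins_sign k (w : 'M[R]_(k.+1, n) -> R) (j : 'I_k.+1) v B :
  multilinear_rows w -> alternating_rows w ->
  w (ins_row j v B) = (-1) ^+ j * w (col_mx v B).
Proof.
move=> wl wa; case: j => j jk; elim: j jk => [|j IH] jk.
  rewrite expr0 mul1r -ins_row0; congr (w (ins_row _ _ _)); exact: val_inj.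
have jk' : (j < k.+1)%N by exact: ltnW.
rewrite /= exprS mulN1r mulNr -(IH jk').
set j1 := Ordinal jk; set j0 := Ordinal jk'.
rewrite -(@alternating_swap _ _ j0 j1)//; last first.
  by rewrite -val_eqE /= neq_ltn ltnSn.
congr w; apply/matrixP => l c; rewrite !mxE.
have [->|l0] := eqVneq l j0.
  rewrite tpermL; have jj : j1 != j0 by rewrite -val_eqE /= neq_ltn ltnSn orbT.
  have jj' : j0 != j1 by rewrite eq_sym.
  have [q Eq ->] := unlift_some jj; have [r Er ->] := unlift_some jj'.
  congr (B _ c); apply: val_inj; move: (congr1 val Eq) (congr1 val Er) => /=.
  by rewrite /bump; case: leqP; case: leqP; lia.
have [->|l1] := eqVneq l j1; first by rewrite tpermR !unlift_none.
rewrite tpermD 1?eq_sym//.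
rewrite eq_sym in l0; rewrite eq_sym in l1.
have [q Eq ->] := unlift_some l0; have [r Er ->] := unlift_some l1.
congr (B _ c); apply: val_inj; move: (congr1 val Eq) (congr1 val Er) => /=.
move: l0 l1; rewrite -!val_eqE /= /bump; case: leqP; case: leqP; lia.
Qed.

(** Wedging with a covector is adjoint to contracting with its sharp. Once the inserted row is moved
    to the top the sign squares to 1, so the k+1 terms contribute equally; the factor k+1 is the
    ratio of the normalizations (k+1)! and k!. *)
Lemma Sdot_adjoint k (H : 'M[R]_n) (e : 'M[R]_(1, n) -> R)
    (b : 'M[R]_(k, n) -> R) (w : 'M[R]_(k.+1, n) -> R) :
  multilinear_rows w -> alternating_rows w ->
  Sdot H (fun B => \sum_(j < k.+1) (-1) ^+ j * e (row j B) * b (row' j B)) w =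
  k.+1%:R * Sdot H b (fun B => w (col_mx ((\row_a e (stdvec R a)) *m H) B)).
Proof.
move=> wl wa; set V := _ *m H.
rewrite (_ : (fun B => _) = (fun B : 'M[R]_(k.+1, n) =>
    \sum_(j < k.+1) (-1) ^+ j * (e (row j B) * b (row' j B)))); last first.
  by apply/funext => B; apply: eq_bigr => j _; rewrite mulrA.
rewrite Sdot_suml -[k.+1 in RHS](card_ord k.+1) -sum1_card natr_sum mulr_suml.
apply: eq_bigr => j _; rewrite (Sdot_rec j) mul1r.
(* The sign is introduced here so as to cancel the one carried by the j-th term of the wedge
   product. *)
have Ew : (fun B => w (col_mx V B)) =
    (fun B => \sum_c V 0 c * ((-1) ^+ j * w (ins_row j (stdvec R c) B))).
  apply/funext => B; rewrite -ins_row0 w_ins_basis//; apply: eq_bigr => c _; congr (_ * _).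
  by rewrite (alternating_ins_sign j)// mulrA -expr2 sqrr_sign mul1r ins_row0.
rewrite Ew Sdot_sumr exchange_big mulr_sumr; apply: eq_bigr => c _.
rewrite SdotZr mulrCA; congr (_ * _); rewrite !mxE mulr_suml; apply: eq_bigr => a _.
rewrite mxE (_ : (fun B => _ * _) = (fun B => e (stdvec R a) * b B)) ?SdotZl; last first.
  by apply/funext => B; rewrite row_ins row'_ins.
by rewrite mulrCA mulrA.
Qed.

(** The antiderivation rule i_V (e /\ w) = e(V) w - e /\ i_V w: the term j = 0 of the wedge sees V
    in [e], the others keep V in row 0 of [w] and shift the sign by one. *)
Lemma contract_wedge k (e : 'M[R]_(1, n) -> R) (w : 'M[R]_(k.+1, n) -> R) (V : 'rV[R]_n)
    (B : 'M[R]_(k.+1, n)) :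
  \sum_(j < k.+2) (-1) ^+ j * e (row j (col_mx V B)) * w (row' j (col_mx V B)) =
  e V * w B - \sum_(j < k.+1) (-1) ^+ j * e (row j B) * w (col_mx V (row' j B)).
Proof.
rewrite big_ord_recl /= expr0 mul1r (row0_col_mx V B) (row'0_col_mx V B); congr (_ + _).
rewrite -sumrN; apply: eq_bigr => j _.
rewrite exprS mulN1r !mulNr; congr (- (_ * e _ * w _)).
  by rewrite -ins_row0 row_ins_lift.
rewrite -!ins_row0; apply/matrixP => l c; rewrite !mxE.
case: (unliftP ord0 l) => [l'|] ->.
  have -> : lift (lift ord0 j) (lift ord0 l') = lift ord0 (lift j l').
    by apply: val_inj; rewrite /= /bump; lia.
  by rewrite !liftK mxE.
have -> : lift (lift ord0 j) ord0 = ord0 by apply: val_inj.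
by rewrite !unlift_none.
Qed.

(** * Positive definite matrices *)

Definition posdef (G : 'M[R]_n) := G^T = G /\ forall v : 'rV[R]_n, v != 0 -> 0 < (v *m G *m v^T) 0 0.

End Algebra.

(** Block elimination: split off the first row and column, apply induction to the Schur complement
    of the corner entry, and assemble a lower triangular factor. *)
Lemma cholesky (R : realType) n (G : 'M[R]_n) : posdef G ->
  exists2 Q : 'M[R]_n, Q \in unitmx & G = Q *m Q^T.
Proof.
elim: n G => [|n IH] G [Gs Gp].
  exists 1%:M; first exact: unitmx1.
  by apply/matrixP => -[].
change 'M[R]_(1 + n) in G.
pose a := G 0 0; pose b : 'rV[R]_n := ursubmx G; pose D : 'M[R]_n := drsubmx G.
have ulE : ulsubmx G = a%:M :> 'M[R]_1.
  apply/matrixP => i j; rewrite !ord1 !mxE eqxx mulr1n /a; congr (G _ _); exact: val_inj.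
have dlE : dlsubmx G = b^T by rewrite /b trmx_ursub Gs.
have GE : G = block_mx a%:M b b^T D by rewrite -ulE -dlE submxK.
have Ds : D^T = D by rewrite /D trmx_drsub Gs.
have quad (t : 'M[R]_1) (v : 'rV[R]_n) : row_mx t v *m G *m (row_mx t v)^T =
    a *: (t *m t^T) + v *m b^T *m t^T + t *m b *m v^T + v *m D *m v^T.
  rewrite {1}GE mul_row_block tr_row_mx mul_row_col !mulmxDl mul_mx_scalar -scalemxAl.
  by rewrite !addrA.
have a0 : 0 < a.
  have := Gp (row_mx 1%:M 0); rewrite quad.
  rewrite trmx1 mulmx1 mul0mx trmx0 !mulmx0 mul0mx !addr0 !mxE eqxx mulr1; apply.
  apply/eqP => /(congr1 (@lsubmx _ 1 1 n)); rewrite row_mxKl => /matrixP/(_ 0 0).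
  by rewrite !mxE eqxx => /eqP; rewrite oner_eq0.
have an : a != 0 by rewrite gt_eqF.
(* The Schur complement of the corner entry a. *)
pose S := D - a^-1 *: (b^T *m b).
have [|Q Qu QE] := IH S.
  split; first by rewrite /S linearB /= linearZ /= trmx_mul trmxK Ds.
  move=> v v0.
  (* For fixed v this first entry minimizes the quadratic form, whose minimum is v S v^T. *)
  have := Gp (row_mx (- a^-1 *: (v *m b^T)) v); rewrite quad.
  have -> : a *: ((- a^-1 *: (v *m b^T)) *m (- a^-1 *: (v *m b^T))^T) +
      v *m b^T *m (- a^-1 *: (v *m b^T))^T + (- a^-1 *: (v *m b^T)) *m b *m v^T +
      v *m D *m v^T = v *m S *m v^T.
    set X := v *m b^T; have XT : X^T = b *m v^T by rewrite trmx_mul trmxK.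
    have -> : v *m S *m v^T = v *m D *m v^T - a^-1 *: (X *m X^T).
      by rewrite /S mulmxBr mulmxBl -scalemxAr -scalemxAl XT /X !mulmxA.
    rewrite linearZ /= -!scalemxAl -!scalemxAr !scalerA -mulmxA -XT.
    rewrite -!scalerDl addrC -scaleNr; congr (_ + _ *: _).
    by field.
  apply; apply: contra v0 => /eqP/(congr1 (@rsubmx _ 1 1 n)); rewrite row_mxKr => ->.
  by apply/eqP/matrixP => i j; rewrite !mxE.
pose s := Num.sqrt a.
have s0 : s != 0 by rewrite gt_eqF// sqrtr_gt0.
have ss : s * s = a by rewrite -expr2 sqr_sqrtr// ltW.
exists (block_mx s%:M 0 (s^-1 *: b^T) Q : 'M[R]_(1 + n)).
  rewrite unitmxE (@det_lblock _ 1 n s%:M (s^-1 *: b^T) Q) det_scalar expr1 unitrM unitfE s0 /=.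
  by rewrite -unitmxE.
apply: (etrans GE); rewrite (@tr_block_mx _ 1 n 1 n) (@mulmx_block _ 1 n 1 n 1 n).
rewrite linearZ /= !trmx0 trmxK tr_scalar_mx !mul0mx !mulmx0 !addr0 -scalar_mxM ss -QE; congr block_mx.
- by rewrite mul_scalar_mx scalerA mulfV// scale1r.
- by rewrite mul_mx_scalar scalerA mulfV// scale1r.
- rewrite -scalemxAl -scalemxAr scalerA -invfM ss /S addrC subrK//.
Qed.

Section Positivity.
Context {R : realType} {n : nat}.

Lemma posdef_unitmx (G : 'M[R]_n) : posdef G -> G \in unitmx.
Proof. by move=> /cholesky[Q Qu ->]; rewrite unitmx_mul unitmx_tr Qu. Qed.

Lemma posdef_det (G : 'M[R]_n) : posdef G -> 0 < \det G.
Proof.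
move=> /cholesky[Q Qu ->]; rewrite det_mulmx det_tr -expr2.
by rewrite exprn_even_gt0//= -unitfE -unitmxE.
Qed.

(** The factor [1%:M] is written out so that [Sdot_base_change] applies and leaves [Sdot 1%:M], a
    sum over orthonormal components. *)
Lemma posdef_inv (G : 'M[R]_n) : posdef G ->
  exists2 P : 'M[R]_n, P \in unitmx & invmx G = P^T *m 1%:M *m P.
Proof.
move=> /cholesky[Q Qu ->]; exists (invmx Q); first by rewrite unitmx_inv.
rewrite mulmx1; apply: (can_inj (mulKmx (_ : Q *m Q^T \in unitmx))).
  by rewrite unitmx_mul unitmx_tr Qu.
rewrite mulmxV ?unitmx_mul ?unitmx_tr ?Qu//.
rewrite -mulmxA (mulmxA Q^T) -trmx_mul mulVmx// trmx1 mul1mx mulmxV//.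
Qed.

Lemma Sdot1 k (w w' : 'M[R]_(k, n) -> R) :
  Sdot 1%:M w w' = \sum_(I : {ffun 'I_k -> 'I_n}) w (stdrows R I) * w' (stdrows R I).
Proof.
apply: eq_bigr => I _; rewrite (bigD1 I)//= [X in _ + X]big1 => [|J JI].
  by rewrite addr0 big1 ?mul1r// => l _; rewrite mxE eqxx.
have [l lJ] : exists l, I l != J l.
  apply/existsP; rewrite -negb_forall; apply: contra JI => /forallP H.
  by apply/eqP/ffunP => l; apply/esym/eqP.
by rewrite (bigD1 l)//= mxE (negbTE lJ) !mul0r.
Qed.

Lemma Sdot_ge0 k (G : 'M[R]_n) (w : 'M[R]_(k, n) -> R) :
  posdef G -> multilinear_rows w -> 0 <= Sdot (invmx G) w w.
Proof.
move=> /posdef_inv[P Pu ->] wl; rewrite Sdot_base_change// Sdot1.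
by apply: sumr_ge0 => I _; rewrite -expr2 sqr_ge0.
Qed.

Lemma multilinear_mulr k (w : 'M[R]_(k, n) -> R) (P : 'M[R]_n) :
  multilinear_rows w -> multilinear_rows (fun B => w (B *m P)).
Proof.
move=> wl A B C l b c rA rB rC; apply: (wl _ _ _ l); rewrite ?row_mul.
- by rewrite rA mulmxDl !scalemxAl.
- by apply/matrixP => i j; rewrite !mxE; apply: eq_bigr => a _; have /matrixP/(_ i a) := rB; rewrite !mxE => ->.
- by apply/matrixP => i j; rewrite !mxE; apply: eq_bigr => a _; have /matrixP/(_ i a) := rC; rewrite !mxE => ->.
Qed.

Lemma alternating_mulr k (w : 'M[R]_(k, n) -> R) (P : 'M[R]_n) :
  alternating_rows w -> alternating_rows (fun B => w (B *m P)).
Proof. by move=> wa A l m lm rA; apply: (wa _ l m lm); rewrite !row_mul rA. Qed.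

(** In orthonormal components the form is a sum of squares; all its values on the new basis rows
    vanish, and these determine a multilinear map. *)
Lemma Sdot_eq0 k (G : 'M[R]_n) (w : 'M[R]_(k, n) -> R) :
  posdef G -> multilinear_rows w -> Sdot (invmx G) w w <= 0 -> w = fun=> 0.
Proof.
move=> /posdef_inv[P Pu ->] wl; rewrite Sdot_base_change// Sdot1 => S0.
have S00 : \sum_(I : {ffun 'I_k -> 'I_n}) w (stdrows R I *m P) * w (stdrows R I *m P) = 0.
  by apply/eqP; rewrite eq_le S0 sumr_ge0// => I _; rewrite -expr2 sqr_ge0.
have w0 I : w (stdrows R I *m P) = 0.
  have /psumr_eq0P := S00 => /(_ _ I isT)/eqP.
  by rewrite mulf_eq0 orbb => H; apply/eqP/H => J _; rewrite -expr2 sqr_ge0.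
apply/funext => B; rewrite -[B](mulmxKV Pu).
rewrite (multilinear_expand (multilinear_mulr P wl)) big1// => I _.
by rewrite w0 mulr0.
Qed.

End Positivity.

(** * Local calculus on a manifold *)

Local Notation contract := Defs.contract.

Section Manifold.
Context {R : realType} {n : nat} {M : smoothManifold R n}.
Implicit Types (i j : chart M) (x : M) (y : 'rV[R]_n).

Definition cod i : set 'rV[R]_n := phi i @` dom i.
Definition ovl i j : set 'rV[R]_n := phi i @` (dom i `&` dom j).
Definition trans i j : 'rV[R]_n -> 'rV[R]_n := fun y => phi j (psi i y).
Definition Jac i j y : 'M[R]_n := jacobian (trans i j) y.

Lemma cod_nbhs i y : cod i y -> nbhs y (cod i).
Proof. by move=> iy; apply: open_nbhs_nbhs; split => //; exact: cod_open. Qed.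

Lemma dom_nbhs i x : dom i x -> nbhs x (dom i).
Proof. by move=> ix; apply: open_nbhs_nbhs; split => //; exact: dom_open. Qed.

Lemma dom_psi i y : cod i y -> dom i (psi i y).
Proof. by move=> [x ix <-]; rewrite phiK. Qed.

Lemma psiK i y : cod i y -> phi i (psi i y) = y.
Proof. by move=> [x ix <-]; rewrite phiK. Qed.

Lemma cod_phi i x : dom i x -> cod i (phi i x). Proof. by exists x. Qed.

Lemma ovlP i j y : ovl i j y <-> cod i y /\ dom j (psi i y).
Proof.
split=> [[x [ix jx] <-]|[iy jy]].
  by rewrite phiK//; split => //; exact: cod_phi.
by exists (psi i y); rewrite ?psiK//; split => //; exact: dom_psi.
Qed.

Lemma psi_near i y (A : set M) : cod i y -> nbhs (psi i y) A ->
  \forall z \near y, cod i z /\ A (psi i z).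
Proof.
move=> iy Ay; apply: filterI; first exact: cod_nbhs.
exact: (psi_continuous iy Ay).
Qed.

Lemma psi_open i (A : set M) : open A -> open [set y | cod i y /\ A (psi i y)].
Proof.
move=> Aop; rewrite openE => y [iy Ay]; apply: psi_near => //.
exact: open_nbhs_nbhs.
Qed.

Lemma ovl_open i j : open (ovl i j).
Proof.
rewrite (_ : ovl i j = [set y | cod i y /\ dom j (psi i y)]).
  exact/psi_open/dom_open.
by apply/seteqP; split => y /ovlP.
Qed.

Lemma phi_near i x (A : set 'rV[R]_n) : dom i x -> nbhs (phi i x) A ->
  \forall z \near x, dom i z /\ A (phi i z).
Proof.
move=> ix Ax; apply: filterI; first exact: dom_nbhs.
exact: (phi_continuous ix Ax).
Qed.

Lemma trans_differentiable i j y : ovl i j y -> differentiable (trans i j) y.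
Proof.
move=> oy; apply: differentiable_rV => b.
exact: (smooth_on_differentiable (@ovl_open i j) (transition_smooth (i := i) (j := j) b) oy).
Qed.

Lemma frameE i x : frame i x = Jac i (chart_at x) (phi i x).
Proof. by []. Qed.

Lemma derive_trans i j y v : ovl i j y -> 'D_v (trans i j) y = v *m Jac i j y.
Proof. by move=> oy; apply: deriveEjacobian; exact: trans_differentiable. Qed.

#[local] Opaque Jac.

Lemma Jac_entry i j y a b : ovl i j y ->
  Jac i j y a b = partial a (fun z => trans i j z 0 b) y.
Proof.
move=> oy; rewrite /partial -derive_coordf; last exact: trans_differentiable.
by rewrite (derive_trans _ oy) /stdvec -rowE [RHS]mxE.
Qed.

Lemma Jac_smooth i j a b : smooth_on (ovl i j) (fun y => Jac i j y a b).
Proof.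
apply: (smooth_eq (@ovl_open i j) (f := partial a (fun z => trans i j z 0 b))).
  by move=> y oy; rewrite Jac_entry.
apply: smooth_on_partial; exact: transition_smooth.
Qed.

Lemma Jac_comp i j k y : cod i y -> dom j (psi i y) -> dom k (psi i y) ->
  Jac i k y = Jac i j y *m Jac j k (trans i j y).
Proof.
move=> iy jy ky; apply/row_matrixP => a; rewrite !rowE mulmxA.
have oij : ovl i j y by apply/ovlP.
have oik : ovl i k y by apply/ovlP.
have ojk : ovl j k (trans i j y).
  by apply/ovlP; rewrite /trans phiK//; split => //; exact: cod_phi.
apply: (etrans (esym (derive_trans _ oik))).
apply: (etrans _ (congr1 (mulmx^~ _) (derive_trans _ oij))).
apply: (etrans _ (derive_trans _ ojk)).
have E : \near y, trans i k y = (trans j k \o trans i j) y.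
  have := psi_near iy (dom_nbhs jy).
  by apply: filterS => z [_ jz]; rewrite /trans /= phiK.
rewrite (near_eq_derive _ E).
have d1 := trans_differentiable oij; have d2 := trans_differentiable ojk.
rewrite !deriveE//; last exact: differentiable_comp.
exact: (congr1 (fun f => f (delta_mx 0 a)) (diff_comp d1 d2)).
Qed.

Lemma Jac_id i y : cod i y -> Jac i i y = 1%:M.
Proof.
move=> iy; apply/row_matrixP => a; rewrite !rowE mulmx1.
have oii : ovl i i y by apply/ovlP; split => //; exact: dom_psi.
rewrite -(derive_trans _ oii).
have E : \near y, trans i i y = id y.
  have := cod_nbhs iy.
  by apply: filterS => z iz; rewrite /trans /= psiK.
by rewrite (near_eq_derive _ E) derive_id.
Qed.

Lemma Jac_inv i j y : cod i y -> dom j (psi i y) ->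
  Jac i j y *m Jac j i (trans i j y) = 1%:M.
Proof.
move=> iy jy; rewrite -(@Jac_comp i j i)// ?Jac_id//; exact: dom_psi.
Qed.

Lemma frame_unit i x : dom i x -> frame i x \in unitmx.
Proof.
move=> ix; rewrite frameE.
have xi : dom (chart_at x) (psi i (phi i x)) by rewrite phiK//; exact: chart_atP.
exact: (mulmx1_unit (Jac_inv (cod_phi ix) xi)).1.
Qed.

(** Tangent vectors at x are by convention components in the preferred chart, so there a field and
    its local expression agree. Pointwise identities at x are proved in this chart. *)
Lemma frame_chart_at x : frame (chart_at x) x = 1%:M.
Proof. by rewrite frameE Jac_id//; apply/cod_phi/chart_atP. Qed.

Lemma localf_at k (alpha : kfield M k) x B :
  localf (chart_at x) alpha (phi (chart_at x) x) B = alpha x B.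
Proof. by rewrite /localf phiK ?frame_chart_at ?mulmx1//; exact: chart_atP. Qed.

Definition smooth_fun (h : M -> R) := forall i, smooth_on (cod i) (h \o psi i).

Lemma smooth_fun_near i x (h : M -> R) : smooth_fun h -> dom i x ->
  {for x, continuous h}.
Proof.
move=> sh ix.
have : {for phi i x, continuous (h \o psi i)}.
  exact: (sh i [::] _ (cod_phi ix)).1.
move=> c A; rewrite -{1}(phiK ix) => Ah.
have := phi_near ix (c _ Ah).
by apply: filterS => z [iz]; rewrite /= phiK.
Qed.

Lemma smooth_fun_continuous (h : M -> R) : smooth_fun h -> continuous h.
Proof. move=> sh x; exact: smooth_fun_near sh (chart_atP x). Qed.

Lemma smooth_fun_differentiable i y (h : M -> R) : smooth_fun h -> cod i y ->
  differentiable (h \o psi i) y.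
Proof. by move=> sh; apply: smooth_on_differentiable => //; exact: cod_open. Qed.

(** The differential of a function, with the tangent vector [A] itself as direction, which avoids
    regarding h as a field of 0-forms. *)
Definition dform (h : M -> R) : kfield M 1 := fun x A =>
  'D_A (h \o psi (chart_at x)) (phi (chart_at x) x).

Lemma derive_chart i j y v (h : M -> R) : smooth_fun h -> cod i y -> dom j (psi i y) ->
  'D_v (h \o psi i) y = 'D_(v *m Jac i j y) (h \o psi j) (trans i j y).
Proof.
move=> sh iy jy.
have oij : ovl i j y by apply/ovlP.
have E : \near y, (h \o psi i) y = ((h \o psi j) \o trans i j) y.
  have := psi_near iy (dom_nbhs jy).
  by apply: filterS => z [_ jz]; rewrite /trans /= phiK.
rewrite (near_eq_derive _ E) -(derive_trans _ oij).
have d := smooth_fun_differentiable sh (cod_phi jy).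
exact: (derive_compn v (trans_differentiable oij) d).2.
Qed.

Lemma localf_dform i y (h : M -> R) B : smooth_fun h -> cod i y ->
  localf i (dform h) y B = 'D_B (h \o psi i) y.
Proof.
move=> sh iy; rewrite (derive_chart B sh iy (chart_atP (psi i y))).
by rewrite /localf /dform frameE psiK.
Qed.

Lemma derive_chartE i y v (h : M -> R) : smooth_fun h -> cod i y ->
  'D_v (h \o psi i) y = \sum_a v 0 a * partial a (h \o psi i) y.
Proof. by move=> sh iy; apply: differentiable_deriveE; exact: smooth_fun_differentiable. Qed.

Lemma dform_Omega (h : M -> R) : smooth_fun h -> Omega (dform h).
Proof.
move=> sh; split.
- move=> x A B C l b c; rewrite (ord1 l) => rA _ _.
  have row0 (X : 'M[R]_(1, n)) : row 0 X = X by apply/rowP => a; rewrite mxE.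
  rewrite !row0 in rA; rewrite /dform rA.
  have ix := cod_phi (chart_atP x).
  rewrite !(derive_chartE _ sh ix) !mulr_sumr -big_split; apply: eq_bigr => a _ /=.
  by rewrite !mxE mulrDl !mulrA.
- by move=> x A l m; rewrite (ord1 l) (ord1 m) eqxx.
- move=> i B; apply: (smooth_eq (@cod_open _ _ M i)
    (f := fun y => \sum_a B 0 a * partial a (h \o psi i) y)) => [y iy|].
    by rewrite (localf_dform _ sh iy) (derive_chartE _ sh iy).
  apply: (smooth_sum (@cod_open _ _ M i)) => a _.
  apply: (smoothM (@cod_open _ _ M i) (f := fun=> B 0 a)); first exact: smooth_on_cst.
  exact/smooth_on_partial/sh.
Qed.

Lemma localf_multilinear k (alpha : kfield M k) i y :
  Omega alpha -> multilinear_rows (localf i alpha y).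
Proof. by move=> [al _ _]; apply: multilinear_mulr; exact: al. Qed.

Lemma localf_alternating k (alpha : kfield M k) i y :
  Omega alpha -> alternating_rows (localf i alpha y).
Proof. by move=> [_ aa _]; apply: alternating_mulr; exact: aa. Qed.

Lemma localf_col_smooth k i (alpha : kfield M k.+1) (u : 'rV[R]_n -> 'rV[R]_n)
    (B : 'M[R]_(k, n)) : Omega alpha -> (forall c, smooth_on (cod i) (fun y => u y 0 c)) ->
  smooth_on (cod i) (fun y => localf i alpha y (col_mx (u y) B)).
Proof.
move=> aO us; apply: (smooth_eq (@cod_open _ _ M i)
    (f := fun y => \sum_c u y 0 c * localf i alpha y (ins_row 0 (stdvec R c) B))) => [y iy|].
  by rewrite -w_ins_basis ?ins_row0//; exact: localf_multilinear.
apply: (smooth_sum (@cod_open _ _ M i)) => c _; apply: (smoothM (@cod_open _ _ M i) (us c)).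
by case: aO => _ _; exact.
Qed.

Lemma smooth_det m i (A : 'rV[R]_n -> 'M[R]_m) :
  (forall a b, smooth_on (cod i) (fun y => A y a b)) -> smooth_on (cod i) (fun y => \det (A y)).
Proof.
move=> sA; apply: (smooth_sum (@cod_open _ _ M i)) => s _.
apply: (smoothM (@cod_open _ _ M i) (f := fun=> (-1) ^+ perm.odd_perm s)); first exact: smooth_on_cst.
by apply: (smooth_prod (@cod_open _ _ M i)) => a _; exact: sA.
Qed.

Lemma Omega_scale k (h : M -> R) (alpha : kfield M k) : smooth_fun h -> Omega alpha ->
  Omega (fun x B => h x * alpha x B).
Proof.
move=> sh [al aa asm]; split.
- move=> x A B C l b c rA rB rC; rewrite (al x A B C l b c)//; ring.
- by move=> x A l m lm rA; rewrite (aa x A l m)// mulr0.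
- by move=> i B; exact: (smoothM (@cod_open _ _ M i) (sh i) (asm i B)).
Qed.

Lemma smooth_funM (h h' : M -> R) : smooth_fun h -> smooth_fun h' -> smooth_fun (fun x => h x * h' x).
Proof. by move=> sh sh' i; exact: (smoothM (@cod_open _ _ M i) (sh i) (sh' i)). Qed.

Lemma smooth_funD (h h' : M -> R) : smooth_fun h -> smooth_fun h' -> smooth_fun (fun x => h x + h' x).
Proof. by move=> sh sh' i; exact: (smoothD (@cod_open _ _ M i) (sh i) (sh' i)). Qed.

Lemma smooth_funB (h h' : M -> R) : smooth_fun h -> smooth_fun h' -> smooth_fun (fun x => h x - h' x).
Proof. by move=> sh sh' i; exact: (smoothB (@cod_open _ _ M i) (sh i) (sh' i)). Qed.

Lemma smooth_fun_cst c : smooth_fun (fun=> c).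
Proof. by move=> i; exact: smooth_on_cst. Qed.

Section Metric.
Variables (g : M -> 'M[R]_n) (gm : riemannian_metric g).
Local Notation G := (local_metric g).

Lemma metric_posdef x : posdef (g x).
Proof.
split; first exact: Defs.metric_sym.
by move=> v v0; case: gm => _ gp _; exact: gp.
Qed.

Lemma local_metric_posdef i y : cod i y -> posdef (G i y).
Proof.
move=> iy; split; first by rewrite /local_metric !trmx_mul trmxK (Defs.metric_sym _ gm) mulmxA.
move=> v v0; rewrite /local_metric.
have Fu := frame_unit (dom_psi iy).
have [_ pg] := metric_posdef (psi i y).
have : v *m frame i (psi i y) != 0.
  by apply: contra v0 => /eqP vF; rewrite -(mulmxK Fu v) vF mul0mx.
by move=> /pg; rewrite trmx_mul !mulmxA.
Qed.

Lemma local_metric_smooth i a b : smooth_on (cod i) (fun y => G i y a b).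
Proof. by case: gm => _ _; exact. Qed.

Lemma det_metric_smooth i : smooth_on (cod i) (fun y => \det (G i y)).
Proof. by apply: smooth_det => a b; exact: local_metric_smooth. Qed.

Lemma det_metric_gt0 i y : cod i y -> 0 < \det (G i y).
Proof. by move=> /local_metric_posdef/posdef_det. Qed.

(** Cramer's rule: cofactors are polynomial in the entries, and the determinant is positive on the
    chart. *)
Lemma invmx_metric_smooth i a b : smooth_on (cod i) (fun y => invmx (G i y) a b).
Proof.
apply: (smooth_eq (@cod_open _ _ M i)
   (f := fun y => (\det (G i y))^-1 * cofactor (G i y) b a)) => [y iy|].
  by rewrite /invmx (posdef_unitmx (local_metric_posdef iy)) !mxE.
apply: (smoothM (@cod_open _ _ M i)).
  apply: (smoothV (@cod_open _ _ M i)); first exact: det_metric_smooth.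
  by move=> y iy; rewrite gt_eqF// det_metric_gt0.
apply: (smoothM (@cod_open _ _ M i) (f := fun=> (-1) ^+ (b + a))); first exact: smooth_on_cst.
apply: smooth_det => c d.
apply: (smooth_eq (@cod_open _ _ M i) (f := fun y => G i y (lift b c) (lift a d))).
  by move=> y _; rewrite !mxE.
exact: local_metric_smooth.
Qed.

(** The components in the chart i of the sharp of w; [sharp_local] converts them by the frame. *)
Definition lsharp i (w : kfield M 1) y : 'rV[R]_n :=
  (\row_b localf i w y (stdvec R b)) *m invmx (G i y).

Lemma invmx_local_metric i y : cod i y ->
  (frame i (psi i y))^T *m invmx (G i y) *m frame i (psi i y) = invmx (g (psi i y)).
Proof.
move=> iy; have Fu := frame_unit (dom_psi iy).
have gu : g (psi i y) \in unitmx := posdef_unitmx (metric_posdef _).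
have FTu : (frame i (psi i y))^T \in unitmx by rewrite unitmx_tr.
apply: (can_inj (mulmxK gu)); rewrite mulVmx//.
apply: (can_inj (mulmxK FTu)); rewrite mul1mx -!mulmxA.
rewrite (_ : _ *m (_ *m _^T) = G i y); last by rewrite mulmxA.
by rewrite mulVmx ?mulmx1// (posdef_unitmx (local_metric_posdef iy)).
Qed.

Lemma sharp_local i y (w : kfield M 1) : Omega w -> cod i y ->
  sharp g w (psi i y) = lsharp i w y *m frame i (psi i y).
Proof.
move=> [wl _ _] iy; rewrite /sharp /lsharp -(invmx_local_metric iy) !mulmxA.
congr (_ *m _ *m _); apply/rowP => b; rewrite [LHS]mxE.
under eq_bigr do rewrite mxE.
rewrite mxE /localf (oneform_sum _ (wl _)); apply: eq_bigr => c _.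
by rewrite mulrC /stdvec -rowE !mxE.
Qed.

Lemma lsharp_smooth i (w : kfield M 1) c : Omega w ->
  smooth_on (cod i) (fun y => lsharp i w y 0 c).
Proof.
move=> [_ _ ws]; apply: (smooth_eq (@cod_open _ _ M i) (f := fun y =>
  \sum_b localf i w y (stdvec R b) * invmx (G i y) b c)) => [y iy|].
  by rewrite mxE; apply: eq_bigr => b _; rewrite mxE.
apply: (smooth_sum (@cod_open _ _ M i)) => b _.
apply: (smoothM (@cod_open _ _ M i)); first exact: ws.
exact: invmx_metric_smooth.
Qed.

Lemma localf_contract k i y (w : kfield M 1) (alpha : kfield M k.+1) B :
  Omega w -> cod i y ->
  localf i (contract (sharp g w) alpha) y B = localf i alpha y (col_mx (lsharp i w y) B).
Proof. by move=> wO iy; rewrite /localf /contract (sharp_local wO iy) -!ins_row0 mul_ins_row. Qed.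

Lemma contract_Omega k (w : kfield M 1) (alpha : kfield M k.+1) :
  Omega w -> Omega alpha -> Omega (contract (sharp g w) alpha).
Proof.
move=> wO aO; have [al aa _] := aO; split.
- move=> x; rewrite /contract (_ : (fun A => _) = (fun A : 'M[R]_(k, n) => alpha x (ins_row 0 (sharp g w x) A))).
    exact: multilinear_ins.
  by apply/funext => A; rewrite ins_row0.
- move=> x; rewrite /contract (_ : (fun A => _) = (fun A : 'M[R]_(k, n) => alpha x (ins_row 0 (sharp g w x) A))).
    exact: alternating_ins.
  by apply/funext => A; rewrite ins_row0.
- move=> i B; apply: (smooth_eq (@cod_open _ _ M i) (f := fun y =>
      localf i alpha y (col_mx (lsharp i w y) B))) => [y iy|].
    by rewrite (localf_contract _ _ wO iy).
  by apply: localf_col_smooth => // c; exact: lsharp_smooth.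
Qed.

Lemma form_dotE k (alpha beta : kfield M k) x :
  form_dot g alpha beta x = (k`!%:R)^-1 * Sdot (invmx (g x)) (alpha x) (beta x).
Proof. by []. Qed.

Lemma form_dot_local k (alpha beta : kfield M k) i y :
  Omega alpha -> Omega beta -> cod i y ->
  form_dot g alpha beta (psi i y) =
  (k`!%:R)^-1 * Sdot (invmx (G i y)) (localf i alpha y) (localf i beta y).
Proof.
move=> [al _ _] [bl _ _] iy; rewrite form_dotE -(invmx_local_metric iy); congr (_ * _).
by rewrite Sdot_base_change.
Qed.

Lemma form_dot_smooth k (alpha beta : kfield M k) :
  Omega alpha -> Omega beta -> smooth_fun (form_dot g alpha beta).
Proof.
move=> aO bO i; have [_ _ asm] := aO; have [_ _ bsm] := bO.
have co := @cod_open _ _ M i.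
apply: (smooth_eq co (f := fun y => (k`!%:R)^-1 * Sdot (invmx (G i y)) (localf i alpha y) (localf i beta y))).
  by move=> y iy; rewrite /= (form_dot_local aO bO iy).
apply: (smoothM co (f := fun=> (k`!%:R)^-1)); first exact: smooth_on_cst.
apply: (smooth_sum co) => I _; apply: (smooth_sum co) => J _.
apply: (smoothM co _ (bsm i _)); apply: (smoothM co _ (asm i _)).
by apply: (smooth_prod co) => l _; exact: invmx_metric_smooth.
Qed.

Lemma pairing_smooth (w w' : kfield M 1) : Omega w -> Omega w' ->
  smooth_fun (fun x => w x (sharp g w' x)).
Proof.
move=> wO wO' i; have co := @cod_open _ _ M i; have [wl _ ws] := wO.
apply: (smooth_eq co (f := fun y => \sum_c lsharp i w' y 0 c * localf i w y (stdvec R c))).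
  move=> y iy; rewrite /= (sharp_local wO' iy).
  exact: esym (oneform_sum _ (@localf_multilinear 1 w i y wO)).
by apply: (smooth_sum co) => c _; apply: (smoothM co) => //; exact: lsharp_smooth.
Qed.

End Metric.

End Manifold.

(** * Parallel one-forms *)

Section MatrixIdentities.
Context {R : realType} {n : nat}.

Lemma killing_inv (H J G : 'M[R]_n) : H^T = H -> G^T = G -> G *m H = 1%:M -> H *m G = 1%:M ->
  (H *m J + (H *m J)^T) *m G = H *m (J *m G + (J *m G)^T).
Proof.
move=> HT GT GH HG; rewrite mulmxDl mulmxDr !trmx_mul HT GT !mulmxA; congr (_ + _).
by rewrite HG mul1mx -mulmxA HG mulmx1.
Qed.

Lemma Sdot_comb4 k (H : 'M[R]_n) (a b c : R) (w1 w2 w3 w4 w : 'M[R]_(k, n) -> R) :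
  Sdot H (fun B => a * w1 B + (b * w2 B + (c * w3 B + w4 B))) w =
  a * Sdot H w1 w + (b * Sdot H w2 w + (c * Sdot H w3 w + Sdot H w4 w)).
Proof. by rewrite !SdotDl !SdotZl. Qed.

End MatrixIdentities.

Section Derivatives.
Context {R : realType} {n : nat}.
Implicit Types (f : 'rV[R]_n -> R) (y v : 'rV[R]_n).

Lemma derive_mul f h y v : differentiable f y -> differentiable h y ->
  'D_v (fun z => f z * h z) y = f y * 'D_v h y + 'D_v f y * h y.
Proof.
move=> df dh.
rewrite -[LHS]/('D_v (f * h) y) deriveM; [|exact: diff_derivable..].
by rewrite /GRing.scale /= [h y * _]mulrC.
Qed.

Lemma derive_bigsum (I : Type) (r : seq I) (P : pred I) (F : I -> 'rV[R]_n -> R) y v :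
  (forall i, differentiable (F i) y) ->
  differentiable (fun z => \sum_(i <- r | P i) F i z) y /\
  'D_v (fun z => \sum_(i <- r | P i) F i z) y = \sum_(i <- r | P i) 'D_v (F i) y.
Proof.
move=> dF; elim: r => [|i r [d IH]].
  rewrite (_ : (fun z => _) = cst 0); last by apply/funext => z; rewrite big_nil.
  by rewrite big_nil derive_cst; split.
rewrite big_cons; case Pi : (P i); last first.
  by rewrite (_ : (fun z => _) = (fun z => \sum_(i <- r | P i) F i z));
    [|by apply/funext => z; rewrite big_cons Pi].
rewrite (_ : (fun z => _) = (F i + (fun z => \sum_(i <- r | P i) F i z))).
  split; first exact: differentiableD.
  by rewrite deriveD ?IH//; exact: diff_derivable.
by apply/funext => z; rewrite big_cons Pi.
Qed.

Lemma derive_bigprod (I : eqType) (r : seq I) (F : I -> 'rV[R]_n -> R) y v :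
  (forall i, differentiable (F i) y) -> uniq r ->
  differentiable (fun z => \prod_(i <- r) F i z) y /\
  'D_v (fun z => \prod_(i <- r) F i z) y =
  \sum_(i <- r) 'D_v (F i) y * \prod_(j <- r | j != i) F j y.
Proof.
move=> dF; elim: r => [|i r IH] /=.
  rewrite (_ : (fun z => _) = cst 1); last by apply/funext => z; rewrite big_nil.
  by rewrite big_nil derive_cst; split.
move=> /andP[ir /IH{IH}[d IH]].
rewrite (_ : (fun z => _) = (fun z => F i z * (\prod_(i <- r) F i z))); last first.
  by apply/funext => z; rewrite big_cons.
split; first exact: differentiableM.
rewrite derive_mul// IH big_cons addrC; congr (_ * _ + _).
  rewrite big_cons eqxx /= big_seq_cond [RHS]big_seq_cond; apply: eq_bigl => j.
  by case jr : (j \in r) => //=; apply/esym; apply: contraNneq ir => <-.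
rewrite mulr_sumr; apply: eq_big_seq => j jr.
have ij : i != j by apply: contraNneq ir => ->.
by rewrite big_cons ij mulrCA.
Qed.

Lemma prod_neq_lift k (l : 'I_k.+1) (F : 'I_k.+1 -> R) :
  \prod_(m | m != l) F m = \prod_(m < k) F (lift l m).
Proof.
rewrite big_mkcond (bigD1_ord l)//= eqxx mul1r; apply: eq_bigr => m _.
by rewrite eq_sym neq_lift.
Qed.

(** The hypothesis on the derivative of [H] is the Killing equation for the inverse metric. Each
    factor of the product over l then yields one term in which X acts on the first index and one in
    which it acts on the second; by symmetry they agree, whence the factor 2 in front of the pairing
    with the Lie derivative. *)
Lemma derive_Sdot k (H : 'rV[R]_n -> 'M[R]_n) (A : 'rV[R]_n -> 'M[R]_(k, n) -> R)
    (X : 'M[R]_n) y v :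
  (forall a b, differentiable (fun z => H z a b) y) ->
  (forall B, differentiable (fun z => A z B) y) ->
  multilinear_rows (A y) -> (H y)^T = H y ->
  (forall a b, 'D_v (fun z => H z a b) y = (H y *m X) a b + (H y *m X) b a) ->
  'D_v (fun z => Sdot (H z) (A z) (A z)) y =
  2 * Sdot (H y) (A y) (fun B => 'D_v (fun z => A z B) y +
    \sum_l A y (\matrix_(i, c) if i == l then (row l B *m X) 0 c else B i c)).
Proof.
move=> dH dA Al Hs DH.
have dprod (I J : {ffun 'I_k -> 'I_n}) := @derive_bigprod _ (index_enum 'I_k)
  (fun l z => H z (I l) (J l)) y v (fun l => dH _ _) (index_enum_uniq _).
have d1 (I J : {ffun 'I_k -> 'I_n}) : differentiable (fun z =>
    (\prod_(l < k) H z (I l) (J l)) * A z (stdrows R I)) y.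
  by apply: differentiableM; [exact: (dprod I J).1|exact: dA].
have d2 (I J : {ffun 'I_k -> 'I_n}) : differentiable (fun z =>
    (\prod_(l < k) H z (I l) (J l)) * A z (stdrows R I) * A z (stdrows R J)) y.
  by apply: differentiableM; [exact: d1|exact: dA].
have d3 (I : {ffun 'I_k -> 'I_n}) := @derive_bigsum _ (index_enum {ffun 'I_k -> 'I_n}) xpredT (fun J z =>
  (\prod_(l < k) H z (I l) (J l)) * A z (stdrows R I) * A z (stdrows R J)) y v (d2 I).
rewrite (derive_bigsum _ _ _ (fun I => (d3 I).1)).2.
pose DA B := 'D_v (fun z => A z B) y.
(* The terms in which X acts on the second index of a factor of [H]; [T2] below is the same number
   with the two indices exchanged. *)
pose T := \sum_(I : {ffun 'I_k -> 'I_n}) \sum_(J : {ffun 'I_k -> 'I_n})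
  (\sum_l (H y *m X) (I l) (J l) * \prod_(m | m != l) H y (I m) (J m)) *
  A y (stdrows R I) * A y (stdrows R J).
have TE : T = Sdot (H y) (A y) (fun B => \sum_l A y (\matrix_(i, c) if i == l then (row l B *m X) 0 c else B i c)).
  rewrite {dprod d1 d2 d3 DA}/T.
  transitivity (\sum_l \sum_(I : {ffun 'I_k -> 'I_n}) \sum_(J : {ffun 'I_k -> 'I_n})
    (H y *m X) (I l) (J l) * \prod_(m | m != l) H y (I m) (J m) * A y (stdrows R I) * A y (stdrows R J)).
    rewrite [RHS]exchange_big; apply: eq_bigr => I _; rewrite [RHS]exchange_big; apply: eq_bigr => J _.
    by rewrite !mulr_suml.
  have -> : (fun B => \sum_l A y (\matrix_(i, c) if i == l then (row l B *m X) 0 c else B i c)) =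
     (fun B => \sum_l 1 * A y (\matrix_(i, c) if i == l then (row l B *m X) 0 c else B i c)).
    by apply/funext => B; apply: eq_bigr => l _; rewrite mul1r.
  rewrite Sdot_sumr; apply: eq_bigr => l _; rewrite mul1r.
  case: k A dA Al l => [|k] A dA Al l; first by case: l.
  have -> : (fun B : 'M[R]_(k.+1, n) => A y (\matrix_(i, c) (if i == l then (row l B *m X) 0 c else B i c))) =
      (fun B => A y (ins_row l (row l B *m X) (row' l B))).
    apply/funext => B; congr (A y _); apply/matrixP => i c; rewrite [LHS]mxE [RHS]mxE.
    by case: (unliftP l i) => [i'|] ->; rewrite ?eqxx// eq_sym (negbTE (neq_lift _ _)) mxE.
  rewrite (Sdot_rec l) (sum_consi l); apply: eq_bigr => a _.
  under eq_bigr do rewrite (sum_consi l).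
  rewrite exchange_big.
  transitivity (\sum_b (H y *m X) a b * Sdot (H y) (fun B => A y (ins_row l (stdvec R a) B))
      (fun B => A y (ins_row l (stdvec R b) B))).
    apply: eq_bigr => b _; rewrite mulr_sumr; apply: eq_bigr => I _.
    rewrite mulr_sumr; apply: eq_bigr => J _.
    rewrite !stdrows_consi !mulrA; congr (_ * _ * _).
    rewrite prod_neq_lift !ffunE !unlift_none; congr (_ * _).
    by apply: eq_bigr => m _; rewrite !ffunE !liftK.
  transitivity (\sum_c H y a c * (\sum_b X c b * Sdot (H y) (fun B => A y (ins_row l (stdvec R a) B))
      (fun B => A y (ins_row l (stdvec R b) B)))).
    under [RHS]eq_bigr do rewrite mulr_sumr.
    rewrite [RHS]exchange_big; apply: eq_bigr => b _; rewrite mxE mulr_suml.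
    by apply: eq_bigr => c _; rewrite mulrA.
  apply: eq_bigr => c _; congr (_ * _); rewrite -Sdot_sumr; congr (Sdot _ _ _).
  apply/funext => B; rewrite row_ins row'_ins -rowE w_ins_basis//.
  by apply: eq_bigr => b _; rewrite mxE.
rewrite SdotDr -TE mulrDr.
have -> : 2 * Sdot (H y) (A y) DA = Sdot (H y) DA (A y) + Sdot (H y) (A y) DA.
  by rewrite -[in X in _ = X + _]Hs Sdot_trmx; ring.
have T2 : T = \sum_(I : {ffun 'I_k -> 'I_n}) \sum_(J : {ffun 'I_k -> 'I_n})
  (\sum_l (H y *m X) (J l) (I l) * \prod_(m | m != l) H y (I m) (J m)) *
  A y (stdrows R I) * A y (stdrows R J).
  rewrite /T exchange_big; apply: eq_bigr => I _; apply: eq_bigr => J _.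
  rewrite mulrAC; congr (_ * _ * _); apply: eq_bigr => l _; congr (_ * _).
  by apply: eq_bigr => m _; rewrite -[in LHS]Hs mxE.
rewrite mulr_natl mulr2n {2}T2 /T /Sdot -!big_split; apply: eq_bigr => I _.
rewrite (d3 I).2 -!big_split; apply: eq_bigr => J _ /=.
rewrite (derive_mul v (d1 I J) (dA _)) (derive_mul v (dprod I J).1 (dA _)).
rewrite (dprod I J).2.
have -> : \sum_(i <- index_enum 'I_k) 'D_v (fun z => H z (I i) (J i)) y *
    \prod_(j <- index_enum 'I_k | j != i) H y (I j) (J j) =
  \sum_l (H y *m X) (I l) (J l) * \prod_(m | m != l) H y (I m) (J m) +
  \sum_l (H y *m X) (J l) (I l) * \prod_(m | m != l) H y (I m) (J m).
  by rewrite -big_split; apply: eq_bigr => l _ /=; rewrite DH mulrDl.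
rewrite -!/(DA _); ring.
Qed.

End Derivatives.

Section Parallel.
Context {R : realType} {n : nat} {M : smoothManifold R n}.
Variables (g : M -> 'M[R]_n) (gm : riemannian_metric g).
Variables (eta : kfield M 1) (etaO : Omega eta) (par : parallel g eta).
Local Notation G := (local_metric g).
Local Notation e i := (fun b y => localf i eta y (stdvec R b)).
Local Notation u i := (lsharp g i eta).

Definition Jsharp (i : chart M) (y : 'rV[R]_n) : 'M[R]_n :=
  \matrix_(a, c) partial a (fun z => lsharp g i eta z 0 c) y.

Lemma JsharpE i y a c : Jsharp i y a c = 'D_(stdvec R a) (fun z => lsharp g i eta z 0 c) y.
Proof. by rewrite mxE. Qed.

Lemma G_differentiable i y a b : cod i y -> differentiable (fun z => G i z a b) y.
Proof.
move=> iy; exact: (smooth_on_differentiable (@cod_open _ _ M i) (@local_metric_smooth _ _ _ _ gm i a b) iy).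
Qed.

Lemma lsharp_differentiable i y c : cod i y -> differentiable (fun z => lsharp g i eta z 0 c) y.
Proof.
move=> iy; exact: (smooth_on_differentiable (@cod_open _ _ M i) (@lsharp_smooth _ _ _ _ gm i _ c etaO) iy).
Qed.

Lemma localf_differentiable k (alpha : kfield M k) i y B : Omega alpha -> cod i y ->
  differentiable (fun z => localf i alpha z B) y.
Proof.
move=> [_ _ s] iy; exact: (smooth_on_differentiable (@cod_open _ _ M i) (s i B) iy).
Qed.

Lemma lower_lsharp i y b : cod i y -> e i b y = \sum_c u i y 0 c * G i y c b.
Proof.
move=> iy; transitivity ((u i y *m G i y) 0 b); last by rewrite mxE.
by rewrite /lsharp mulmxKV ?mxE// (posdef_unitmx (local_metric_posdef gm iy)).
Qed.

Lemma partial_lower i y a b : cod i y -> partial a (e i b) y =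
  \sum_c (Jsharp i y a c * G i y c b + u i y 0 c * partial a (fun z => G i z c b) y).
Proof.
move=> iy.
have E := partial_eq_on a (@cod_open _ _ M i) (fun z iz => @lower_lsharp i z b iz) iy.
have dm c : differentiable (fun z => u i z 0 c * G i z c b) y.
  by apply: differentiableM; [exact: lsharp_differentiable|exact: G_differentiable].
apply: (etrans E); rewrite /partial (derive_bigsum _ _ _ dm).2; apply: eq_bigr => c _.
rewrite derive_mul; [|exact: lsharp_differentiable|exact: G_differentiable].
by rewrite addrC JsharpE.
Qed.

(** A parallel form satisfies d_a eta_b = Gamma_ab^c eta_c, and the inverse metric inside the
    Christoffel symbol raises the index of eta. *)
Lemma parallel_partial i y a b : cod i y -> partial a (e i b) y =
  2^-1 * \sum_c u i y 0 c * (partial a (fun z => G i z b c) y +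
    partial b (fun z => G i z a c) y - partial c (fun z => G i z a b) y).
Proof.
move=> iy; have /eqP := par iy a b; rewrite /nabla1 subr_eq0 => /eqP ->.
rewrite /christoffel.
under eq_bigr do rewrite -mulrA mulr_suml.
rewrite -mulr_sumr exchange_big; congr (_ * _); apply: eq_bigr => c _.
rewrite [u i y 0 c]mxE mulr_suml; apply: eq_bigr => d _ /=.
by rewrite mxE; ring.
Qed.

Lemma G_sym i y a b : G i y a b = G i y b a.
Proof. exact: local_metric_sym. Qed.

Lemma partial_G_sym i y a b c : partial a (fun z => G i z b c) y = partial a (fun z => G i z c b) y.
Proof. by congr (partial _ _ _); apply/funext => z; exact: G_sym. Qed.

(** This is L_U g = 0 in coordinates. Comparing the product rule for eta_b = u^c g_cb with
    [parallel_partial], for (a, b) and for (b, a), and adding, cancels every term except the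
    derivative of g along U and the Jacobian of U. *)
Lemma killing i y a b : cod i y ->
  'D_(u i y) (fun z => G i z a b) y = - ((Jsharp i y *m G i y) a b + (Jsharp i y *m G i y) b a).
Proof.
move=> iy; have E1 := parallel_partial a b iy; have E2 := parallel_partial b a iy.
rewrite partial_lower// big_split /= in E1.
rewrite partial_lower// big_split /= in E2.
rewrite differentiable_deriveE; last exact: G_differentiable.
rewrite ![(Jsharp i y *m G i y) _ _]mxE.
set J1 := \sum_c Jsharp i y a c * _ in E1 *.
set J2 := \sum_c Jsharp i y b c * _ in E2 *.
pose S1 := \sum_c u i y 0 c * partial a (fun z => G i z c b) y.
pose S2 := \sum_c u i y 0 c * partial b (fun z => G i z c a) y.
pose S3 := \sum_c u i y 0 c * partial c (fun z => G i z a b) y.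
have E1' : J1 + S1 = 2^-1 * (S1 + S2 - S3).
  rewrite /S1 E1 /S2 /S3; congr (_ * _); rewrite -big_split -sumrB; apply: eq_bigr => c _ /=.
  by rewrite (partial_G_sym i y a b c) (partial_G_sym i y b a c); ring.
have E2' : J2 + S2 = 2^-1 * (S1 + S2 - S3).
  rewrite /S2 E2 /S1 /S3; congr (_ * _); rewrite -big_split -sumrB; apply: eq_bigr => c _ /=.
  by rewrite (partial_G_sym i y a b c) (partial_G_sym i y b a c) (partial_G_sym i y c b a); ring.
have : S3 = - (J1 + J2) by lra.
exact.
Qed.

(** With P = (d_a u^b) eta_b and Q = u^b u^c d_a g_bc, the sum u^b d_a eta_b is P + Q by the product
    rule and Q/2 by parallelism. Hence the derivative of the norm, P + Q/2, is 0. *)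
Lemma partial_norm i y a : cod i y ->
  partial a (fun z => eta (psi i z) (sharp g eta (psi i z))) y = 0.
Proof.
move=> iy.
pose N z := \sum_b u i z 0 b * e i b z.
have NE z : cod i z -> eta (psi i z) (sharp g eta (psi i z)) = N z.
  move=> iz; rewrite (sharp_local gm etaO iz).
  exact: (oneform_sum _ (@localf_multilinear _ _ _ 1 eta i z etaO)).
rewrite (partial_eq_on a (@cod_open _ _ M i) NE iy).
have dm b : differentiable (fun z => u i z 0 b * e i b z) y.
  by apply: differentiableM; [exact: lsharp_differentiable|exact: localf_differentiable].
rewrite /partial (derive_bigsum _ _ _ dm).2.
pose Q := \sum_b \sum_c u i y 0 b * u i y 0 c * partial a (fun z => G i z b c) y.
pose P := \sum_b Jsharp i y a b * e i b y.
have E1 : \sum_b u i y 0 b * partial a (e i b) y = 2^-1 * Q.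
  under eq_bigr do rewrite parallel_partial//.
  (* The other two derivatives in the Christoffel symbol are exchanged by swapping b and c, so they
     cancel against the symmetric u^b u^c. *)
  have -> : 2^-1 * Q = 2^-1 * Q + (2^-1 * \sum_b \sum_c u i y 0 b * u i y 0 c * partial b (fun z => G i z a c) y
     - 2^-1 * \sum_b \sum_c u i y 0 b * u i y 0 c * partial c (fun z => G i z a b) y).
    have -> : \sum_b \sum_c u i y 0 b * u i y 0 c * partial b (fun z => G i z a c) y =
        \sum_b \sum_c u i y 0 b * u i y 0 c * partial c (fun z => G i z a b) y.
      rewrite exchange_big; apply: eq_bigr => b _; apply: eq_bigr => c _.
      by rewrite [u i y 0 c * _]mulrC.
    by rewrite subrr addr0.
  rewrite -mulrBr -mulrDr -sumrB /Q -big_split /= mulr_sumr; apply: eq_bigr => b _.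
  rewrite -sumrB -big_split /= mulrCA; congr (_ * _); rewrite mulr_sumr.
  by apply: eq_bigr => c _; ring.
have E2 : \sum_b u i y 0 b * partial a (e i b) y = P + Q.
  under eq_bigr do rewrite partial_lower//.
  under eq_bigr do rewrite big_split mulrDr.
  rewrite big_split /=; congr (_ + _); last first.
    apply: eq_bigr => b _; rewrite mulr_sumr; apply: eq_bigr => c _.
    by rewrite mulrA (partial_G_sym i y a c b).
  under eq_bigr do rewrite mulr_sumr.
  rewrite exchange_big; apply: eq_bigr => c _ /=; rewrite lower_lsharp// mulr_sumr.
  by apply: eq_bigr => b _; rewrite (G_sym i y c b); ring.
have -> : \sum_b 'D_(stdvec R a) (fun z => u i z 0 b * e i b z) y = P + 2^-1 * Q.
  rewrite -E1 /P -big_split; apply: eq_bigr => b _ /=.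
  rewrite derive_mul; [|exact: lsharp_differentiable|exact: localf_differentiable].
  by rewrite addrC JsharpE.
lra.
Qed.

Definition enorm (x : M) : R := eta x (sharp g eta x).

Lemma enorm_smooth : smooth_fun enorm.
Proof. exact: pairing_smooth. Qed.

(** All partial derivatives vanish, so the mean value theorem along segments gives local constancy
    in a coordinate ball; connectedness then makes it global. *)
Lemma enorm_near x : \forall z \near x, enorm z = enorm x.
Proof.
have ix := chart_atP x; set i := chart_at x in ix.
have [r r0 yr] := nbhs_norm_ex (cod_nbhs (cod_phi ix)).
have := phi_near ix (nbhs_norm_lt (phi i x) r0).
apply: filterS => z [iz zr].
rewrite -{1}(phiK iz) -[in RHS](phiK ix).
have seg t : 0 <= t <= 1 -> cod i (phi i x + t *: (phi i z - phi i x)).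
  case/andP => t0 t1; apply: yr; rewrite addrC addKr normrZ (ger0_norm t0).
  exact: le_lt_trans (ler_piMl (normr_ge0 _) t1) zr.
have [t t01|t t01 E] := @MVT_line R n (enorm \o psi i) (phi i x) (phi i z - phi i x).
  apply: diff_derivable; apply: smooth_fun_differentiable; first exact: enorm_smooth.
  exact: seg.
apply/eqP; rewrite -subr_eq0; apply/eqP.
move: E; rewrite subrKC => E; apply: (etrans E).
rewrite (derive_chartE _ enorm_smooth (seg t t01)) big1// => a _.
by rewrite (partial_norm a (seg t t01)) mulr0.
Qed.

Lemma enorm_cst : connected [set: M] -> forall x x', enorm x = enorm x'.
Proof.
move=> Mconn x x'.
have op : open [set z | enorm z = enorm x'].
  by rewrite openE => z /= zx; have := enorm_near z; apply: filterS => w /= ->.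
have cl : closed [set z | enorm z = enorm x'].
  rewrite -openC openE => z /= zx; have := enorm_near z.
  by apply: filterS => w /= ->.
suff : [set z | enorm z = enorm x'] = setT by move=> /seteqP[_ /(_ x)]; exact.
apply: Mconn; first by exists x'.
  by exists [set z | enorm z = enorm x']; rewrite ?setTI.
by exists [set z | enorm z = enorm x']; rewrite ?setTI.
Qed.

Lemma enorm_gt0 x A : eta x A != 0 -> 0 < enorm x.
Proof.
rewrite /enorm (sharpP _ (sharp g eta x) gm etaO) (sharpP _ A gm etaO).
have [->|v0 _] := eqVneq (sharp g eta x) 0.
  by rewrite /gdot trmx0 mulmx0 mxE eqxx.
by case: gm => _ /(_ x _ v0).
Qed.

Lemma invmx_differentiable i y a b : cod i y -> differentiable (fun z => invmx (G i z) a b) y.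
Proof.
move=> iy; exact: (smooth_on_differentiable (@cod_open _ _ M i) (@invmx_metric_smooth _ _ _ _ gm i a b) iy).
Qed.

Lemma G_trmx i y : (G i y)^T = G i y.
Proof. by apply/matrixP => a b; rewrite mxE G_sym. Qed.

(** Differentiating (inverse of G) * G = 1 along U carries the Killing equation over to the inverse
    metric, in the form that [derive_Sdot] expects. *)
Lemma derive_invmx i y a b : cod i y ->
  'D_(u i y) (fun z => invmx (G i z) a b) y =
  (invmx (G i y) *m Jsharp i y) a b + (invmx (G i y) *m Jsharp i y) b a.
Proof.
move=> iy; pose H := invmx (G i y); pose J := Jsharp i y.
have Gu z : cod i z -> G i z \in unitmx by move=> iz; exact: posdef_unitmx (local_metric_posdef gm iz).
pose DH : 'M[R]_n := \matrix_(a, b) 'D_(u i y) (fun z => invmx (G i z) a b) y.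
pose DG : 'M[R]_n := \matrix_(a, b) 'D_(u i y) (fun z => G i z a b) y.
have DGE : DG = - (J *m G i y + (J *m G i y)^T).
  by apply/matrixP => c d; rewrite mxE killing// [RHS]mxE [in RHS]mxE [_^T c d]mxE.
have E : DH *m G i y + H *m DG = 0.
  apply/matrixP => c d; rewrite !mxE -big_split /=.
  have dm f : differentiable (fun z => invmx (G i z) c f * G i z f d) y.
    by apply: differentiableM; [exact: invmx_differentiable|exact: G_differentiable].
  transitivity ('D_(u i y) (fun z => \sum_f invmx (G i z) c f * G i z f d) y).
    rewrite (derive_bigsum _ _ _ dm).2; apply: eq_bigr => f _.
    rewrite (derive_mul _ (invmx_differentiable c f iy) (G_differentiable f d iy)) addrC.
    by rewrite [DH c f]mxE [DG f d]mxE.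
  transitivity ('D_(u i y) (cst ((c == d)%:R : R)) y); last by rewrite derive_cst.
  apply: near_eq_derive; have := cod_nbhs iy; apply: filterS => z iz.
  by have /matrixP/(_ c d) := mulVmx (Gu z iz); rewrite !mxE.
have HT : H^T = H by rewrite /H trmx_inv G_trmx.
have : DH = H *m J + (H *m J)^T.
  have Gy := Gu y iy; apply: (can_inj (mulmxK Gy)); apply/eqP; rewrite -subr_eq0; apply/eqP.
  rewrite -[RHS]E; congr (_ + _); rewrite DGE mulmxN; congr (- _).
  exact: (killing_inv J HT (G_trmx i y) (mulmxV Gy) (mulVmx Gy)).
move=> /matrixP/(_ a b); rewrite [LHS]mxE [RHS]mxE [_^T a b]mxE; exact.
Qed.

(* The Lie derivative of alpha along the sharp of eta, in the chart i. *)
Definition lie k (alpha : kfield M k) i y (B : 'M[R]_(k, n)) : R :=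
  'D_(u i y) (fun z => localf i alpha z B) y +
  \sum_l localf i alpha y (\matrix_(m, c) if m == l then (row l B *m Jsharp i y) 0 c else B m c).

Lemma derive_form_dot k (alpha : kfield M k) i y : Omega alpha -> cod i y ->
  'D_(u i y) (form_dot g alpha alpha \o psi i) y =
  2 * ((k`!%:R)^-1 * Sdot (invmx (G i y)) (localf i alpha y) (lie alpha i y)).
Proof.
move=> aO iy.
have E : \near y, (form_dot g alpha alpha \o psi i) y =
   (fun z => (k`!%:R)^-1 * Sdot (invmx (G i z)) (localf i alpha z) (localf i alpha z)) y.
  have := cod_nbhs iy; apply: filterS => z iz; exact: form_dot_local.
rewrite (near_eq_derive _ E).
have dS : differentiable (fun z => Sdot (invmx (G i z)) (localf i alpha z) (localf i alpha z)) y.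
  apply: (derive_bigsum _ _ 0 _).1 => I; apply: (derive_bigsum _ _ 0 _).1 => J.
  apply: differentiableM; last exact: localf_differentiable.
  apply: differentiableM; last exact: localf_differentiable.
  apply: (@derive_bigprod _ _ _ _ (fun l z => invmx (G i z) (I l) (J l)) _ 0 _ (index_enum_uniq _)).1 => l.
  exact: invmx_differentiable.
rewrite (derive_mul (u i y) (differentiable_cst (k`!%:R^-1 : R) y) dS).
rewrite (@derive_cst R _ R (k`!%:R^-1 : R)) mul0r addr0 mulrCA; congr (_ * _).
apply: (derive_Sdot (X := Jsharp i y)) => [a b|B|||a b].
- exact: invmx_differentiable.
- exact: localf_differentiable.
- exact: localf_multilinear.
- by rewrite trmx_inv G_trmx.
- exact: derive_invmx.
Qed.

Lemma derive_lsharp i y v c : cod i y ->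
  'D_v (fun z => u i z 0 c) y = (v *m Jsharp i y) 0 c.
Proof.
move=> iy; rewrite differentiable_deriveE; last exact: lsharp_differentiable.
by rewrite mxE; apply: eq_bigr => a _; rewrite mxE.
Qed.

Lemma derive_contract k (alpha : kfield M k.+1) i y v B : Omega alpha -> cod i y ->
  'D_v (fun z => localf i (contract (sharp g eta) alpha) z B) y =
  localf i alpha y (col_mx (v *m Jsharp i y) B) +
  'D_v (fun z => localf i alpha z (col_mx (u i y) B)) y.
Proof.
move=> aO iy.
have E : \near y, localf i (contract (sharp g eta) alpha) y B =
   (fun z => \sum_c u i z 0 c * localf i alpha z (ins_row 0 (stdvec R c) B)) y.
  have := cod_nbhs iy; apply: filterS => z iz.
  rewrite (localf_contract gm _ _ etaO iz) -ins_row0 w_ins_basis//.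
  exact: localf_multilinear.
rewrite (near_eq_derive _ E).
have dm c : differentiable (fun z => u i z 0 c * localf i alpha z (ins_row 0 (stdvec R c) B)) y.
  by apply: differentiableM; [exact: lsharp_differentiable|exact: localf_differentiable].
rewrite (derive_bigsum _ _ _ dm).2.
have dm' c : differentiable (fun z => u i y 0 c * localf i alpha z (ins_row 0 (stdvec R c) B)) y.
  by apply: differentiableM; [exact: differentiable_cst|exact: localf_differentiable].
have -> : (fun z => localf i alpha z (col_mx (u i y) B)) =
    (fun z => \sum_c u i y 0 c * localf i alpha z (ins_row 0 (stdvec R c) B)).
  by apply/funext => z; rewrite -ins_row0 w_ins_basis//; exact: localf_multilinear.
rewrite (derive_bigsum _ _ _ dm').2 -ins_row0 w_ins_basis; last exact: localf_multilinear.
rewrite -big_split; apply: eq_bigr => c _ /=.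
have dA := localf_differentiable (ins_row 0 (stdvec R c) B) aO iy.
have e1 := derive_mul v (lsharp_differentiable c iy) dA.
have e2 := derive_mul v (differentiable_cst (u i y 0 c : R) y) dA.
have e3 := derive_lsharp v c iy.
have e4 : 'D_v (cst (u i y 0 c : R)) y = 0 by exact: derive_cst.
rewrite e4 mul0r addr0 in e2; rewrite e3 addrC in e1.
exact: (etrans e1 (congr1 (+%R _) (esym e2))).
Qed.

Lemma sharp_at x : sharp g eta x = u (chart_at x) (phi (chart_at x) x).
Proof.
have ix := chart_atP x.
by have := sharp_local gm etaO (cod_phi ix); rewrite phiK// frame_chart_at mulmx1.
Qed.

(** The term j = 0 of d alpha (U, ...) is the derivative of alpha along U. In d (i_U alpha) the
    terms that differentiate alpha cancel against the remaining terms of d alpha, and those that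
    differentiate U are the Jacobian terms of the Lie derivative. *)
Lemma cartan k (alpha : kfield M k.+1) x A : Omega alpha ->
  ext_d (contract (sharp g eta) alpha) x A + ext_d alpha x (col_mx (sharp g eta x) A) =
  lie alpha (chart_at x) (phi (chart_at x) x) A.
Proof.
move=> aO; set i := chart_at x; set y := phi i x.
have iy : cod i y := cod_phi (chart_atP x).
rewrite sharp_at -/i -/y /ext_d -/i -/y [X in _ + X]big_ord_recl /= expr0 mul1r.
rewrite (row0_col_mx (u i y) A) (row'0_col_mx (u i y) A) addrCA; congr (_ + _).
rewrite -big_split; apply: eq_bigr => j _ /=.
rewrite derive_contract// mulrDr -addrA.
rewrite (_ : row (lift ord0 j) (col_mx (u i y) A) = row j A); last first.
  by rewrite -ins_row0 row_ins_lift.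
rewrite (_ : row' (lift ord0 j) (col_mx (u i y) A) = col_mx (u i y) (row' j A)); last first.
  rewrite -!ins_row0; apply/matrixP => l c; rewrite !mxE.
  case: (unliftP ord0 l) => [l'|] ->.
    have -> : lift (lift ord0 j) (lift ord0 l') = lift ord0 (lift j l').
      by apply: val_inj; rewrite /= /bump; lia.
    by rewrite !liftK mxE.
  have -> : lift (lift ord0 j) ord0 = ord0 by apply: val_inj.
  by rewrite !unlift_none.
(* Having U in row 0 shifts the index by one, hence the opposite sign and the cancellation. *)
rewrite -[bump 0 j]/(j.+1) exprS mulN1r mulNr subrr addr0.
rewrite -alternating_ins_sign; [|exact: localf_multilinear|exact: localf_alternating].
congr (localf i alpha y _); apply/matrixP => l c; rewrite !mxE.
case: unliftP => [l'|] ->; first by rewrite eq_sym (negbTE (neq_lift _ _)) mxE.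
by rewrite eqxx.
Qed.

Lemma ext_d_scale k (h : M -> R) (beta : kfield M k) x A : smooth_fun h -> Omega beta ->
  ext_d (fun x B => h x * beta x B) x A = h x * ext_d beta x A + wedge1 (dform h) beta x A.
Proof.
move=> sh bO; rewrite /ext_d /wedge1 mulr_sumr -big_split; apply: eq_bigr => j _ /=.
have iy := cod_phi (chart_atP x).
have dh := smooth_fun_differentiable sh iy.
have db := localf_differentiable (row' j A) bO iy.
rewrite -[in RHS](localf_at beta) (_ : h x = (h \o psi (chart_at x)) (phi (chart_at x) x)); last first.
  by rewrite /= phiK//; exact: chart_atP.
have e1 := derive_mul (row j A) dh db.
apply: (etrans (congr1 ( *%R _) e1)); rewrite /dform; ring.
Qed.

(** The factor k+1 of [Sdot_adjoint] is absorbed by the factorials in [form_dot]. *)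
Lemma form_dot_wedge k (w : kfield M 1) (beta : kfield M k) (alpha : kfield M k.+1) x :
  Omega alpha ->
  form_dot g (wedge1 w beta) alpha x = form_dot g beta (contract (sharp g w) alpha) x.
Proof.
move=> [al aa _]; rewrite !form_dotE [wedge1 w beta x]/(wedge1 w beta x).
have -> : Sdot (invmx (g x)) (wedge1 w beta x) (alpha x) =
  k.+1%:R * Sdot (invmx (g x)) (beta x) (contract (sharp g w) alpha x).
  exact: Sdot_adjoint.
by rewrite factS natrM invfM mulrACA mulVf ?mul1r// pnatr_eq0.
Qed.

Lemma form_dotC k (alpha beta : kfield M k) x : form_dot g alpha beta x = form_dot g beta alpha x.
Proof.
by rewrite !form_dotE -Sdot_trmx trmx_inv Defs.metric_sym.
Qed.

Lemma form_dot_ge0 k (alpha : kfield M k) x : multilinear_rows (alpha x) -> 0 <= form_dot g alpha alpha x.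
Proof.
move=> al; rewrite form_dotE mulr_ge0 ?invr_ge0//; apply: Sdot_ge0 => //.
exact: metric_posdef.
Qed.

Lemma form_dot_le0 k (alpha : kfield M k) x : multilinear_rows (alpha x) ->
  form_dot g alpha alpha x <= 0 -> alpha x = fun=> 0.
Proof.
move=> al; rewrite form_dotE pmulr_rle0 ?invr_gt0 ?ltr0n ?fact_gt0//.
by apply: Sdot_eq0 => //; exact: metric_posdef.
Qed.

Lemma wedge_contract k (w : kfield M 1) (alpha : kfield M k.+1) x B :
  wedge1 w alpha x (col_mx (sharp g w x) B) =
  w x (sharp g w x) * alpha x B - wedge1 w (contract (sharp g w) alpha) x B.
Proof. exact: contract_wedge. Qed.

(** * The pointwise energy identity *)

Section Harmonic.
Variables (k : nat) (alpha : kfield M k.+1) (alphaO : Omega alpha).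
Hypothesis closed : d_eta eta alpha = 0.
Let beta := contract (sharp g eta) alpha.

Lemma ext_d_closed x A : ext_d alpha x A = - wedge1 eta alpha x A.
Proof.
apply/eqP; rewrite -addr_eq0; apply/eqP.
by have := congr1 (fun f : kfield M k.+2 => f x A) closed.
Qed.

Lemma ext_d_contract x A : ext_d beta x A =
  lie alpha (chart_at x) (phi (chart_at x) x) A + enorm x * alpha x A - wedge1 eta beta x A.
Proof.
by rewrite -cartan// ext_d_closed wedge_contract -/(enorm x) /beta; ring.
Qed.

Lemma form_dot_lie x :
  (k.+1`!%:R)^-1 * Sdot (invmx (g x)) (lie alpha (chart_at x) (phi (chart_at x) x)) (alpha x) =
  2^-1 * dform (form_dot g alpha alpha) x (sharp g eta x).
Proof.
have iy := cod_phi (chart_atP x).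
rewrite /dform sharp_at (derive_form_dot alphaO iy) mulrA mulVf ?pnatr_eq0// mul1r.
congr (_ * _); rewrite /local_metric phiK; last exact: chart_atP.
rewrite frame_chart_at trmx1 mulmx1 mul1mx -Sdot_trmx trmx_inv Defs.metric_sym//.
by congr (Sdot _ _ _); apply/funext => B; rewrite localf_at.
Qed.

(* Integrated against the codifferential, the left-hand side vanishes. *)
Lemma energy_pointwise (h : M -> R) x : smooth_fun h ->
  form_dot g (ext_d (fun x B => h x * beta x B)) alpha x + h x * form_dot g beta beta x =
  form_dot g beta (contract (sharp g (dform h)) alpha) x +
  h x * (2^-1 * dform (form_dot g alpha alpha) x (sharp g eta x) + enorm x * form_dot g alpha alpha x).
Proof.
move=> sh; have bO : Omega beta := contract_Omega gm etaO alphaO.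
rewrite -(form_dot_wedge (dform h) beta x alphaO) -(form_dot_wedge eta beta x alphaO).
rewrite -form_dot_lie !form_dotE.
have -> : ext_d (fun x B => h x * beta x B) x =
  (fun A => h x * lie alpha (chart_at x) (phi (chart_at x) x) A + (h x * enorm x * alpha x A +
     ((- h x) * wedge1 eta beta x A + wedge1 (dform h) beta x A))).
  by apply/funext => A; rewrite ext_d_scale// ext_d_contract; ring.
rewrite (Sdot_comb4 (invmx (g x)) (h x) (h x * enorm x) (- h x)
  (lie alpha (chart_at x) (phi (chart_at x) x)) (alpha x) (wedge1 eta beta x)
  (wedge1 (dform h) beta x) (alpha x)); ring.
Qed.

End Harmonic.

(** For a function the equation gives U alpha = - |eta|^2 alpha, and multiplying by alpha gives the
    identity at every point. *)
Lemma energy_pointwise0 (alpha : kfield M 0) x : Omega alpha -> d_eta eta alpha = 0 ->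
  2^-1 * dform (form_dot g alpha alpha) x (sharp g eta x) + enorm x * form_dot g alpha alpha x = 0.
Proof.
move=> aO closed.
have iy := cod_phi (chart_atP x).
have E : ext_d alpha x (sharp g eta x) = - wedge1 eta alpha x (sharp g eta x).
  apply/eqP; rewrite -addr_eq0; apply/eqP.
  by have := congr1 (fun f : kfield M 1 => f x (sharp g eta x)) closed.
rewrite /ext_d /wedge1 !big_ord1 expr0 !mul1r in E.
have row0 (X : 'M[R]_(1, n)) : row 0 X = X by apply/rowP => a; rewrite mxE.
rewrite !row0 -/(enorm x) in E.
rewrite {1}/dform {1}sharp_at (derive_form_dot aO iy) mulrA mulVf ?pnatr_eq0// mul1r.
have -> : lie alpha (chart_at x) (phi (chart_at x) x) =
    (fun B => - enorm x * localf (chart_at x) alpha (phi (chart_at x) x) B).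
  apply/funext => B; rewrite /lie big_ord0 addr0 -sharp_at localf_at mulNr.
  by rewrite (flatmx0 B) -(flatmx0 (row' ord0 (sharp g eta x))).
have FE := form_dot_local gm aO aO iy; rewrite (phiK (chart_atP x)) in FE.
rewrite (SdotZr (invmx (G (chart_at x) (phi (chart_at x) x))) (- enorm x)) FE.
by rewrite mulrCA mulNr addNr.
Qed.

End Parallel.

(** * Lebesgue measure on R^n *)

Section RowModel.
Context {R : realType}.

Definition leb : {sigma_finite_measure set (measurableTypeR R) -> \bar R} := lebesgue_measure.

Definition cons_row n (t : R) (y : 'rV[R]_n) : 'rV[R]_n.+1 := row_mx (const_mx t : 'rV_1) y.

Lemma cons_row0 n t (y : 'rV[R]_n) : cons_row t y 0 0 = t.
Proof.
rewrite /cons_row; have -> : (0 : 'I_n.+1) = lshift n (0 : 'I_1) by apply: val_inj.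
by rewrite (@row_mxEl _ 1 1 n (const_mx t) y 0 0) mxE.
Qed.

Lemma cons_row_lift n t (y : 'rV[R]_n) b : cons_row t y 0 (lift ord0 b) = y 0 b.
Proof.
rewrite /cons_row; have -> : lift ord0 b = rshift 1 b :> 'I_(1 + n) by apply: val_inj.
by rewrite (@row_mxEr _ 1 1 n (const_mx t) y 0 b).
Qed.

Lemma cons_rowB n s t (y z : 'rV[R]_n) :
  cons_row s y - cons_row t z = cons_row (s - t) (y - z).
Proof.
apply/rowP => a; rewrite [LHS]mxE [in X in _ + X]mxE.
by case: (unliftP ord0 a) => [b|] ->; rewrite ?cons_row_lift ?cons_row0 ?mxE.
Qed.

Lemma rV_norm_lt n (v : 'rV[R]_n) r : 0 < r -> (`|v| < r) <-> forall a, `|v 0 a| < r.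
Proof.
move=> r0; split=> [vr a|vr]; first exact: le_lt_trans (rV_norm_coord v a) vr.
rewrite /Num.norm /= mx_normrE; apply/bigmax_ltP; split => //= -[i a] _ /=.
by rewrite (ord1 i).
Qed.

Lemma cons_row_norm_lt n t (y : 'rV[R]_n) r : 0 < r ->
  (`|cons_row t y| < r) <-> `|t| < r /\ `|y| < r.
Proof.
move=> r0; rewrite (rV_norm_lt _ r0) (rV_norm_lt y r0); split=> [H|[Ht Hy] a].
  split; first by have := H 0; rewrite cons_row0.
  by move=> b; have := H (lift ord0 b); rewrite cons_row_lift.
by case: (unliftP ord0 a) => [b|] ->; rewrite ?cons_row_lift ?cons_row0.
Qed.

Definition C1_bounded_support n (a : 'I_n) (r : R) (F : 'rV[R]_n -> R) :=
  [/\ continuous F, continuous (partial a F),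
      forall y, derivable F y (stdvec R a) & forall y, r <= `|y| -> F y = 0].

(* Iterated Lebesgue integrals as the integral over a product measure space T:
   rows are built from T by [vec], since 'rV[R]_n carries no product measure. *)
Definition rV_model n d (T : measurableType d) (mu : {sigma_finite_measure set T -> \bar R})
    (vec : T -> 'rV[R]_n) :=
  [/\ forall O, open O -> measurable (vec @^-1` O),
      forall f : 'rV[R]_n -> \bar R, (forall y, 0 <= f y)%E ->
        measurable_fun [set: T] (fun t => f (vec t)) ->
        lebesgue_integral_rV f = (\int[mu]_t f (vec t))%E,
      forall y r, 0 < r -> mu (vec @^-1` [set z | `|z - y| < r]) = ((r *+ 2) ^+ n)%:E
    & forall a r F, C1_bounded_support a r F ->
        (\int[mu]_t (partial a F (vec t))%:E = 0)%E].

Lemma rV_model0 : rV_model (@dirac _ unit tt R : {sigma_finite_measure set unit -> \bar R})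
  (fun=> 0 : 'rV[R]_0).
Proof.
split => //.
- move=> f f0 mf /=; rewrite integral_dirac//.
  by rewrite diracT mul1e.
- move=> y r r0; rewrite expr0 /= diracE mem_set//=.
  have -> : 0 - y = 0 by apply/rowP => -[].
  by rewrite normr0.
- by move=> [].
Qed.

Section Properties.
Context n d (T : measurableType d) (mu : {measure set T -> \bar R})
  (vec : T -> 'rV[R]_n)
  (mO : forall O, open O -> measurable (vec @^-1` O))
  (mB : forall y r, 0 < r -> mu (vec @^-1` [set z | `|z - y| < r]) = ((r *+ 2) ^+ n)%:E).

Lemma model_measurable_fun (F : 'rV[R]_n -> R) : continuous F ->
  measurable_fun [set: T] (fun t => F (vec t)).
Proof.
move=> /continuousP cF; apply: (measurability _ (RGenOpens.measurableE R)).
move=> _ [_ [a [b ->] <-]].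
rewrite setTI.
change (measurable (vec @^-1` (F @^-1` `]a, b[))).
by apply: mO; apply: cF; exact: interval_open.
Qed.

Lemma bounded_support_bounded (F : 'rV[R]_n -> R) r : continuous F ->
  (forall y, r <= `|y| -> F y = 0) -> exists2 C, 0 <= C & forall y, `|F y| <= C.
Proof.
move=> cF F0.
have cK : compact [set y : 'rV[R]_n | `|y| <= r].
  have := @compact_norm_le R n 0 r; congr compact.
  by apply/seteqP; split => y /=; rewrite subr0.
have /compact_bounded[C [_ HC]] : compact (F @` [set y | `|y| <= r]).
  by apply: continuous_compact => //; exact: continuous_subspaceT.
exists (`|C| + 1); first by rewrite addr_ge0.
move=> y; have [yr|/ltW yr] := leP `|y| r.
  by apply: HC; [rewrite (le_lt_trans (ler_norm C))// ltrDl|exists y].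
by rewrite F0// normr0 addr_ge0.
Qed.

Lemma model_integrable (F : 'rV[R]_n -> R) r : continuous F ->
  (forall y, r <= `|y| -> F y = 0) ->
  mu.-integrable [set: T] (fun t => (F (vec t))%:E).
Proof.
move=> cF F0; have [C C0 HC] := bounded_support_bounded cF F0.
(* The radius r may be negative; the enclosing ball needs a positive one. *)
pose r1 := `|r| + 1; have r10 : 0 < r1 by rewrite ltr_wpDl.
pose B := vec @^-1` [set z | `|z - 0| < r1].
have muB : mu B = ((r1 *+ 2) ^+ n)%:E := @mB 0 r1 r10.
have mBm : measurable B by apply: mO; exact: open_norm_lt.
apply: (@le_integrable _ _ _ _ _ measurableT _ (fun t => (C * \1_B t)%:E)).
- by apply/measurable_EFinP; exact: model_measurable_fun.
- move=> t _; rewrite !abse_EFin lee_fin.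
  have [tB|tB] := pselect (B t).
    by rewrite indicE mem_set// mulr1 [leRHS]ger0_norm.
  rewrite F0 ?normr0//; move: tB; rewrite /B /= subr0 => /negP; rewrite -leNgt.
  by apply: le_trans; rewrite /r1 (le_trans (ler_norm r))// lerDl.
- apply/integrableP; split.
    by apply/measurable_EFinP/measurable_funM => //; exact: measurable_indic.
  under eq_integral => t _ do rewrite abse_EFin ger0_norm ?mulr_ge0// EFinM.
  rewrite ge0_integralZl//; last by apply/measurable_EFinP; exact: measurable_indic.
  have -> : (\int[mu]_x (\1_B x)%:E)%E = ((r1 *+ 2) ^+ n)%:E.
    by rewrite integral_indic// setIT; exact: muB.
  by rewrite -EFinM; exact: ltry.
Qed.

End Properties.

(** The fundamental theorem of calculus on an interval whose end points lie outside the support. *)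
Lemma FTC_bounded_support (f : R -> R) r : 0 < r -> (forall t, derivable f t 1) ->
  continuous (fun t => 'D_1 f t) -> (forall t, r <= `|t| -> f t = 0) ->
  (\int[leb]_t ('D_1 f t)%:E = 0)%E.
Proof.
(* The margin 1 ensures that f vanishes near every point outside the interval, so that its
   derivative vanishes there too. *)
move=> r0 df cf f0; pose r1 := r + 1.
have r1r : - r1 < r1 by rewrite /r1; lra.
have D0 t : ~ `[- r1, r1]%classic t -> 'D_1 f t = 0.
  rewrite /= in_itv /= -ler_norml => /negP; rewrite -ltNge => r1t.
  have E : \near t, cst 0 t = f t.
    have := nbhsx_ballx t 1 ltr01; apply: filterS => s.
    rewrite -ball_normE /= => ts; apply/esym/f0.
    by have := ler_distD s t 0; rewrite !subr0; move: r1t; rewrite /r1; lra.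
  by rewrite -(near_eq_derive _ E) derive_cst.
transitivity (\int[leb]_(t in `[(- r1)%R, r1]) ('D_1 f t)%:E)%E.
  rewrite [RHS]integral_mkcond; apply: eq_integral => t _; rewrite patchE.
  by case: ifPn => // /negP; rewrite inE => /D0 ->.
rewrite /leb (@continuous_FTC2 R (fun t => 'D_1 f t) f)//.
- have fr : f r1 = 0 by apply: f0; rewrite ger0_norm /r1; lra.
  have fr' : f (- r1) = 0 by apply: f0; rewrite normrN ger0_norm /r1; lra.
  by rewrite fr fr' -EFinB subrr.
- exact: continuous_subspaceT.
- have cff t : {for t, continuous f}.
    by apply: differentiable_continuous; apply/derivable1_diffP; exact: df.
  by split; [move=> t _; exact: df|exact: cvg_at_right_filter (cff _)|exact: cvg_at_left_filter (cff _)].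
- by move=> t _; rewrite derive1E.
Qed.

Section Step.
Context n d (T : measurableType d) (mu : {sigma_finite_measure set T -> \bar R})
  (vec : T -> 'rV[R]_n) (model : rV_model mu vec).

Definition vec_cons (p : measurableTypeR R * T) : 'rV[R]_n.+1 := cons_row p.1 (vec p.2).

(** An open set is a countable union of boxes with rational centre and radius 1/(m+1) in the first
    coordinate, and boxes are measurable in the product. *)
Lemma vec_cons_measurable O : open O -> measurable (vec_cons @^-1` O).
Proof.
move=> Oop; case: (model) => mO _ _ _.
(* The tails y for which the whole interval of radius 1/(m+1) around q stays in [O]; its interior is
   open, so the induction hypothesis applies. *)
pose S (q : rat) (m : nat) : set 'rV[R]_n :=
  [set y | forall s, `|s - ratr q| < m.+1%:R^-1 -> O (cons_row s y)].
have -> : vec_cons @^-1` O =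
    \bigcup_q \bigcup_m (ball (ratr q : R) m.+1%:R^-1 `*` (vec @^-1` (S q m)^°)).
  apply/seteqP; split => [[t0 u] /= Otu|[t u] [q _ [m _ [/= tq Su]]]].
    move: (t0 : R) Otu => t Otu {t0}.
    have : nbhs (vec_cons (t, u)) O by exact: open_nbhs_nbhs.
    move=> /nbhs_norm_ex[r r0 rO].
    have [m /= mr] : exists m : nat, (m.+1%:R^-1 : R) < r / 2.
      have r2 : 0 < r / 2 by rewrite divr_gt0.
      have := near_infty_natSinv_lt (PosNum r2).
      by move=> [m _ /(_ m (leqnn _))] H; exists m.
    have e0 : (0 : R) < m.+1%:R^-1 by rewrite invr_gt0.
    have te : t - m.+1%:R^-1 < t + m.+1%:R^-1 by rewrite ltrBlDr -addrA ltrDl addr_gt0.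
    have [q] := rat_in_itvoo te.
    rewrite in_itv /= => /andP[q1 q2].
    exists q => //; exists m => //; split => /=.
      have tq : `|ratr q - t| < m.+1%:R^-1 by rewrite ltr_distl q1 q2.
      by move: tq; rewrite -ball_normE.
    apply: filterS (nbhs_norm_lt (vec u) r0) => y /= yu s sq.
    apply: rO; rewrite /vec_cons /= cons_rowB; apply/(cons_row_norm_lt _ _ r0); split => //.
    have tq : `|ratr q - t| < m.+1%:R^-1 by rewrite ltr_distl q1 q2.
    apply: (le_lt_trans (ler_distD (ratr q) s t)).
    by rewrite [ltRHS]splitr ltrD// (lt_trans _ mr).
  have := interior_subset Su; apply; move: tq; rewrite -ball_normE /= distrC.
  exact.
apply: bigcupT_measurable_rat => q; apply: bigcupT_measurable => m.
apply: measurableX; first exact: measurable_ball.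
by apply: mO; exact: open_interior.
Qed.

Lemma vec_cons_integral (f : 'rV[R]_n.+1 -> \bar R) : (forall y, 0 <= f y)%E ->
  measurable_fun [set: measurableTypeR R * T] (fun p => f (vec_cons p)) ->
  lebesgue_integral_rV f = (\int[(leb \x mu)%E]_p f (vec_cons p))%E.
Proof.
move=> f0 mf; case: (model) => _ mI _ _.
rewrite fubini_tonelli1//=; apply: eq_integral => t _; rewrite /fubini_F.
rewrite (mI (fun y => f (row_mx (const_mx t : 'rV_1) y)))//.
exact: (measurableT_comp mf (pair1_measurable t)).
Qed.

(** For the sup norm, a ball of rows is an interval times a ball of one dimension less. *)
Lemma vec_cons_ball y r : 0 < r ->
  (leb \x mu)%E (vec_cons @^-1` [set z | `|z - y| < r]) = ((r *+ 2) ^+ n.+1)%:E.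
Proof.
move=> r0; case: (model) => mO _ mB _.
pose y' : 'rV[R]_n := \row_b y 0 (lift ord0 b).
have yE : y = cons_row (y 0 0) y'.
  apply/rowP => a; case: (unliftP ord0 a) => [b|] ->; rewrite ?cons_row_lift ?cons_row0 ?mxE//.
have -> : vec_cons @^-1` [set z | `|z - y| < r] =
   ball (y 0 0) r `*` (vec @^-1` [set z | `|z - y'| < r]).
  apply/seteqP; split => -[t u] /=; have := cons_row_norm_lt (t - y 0 0) (vec u - y') r0;
    rewrite -cons_rowB -yE -ball_normE /= [`|y 0 0 - _|]distrC; by case; auto.
rewrite product_measure1E//; [|exact: measurable_ball|by apply: mO; exact: open_norm_lt].
apply: (etrans (congr2 *%E (lebesgue_measure_ball _ (ltW r0)) (mB y' r r0))).
by rewrite -EFinM exprS.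
Qed.

Lemma cons_row_shift h s t n' (v y : 'rV[R]_n') :
  cons_row (h * s + t) (h *: v + y) = h *: cons_row s v + cons_row t y.
Proof.
apply/rowP => a; rewrite [RHS]mxE [X in _ = X + _]mxE.
by case: (unliftP ord0 a) => [b|] ->; rewrite ?cons_row_lift ?cons_row0 ?mxE.
Qed.

Lemma stdvec_cons0 : stdvec R (0 : 'I_n.+1) = cons_row 1 0.
Proof.
apply/rowP => a; rewrite [LHS]mxE /=.
by case: (unliftP ord0 a) => [b|] ->; rewrite ?cons_row_lift ?cons_row0 ?mxE.
Qed.

Lemma stdvec_cons_lift (b : 'I_n) : stdvec R (lift ord0 b) = cons_row 0 (stdvec R b).
Proof.
apply/rowP => a; rewrite [LHS]mxE /=.
case: (unliftP ord0 a) => [c|] ->; by rewrite ?cons_row_lift ?cons_row0 ?mxE.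
Qed.

Lemma cons_row_continuousl (y : 'rV[R]_n) : continuous (fun s => cons_row s y).
Proof.
move=> t; apply/cvgrPdist_lt => e e0.
apply: filterS (nbhsx_ballx t e e0) => s; rewrite -ball_normE /= => ts.
by rewrite cons_rowB subrr; apply/(cons_row_norm_lt _ _ e0); rewrite normr0.
Qed.

Lemma cons_row_continuousr t : continuous (fun y : 'rV[R]_n => cons_row t y).
Proof.
move=> y; apply/(@cvgrPdist_lt _ _ _ _ (nbhs_filter y)) => e e0.
apply: filterS (nbhs_norm_lt y e0) => s /= ys.
by rewrite cons_rowB subrr; apply/(cons_row_norm_lt _ _ e0); rewrite normr0 distrC.
Qed.

Section Sections.
Variables (F : 'rV[R]_n.+1 -> R).

Lemma derive_cons0 y :
  (fun t => 'D_1 (fun s => F (cons_row s y)) t) = (fun t => partial 0 F (cons_row t y)).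
Proof.
apply/funext => t; rewrite /partial /derive.
apply: (congr1 (fun q : R -> R => lim (q h @[h --> 0^']))); apply/funext => h /=.
by rewrite stdvec_cons0 -cons_row_shift scaler0 add0r.
Qed.

Lemma derivable_cons0 y t :
  derivable F (cons_row t y) (stdvec R 0) -> derivable (fun s => F (cons_row s y)) t 1.
Proof.
rewrite /derivable => H.
apply: (eq_ind _ (fun q : R -> R => cvg (q h @[h --> 0^'])) H); apply/funext => h /=.
by rewrite stdvec_cons0 -cons_row_shift scaler0 add0r.
Qed.

Lemma partial_cons_lift (b : 'I_n) t :
  partial b (fun y => F (cons_row t y)) = (fun y => partial (lift ord0 b) F (cons_row t y)).
Proof.
apply/funext => y; rewrite /partial /derive.
apply: (congr1 (fun q : R -> R => lim (q h @[h --> 0^']))); apply/funext => h /=.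
by rewrite stdvec_cons_lift -cons_row_shift mulr0 add0r.
Qed.

Lemma derivable_cons_lift (b : 'I_n) t y :
  derivable F (cons_row t y) (stdvec R (lift ord0 b)) ->
  derivable (fun y => F (cons_row t y)) y (stdvec R b).
Proof.
rewrite /derivable => H.
apply: (eq_ind _ (fun q : R -> R => cvg (q h @[h --> 0^'])) H); apply/funext => h /=.
by rewrite stdvec_cons_lift -cons_row_shift mulr0 add0r.
Qed.

End Sections.

Lemma C1_bounded_support_partial m (a : 'I_m) r (F : 'rV[R]_m -> R) :
  C1_bounded_support a r F -> forall y, r + 1 <= `|y| -> partial a F y = 0.
Proof.
move=> [_ _ _ F0] y ry.
have E : \near y, cst 0 y = F y.
  apply: filterS (nbhs_norm_lt y ltr01) => z /= yz.
  by apply/esym/F0; have := ler_distD z y 0; rewrite !subr0 distrC; lra.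
by rewrite /partial -(near_eq_derive _ E) derive_cst.
Qed.

Lemma integral_partial0 (F : 'rV[R]_n.+1 -> R) (y : 'rV[R]_n) r : 0 < r ->
  continuous (partial 0 F) -> (forall z, derivable F z (stdvec R 0)) ->
  (forall z, r <= `|z| -> F z = 0) -> (\int[leb]_t (partial 0 F (cons_row t y))%:E = 0)%E.
Proof.
move=> r0 cdF dF F0.
have E t : partial 0 F (cons_row t y) = 'D_1 (fun s => F (cons_row s y)) t.
  by rewrite -[RHS]/((fun t => 'D_1 (fun s => F (cons_row s y)) t) t) derive_cons0.
under eq_integral => t _ do rewrite E.
apply: (FTC_bounded_support r0).
- by move=> t; apply: derivable_cons0; exact: dF.
- rewrite derive_cons0 => t.
  by apply: continuous_comp; [exact: cons_row_continuousl|exact: cdF].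
- move=> t ry; apply: F0; rewrite leNgt; apply/negP => /(cons_row_norm_lt _ _ r0)[].
  by rewrite ltNge ry.
Qed.

(** Fubini allows the variable of differentiation to be treated first: along coordinate 0 the inner
    integral vanishes by the fundamental theorem of calculus, along the others by the induction
    hypothesis. *)
Lemma vec_cons_partial a r F : C1_bounded_support a r F ->
  (\int[(leb \x mu)%E]_p (partial a F (vec_cons p))%:E = 0)%E.
Proof.
move=> C1; have := C1_bounded_support_partial C1; case: C1 => cF cdF dF F0 dF0.
have iG := model_integrable vec_cons_measurable vec_cons_ball cdF dF0.
pose r1 := `|r| + 1; have r10 : 0 < r1 by rewrite ltr_wpDl.
have F0' y : r1 <= `|y| -> F y = 0.
  by move=> ry; apply: F0; apply: le_trans ry; rewrite /r1 (le_trans (ler_norm r))// lerDl.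
case: (unliftP ord0 a) => [b|] aE; rewrite {}aE in cdF dF iG *.
- rewrite -(integral12_prod_meas1 iG) /fubini_F /=.
  rewrite integral0_eq// => t _.
  case: (model) => _ _ _ /(_ b r1 (fun y => F (cons_row t y))).
  rewrite partial_cons_lift; apply; split.
  + by move=> y; apply: continuous_comp; [exact: cons_row_continuousr|exact: cF].
  + rewrite partial_cons_lift => y.
    by apply: continuous_comp; [exact: cons_row_continuousr|exact: cdF].
  + by move=> y; apply: derivable_cons_lift; exact: dF.
  + move=> y ry; apply: F0'; rewrite leNgt; apply/negP => /(cons_row_norm_lt _ _ r10)[_].
    by rewrite ltNge ry.
- rewrite -(integral21_prod_meas1 iG) /fubini_G.
  rewrite integral0_eq// => u _.
  exact: (integral_partial0 (vec u) r10 cdF (fun y => dF y) F0').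
Qed.

(** Keeps the product eligible for Fubini in the next dimension; balls of integer radius exhaust the
    space. *)
Lemma vec_cons_sigma_finite : sigma_finite [set: measurableTypeR R * T] (leb \x mu)%E.
Proof.
exists (fun k => vec_cons @^-1` [set z | `|z - 0| < k.+1%:R]).
  apply/seteqP; split=> // p _; exists (Num.truncn `|vec_cons p|) => //=.
  by rewrite subr0 truncnS_gt.
move=> k; split; first by apply: vec_cons_measurable; exact: open_norm_lt.
by rewrite vec_cons_ball// ltry.
Qed.

Lemma rV_model_cons : exists m : SigmaFiniteMeasure.type _ R, rV_model m vec_cons.
Proof.
pose m : SigmaFiniteMeasure.type _ R :=
  HB.pack (leb \x mu)%E (Measure_isSigmaFinite.Build _ _ _ _ vec_cons_sigma_finite).
exists m; split; [exact: vec_cons_measurable|exact: vec_cons_integral|exact: vec_cons_ball|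
  exact: vec_cons_partial].
Qed.

End Step.

Lemma rV_model_exists n : exists d (T : measurableType d)
  (mu : {sigma_finite_measure set T -> \bar R}) (vec : T -> 'rV[R]_n), rV_model mu vec.
Proof.
elim: n => [|n [d [T [mu [vec model]]]]].
  by eexists; eexists; eexists; eexists; exact: rV_model0.
have [m mP] := rV_model_cons model.
by exists _, _, m, (vec_cons vec).
Qed.

End RowModel.

(** * Quadratic forms and smooth bump functions *)

Section QuadraticForms.
Context {R : realType} {n : nat}.
Implicit Types (A : 'M[R]_n) (v w : 'rV[R]_n).

Definition qf A v w : R := (v *m A *m w^T) 0 0.

Lemma qfE A v w : qf A v w = \sum_a \sum_b v 0 a * (A a b * w 0 b).
Proof.
rewrite /qf -mulmxA mxE; apply: eq_bigr => a _.
by rewrite mxE mulr_sumr; apply: eq_bigr => b _; rewrite mxE.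
Qed.

Lemma qfD A v v' w : qf A (v + v') w = qf A v w + qf A v' w.
Proof. by rewrite /qf !mulmxDl mxE. Qed.

Lemma qfZ A c v w : qf A (c *: v) w = c * qf A v w.
Proof. by rewrite /qf -!scalemxAl mxE. Qed.

Lemma qf_mxB A A' v w : qf (A - A') v w = qf A v w - qf A' v w.
Proof. by rewrite /qf mulmxBr mulmxBl !mxE. Qed.

Lemma qfC A v w : A^T = A -> qf A v w = qf A w v.
Proof.
move=> As; transitivity ((v *m A *m w^T)^T 0 0); first by rewrite mxE.
by rewrite !trmx_mul trmxK As mulmxA.
Qed.

Lemma quarter_bounds (p q s : R) : - s <= p - q -> p - q <= s -> s <= 3 / 4 * q -> 0 <= q ->
  q <= 4 * p /\ p <= 4 * q.
Proof. by move=> *; split; lra. Qed.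

Lemma qf_bound A e v w : (forall a b, `|A a b| <= e) ->
  `|qf A v w| <= e * (n * n)%:R * (`|v| * `|w|).
Proof.
move=> Ae; rewrite qfE; apply: (le_trans (ler_norm_sum _ _ _)).
have -> : e * (n * n)%:R * (`|v| * `|w|) = \sum_(a < n) \sum_(b < n) (e * (`|v| * `|w|)).
  under eq_bigr do rewrite sumr_const card_ord.
  by rewrite sumr_const card_ord -mulrnA -mulr_natr; ring.
apply: ler_sum => a _; apply: (le_trans (ler_norm_sum _ _ _)).
apply: ler_sum => b _; rewrite !normrM.
rewrite [leRHS](_ : _ = `|v| * (e * `|w|)); last by ring.
by apply: ler_pM; rewrite ?mulr_ge0//; [exact: rV_norm_coord|
  apply: ler_pM => //; exact: rV_norm_coord].
Qed.

Lemma posdef_qf_ge0 A v : posdef A -> 0 <= qf A v v.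
Proof.
move=> [_ Ap]; have [->|/Ap/ltW//] := eqVneq v 0.
by rewrite /qf !mul0mx mxE.
Qed.

Lemma posdef_cauchy A v w : posdef A -> qf A v w ^+ 2 <= qf A v v * qf A w w.
Proof.
move=> Ap; have [As App] := Ap; have [->|v0] := eqVneq v 0.
  by rewrite /qf !mul0mx mxE mul0r expr0n.
have q0 : 0 < qf A v v := App v v0.
(* Up to the positive factor q(v, v), this vector is the component of w orthogonal to v. *)
have := posdef_qf_ge0 (qf A v v *: w + (- qf A v w) *: v) Ap.
rewrite qfD !qfZ !(qfC _ (_ + _) As) !qfD !qfZ (qfC w v As) => H.
have {H} : 0 <= qf A v v * (qf A v v * qf A w w - qf A v w ^+ 2).
  by apply: le_trans H _; rewrite le_eqVlt; apply/orP; left; apply/eqP; ring.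
by rewrite pmulr_rge0// subr_ge0.
Qed.

(** With A = Q Q^T the form is the sum of squares of the entries of v Q, so each entry is at most
    its square root; multiplying back by the inverse of Q costs at most [S]. *)
Lemma posdef_lower A : posdef A ->
  exists2 C, 0 < C & forall v, `|v| ^+ 2 <= C * qf A v v.
Proof.
move=> Ap; have [Q Qu AE] := cholesky Ap.
pose S := 1 + \sum_a \sum_b `|invmx Q a b|.
have S0 : 0 < S by rewrite ltr_wpDr//; apply: sumr_ge0 => a _; apply: sumr_ge0.
exists (S ^+ 2) => [|v]; first by rewrite exprn_gt0.
have q0 := posdef_qf_ge0 v Ap; set q := qf A v v in q0 *.
have qE : q = \sum_a (v *m Q) 0 a ^+ 2.
  rewrite /q /qf AE mulmxA -mulmxA -trmx_mul mxE; apply: eq_bigr => a _.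
  by rewrite [in X in _ * X]mxE expr2.
have vQ a : `|(v *m Q) 0 a| <= Num.sqrt q.
  rewrite -sqrtr_sqr ler_wsqrtr// qE (bigD1 a)//= lerDl.
  by apply: sumr_ge0 => b _; rewrite sqr_ge0.
have : `|v| <= S * Num.sqrt q.
  apply: rV_norm_le => [|a]; first by rewrite mulr_ge0 ?sqrtr_ge0// ltW.
  rewrite -[in leLHS](mulmxK Qu v) mxE; apply: (le_trans (ler_norm_sum _ _ _)).
  apply: (@le_trans _ _ (\sum_b `|invmx Q b a| * Num.sqrt q)).
    by apply: ler_sum => b _; rewrite normrM mulrC ler_wpM2l.
  rewrite -mulr_suml ler_wpM2r ?sqrtr_ge0// /S ler_wpDl//.
  apply: ler_sum => b _; rewrite (bigD1 a)//= lerDl; exact: sumr_ge0.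
move=> vS; have := ler_pM (normr_ge0 v) (normr_ge0 v) vS vS.
rewrite -expr2 => /le_trans; apply.
by rewrite mulrACA -!expr2 sqr_sqrtr.
Qed.

Lemma near_dist (f : 'rV[R]_n -> R) (y : 'rV[R]_n) e : {for y, continuous f} -> 0 < e ->
  nbhs y [set z | `|f z - f y| < e].
Proof.
move=> cf e0.
have c : nbhs y (f @^-1` ball (f y) e) := cf _ (nbhsx_ballx (f y) e e0).
by apply: filterS c => z; rewrite -ball_normE /= distrC.
Qed.

Lemma qf_smooth A y0 : smooth_on setT (fun y => qf A (y - y0) (y - y0)).
Proof.
have E : forall y, (setT : set 'rV[R]_n) y -> \sum_a \sum_b (y 0 a - y0 0 a) * (A a b * (y 0 b - y0 0 b)) =
    qf A (y - y0) (y - y0).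
  move=> y _; rewrite qfE; apply: eq_bigr => a _; apply: eq_bigr => b _.
  by rewrite !mxE.
have sc a : smooth_on setT (fun y : 'rV[R]_n => y 0 a - y0 0 a).
  by apply: (smoothB openT); [exact: smooth_coord|exact: smooth_on_cst].
apply: (smooth_eq openT E); apply: (smooth_sum openT) => a _; apply: (smooth_sum openT) => b _.
apply: (smoothM openT (sc a)); apply: (smoothM openT _ (sc b)); exact: smooth_on_cst.
Qed.

Lemma derive_qf A y0 y B : A^T = A ->
  'D_B (fun y => qf A (y - y0) (y - y0)) y = 2 * qf A (y - y0) B.
Proof.
move=> As.
have E : (fun y => qf A (y - y0) (y - y0)) =
   fun y : 'rV[R]_n => \sum_a \sum_b (y 0 a - y0 0 a) * (A a b * (y 0 b - y0 0 b)).
  apply/funext => z; rewrite qfE; apply: eq_bigr => a _; apply: eq_bigr => b _.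
  by rewrite !mxE.
have d a : differentiable (fun y : 'rV[R]_n => y 0 a - y0 0 a) y.
  apply: (smooth_on_differentiable openT) => //.
  by apply: (smoothB openT); [exact: smooth_coord|exact: smooth_on_cst].
have D a : 'D_B (fun y : 'rV[R]_n => y 0 a - y0 0 a) y = B 0 a.
  rewrite -[LHS]/('D_B ((fun y : 'rV[R]_n => y 0 a) - cst (y0 0 a)) y).
  have da : differentiable (fun y : 'rV[R]_n => y 0 a) y.
    by apply: (smooth_on_differentiable openT) => //; exact: smooth_coord.
  rewrite deriveB; [|exact: diff_derivable|exact: derivable_cst].
  rewrite derive_cst subr0 -(@derive_coordf R n n id y B a); first by rewrite derive_id.
  by [].
have d2 a b : differentiable (fun y : 'rV[R]_n => A a b * (y 0 b - y0 0 b)) y.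
  by apply: differentiableM; [exact: (differentiable_cst (A a b) y)|exact: d].
have d3 a b : differentiable (fun y : 'rV[R]_n => (y 0 a - y0 0 a) * (A a b * (y 0 b - y0 0 b))) y.
  by apply: differentiableM; [exact: d|exact: d2].
have d4 a := @derive_bigsum _ _ _ (index_enum 'I_n) xpredT (fun b (y : 'rV[R]_n) =>
   (y 0 a - y0 0 a) * (A a b * (y 0 b - y0 0 b))) y B (d3 a).
rewrite E (derive_bigsum _ _ _ (fun a => (d4 a).1)).2 mulr_natl mulr2n {2}(qfC _ _ As) !qfE -big_split.
apply: eq_bigr => a _; rewrite (d4 a).2 -big_split; apply: eq_bigr => b _ /=.
have e1 := derive_mul B (d a) (d2 a b); have e2 := derive_mul B (differentiable_cst (A a b) y) (d b).
apply: (etrans e1); rewrite D (etrans e2 (congr2 _ (congr1 _ (D b)) (congr2 _ (derive_cst _ _ _) erefl))).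
rewrite !mxE /=; ring.
Qed.

End QuadraticForms.

Section Bumps.
Context {R : realType} {n : nat} {M : smoothManifold R n}.
Implicit Types (i j : chart M) (x : M) (K : set M).

Lemma compact_psi i (L : set 'rV[R]_n) : compact L -> L `<=` cod i -> compact (psi i @` L).
Proof.
move=> cL Li; apply: continuous_compact => //.
apply: continuous_in_subspaceT => y /set_mem Ly.
by apply: psi_continuous; exact: Li.
Qed.

Lemma compact_closedM K : compact K -> closed K.
Proof. by apply: compact_closed; exact: manifold_hausdorff. Qed.

(** Points outside the chart i lie in the complement of K, which is open because the manifold is
    Hausdorff, and there f is 0; on the overlap f is a composite with the transition map. *)
Lemma smooth_fun_extend i K (f : M -> R) : compact K -> K `<=` dom i ->
  smooth_on (cod i) (f \o psi i) -> (forall x, ~ K x -> f x = 0) -> smooth_fun f.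
Proof.
move=> cK Ki sf f0 j s y jy; have [iy|iy] := pselect (dom i (psi j y)).
  have oij : ovl j i y by apply/ovlP.
  suff : smooth_on (ovl j i) (f \o psi j) by apply.
  apply: (smooth_eq (@ovl_open _ _ M j i) (f := fun y => (f \o psi i) (trans j i y))).
    by move=> z /ovlP[jz iz]; rewrite /trans /= phiK.
  apply: (smooth_comp (@ovl_open _ _ M j i) (@cod_open _ _ M i) sf).
    by move=> b; exact: transition_smooth.
  by move=> z /ovlP[jz iz]; exact: cod_phi.
have cO : open (~` K) by apply: closed_openC; exact: compact_closedM.
have oO := psi_open (i := j) cO.
suff : smooth_on [set y | cod j y /\ (~` K) (psi j y)] (f \o psi j).
  by apply; split => // /Ki.
apply: (smooth_eq oO (f := cst 0)); last exact: smooth_on_cst.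
by move=> z [_ /= Kz]; rewrite f0.
Qed.

Lemma dform_near0 (f : M -> R) x v : (\forall z \near x, f z = 0) -> dform f x v = 0.
Proof.
move=> fx; rewrite /dform.
have E : \forall y \near phi (chart_at x) x, cst 0 y = (f \o psi (chart_at x)) y.
  have cx := cod_phi (chart_atP x).
  have := psi_near cx (A := [set z | f z = 0]); rewrite phiK; last exact: chart_atP.
  by move=> /(_ fx); apply: filterS => z [_ /= ->].
by rewrite -(near_eq_derive _ E) derive_cst.
Qed.

Lemma dform_out K (f : M -> R) x v : compact K -> (forall x, ~ K x -> f x = 0) ->
  ~ K x -> dform f x v = 0.
Proof.
move=> cK f0 Kx; apply: dform_near0.
have : open_nbhs x (~` K) by split => //; apply: closed_openC; exact: compact_closedM.
by move=> /open_nbhs_nbhs; apply: filterS => z; exact: f0.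
Qed.

Section Radius.
Variables (g : M -> 'M[R]_n) (gm : riemannian_metric g).
Local Notation G := (local_metric g).

(** A squared norm: that of the displacement from x in the preferred chart, for the metric frozen at
    x. *)
Definition norm0 x (y : 'rV[R]_n) : R :=
  let y0 := phi (chart_at x) x in qf (G (chart_at x) y0) (y - y0) (y - y0).

Definition normal_radius x (O : set M) (r : R) := forall y : 'rV[R]_n, norm0 x y <= r ^+ 2 ->
  [/\ cod (chart_at x) y, O (psi (chart_at x) y) & forall v : 'rV[R]_n,
   qf (G (chart_at x) (phi (chart_at x) x)) v v <= 4 * qf (G (chart_at x) y) v v /\
   qf (G (chart_at x) y) v v <= 4 * qf (G (chart_at x) (phi (chart_at x) x)) v v].

Lemma normal_radius_exists x O : nbhs x O -> exists2 r, 0 < r & normal_radius x O r.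
Proof.
move=> Ox; pose i := chart_at x; pose y0 := phi i x.
have cx : cod i y0 := cod_phi (chart_atP x).
have G0 := local_metric_posdef gm cx.
have [C C0 HC] := posdef_lower G0.
pose e := 3 / (4 * C * ((n * n)%:R + 1)).
have N0 : (0 : R) < (n * n)%:R + 1 by rewrite ltr_wpDl.
have e0 : 0 < e by rewrite /e divr_gt0// !mulr_gt0.
have : \forall y \near y0, [/\ cod i y, O (psi i y) & forall a b, `|G i y a b - G i y0 a b| <= e].
  have c a b : \forall y \near y0, `|G i y a b - G i y0 a b| <= e.
    have cG : {for y0, continuous (fun y : 'rV[R]_n => G i y a b)} :=
      ((local_metric_smooth gm (i := i) a b) [::] y0 cx).1.
    by apply: filterS (near_dist cG e0) => y /ltW.
  have c2 : \forall y \near y0, forall a b, `|G i y a b - G i y0 a b| <= e.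
    apply: (@filter_forall _ _ (fun a y => forall b, `|G i y a b - G i y0 a b| <= e) _
      (nbhs_filter y0)) => a.
    apply: (@filter_forall _ _ (fun b y => `|G i y a b - G i y0 a b| <= e) _ (nbhs_filter y0)) => b.
    exact: c.
  have := psi_near cx (A := O); rewrite phiK; last exact: chart_atP.
  move=> /(_ Ox) Oy.
  near=> y; have [iy Oyy] : cod i y /\ O (psi i y) by near: y.
  by split => //; near: y.
move=> /nbhs_norm_ex[r r0 Hr].
(* From |y - y0|^2 <= C [norm0], this radius keeps y within r of y0 in the sup norm. *)
exists (r / (2 * (C + 1))); first by rewrite divr_gt0// mulr_gt0// addr_gt0.
move=> y; rewrite /norm0 -/i -/y0 => qy.
have C1 : 0 < C + 1 by rewrite addr_gt0.
have yr : `|y - y0| < r.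
  rewrite -(ltr_pXn2r (n := 2))// ?nnegrE ?normr_ge0// ?ltW//.
  apply: (le_lt_trans (HC _)); apply: (le_lt_trans (ler_wpM2l (ltW C0) qy)).
  have -> : C * (r / (2 * (C + 1))) ^+ 2 = r ^+ 2 * (C / (4 * (C + 1) ^+ 2)) by field; rewrite gt_eqF.
  rewrite gtr_pMr ?exprn_gt0// ltr_pdivrMr ?mulr_gt0 ?exprn_gt0// mul1r.
  by rewrite expr2; nra.
have [iy Oy Gy] := Hr y yr; split => // v.
have GE a b : `|(G i y - G i y0) a b| <= e 
    by have := Gy a b; move: (G i y) (G i y0) => P Q; rewrite !mxE.
have := qf_bound v v GE.
have -> : qf (G i y - G i y0) v v = qf (G i y) v v - qf (G i y0) v v.
  exact: qf_mxB.
have q0 := posdef_qf_ge0 v G0; have := HC v; rewrite -expr2 -/i -/y0 => vC.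
have eN : e * (n * n)%:R * `|v| ^+ 2 <= 3 / 4 * qf (G i y0) v v.
  apply: (@le_trans _ _ (e * ((n * n)%:R + 1) * (C * qf (G i y0) v v))).
    apply: ler_pM => //; [by rewrite mulr_ge0// ltW|by rewrite ler_pM2l// lerDl].
  by rewrite /e le_eqVlt; apply/orP; left; apply/eqP; field; rewrite !gt_eqF.
rewrite ler_norml => /andP[h1 h2];
exact: (quarter_bounds h1 h2 eN q0).
Unshelve. all: by end_near. Qed.

Lemma gradient_bound i y (f : M -> R) (c : R) : smooth_fun f -> cod i y ->
  (forall B, ('D_B (f \o psi i) y) ^+ 2 <= c * qf (G i y) B B) ->
  forall v, dform f (psi i y) v ^+ 2 <= c * gdot g (psi i y) v v.
Proof.
move=> sf iy H v; have Fu := frame_unit (dom_psi iy).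
have := H (v *m invmx (frame i (psi i y))).
rewrite -(localf_dform _ sf iy) /localf mulmxKV// => /le_trans; apply.
have qE w : qf (G i y) w w = gdot g (psi i y) (w *m frame i (psi i y)) (w *m frame i (psi i y)).
  by rewrite /qf /gdot /local_metric trmx_mul !mulmxA.
by rewrite qE mulmxKV.
Qed.

Lemma bump_exists x O r0 r : normal_radius x O r0 -> 0 < r -> r <= r0 ->
  exists f : M -> R, [/\ smooth_fun f, forall z, 0 <= f z, r / 8 <= f x,
    forall z v, dform f z v ^+ 2 <= gdot g z v v &
    exists K, [/\ compact K, K `<=` O,
      forall z, K z -> exists2 y, psi (chart_at x) y = z & norm0 x y <= r ^+ 2 &
      forall z, ~ K z -> f z = 0]].
Proof.
move=> nr rp rr0; pose i := chart_at x; pose y0 := phi i x.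
have cx : cod i y0 := cod_phi (chart_atP x).
have G0 := local_metric_posdef gm cx.
have [C C0 HC] := posdef_lower G0.
have rE : r ^+ 2 <= r0 ^+ 2 by rewrite ler_pXn2r// nnegrE ltW// (lt_le_trans rp).
(* With this tau the loss in [theta_ge] is r^2 / 2, leaving (r^2 / 2) / (4r) = r / 8 at the
   centre. *)
pose tau := r ^+ 2 / 2; have tau0 : 0 < tau by rewrite divr_gt0// exprn_gt0.
pose L := [set y | norm0 x y <= r ^+ 2].
have Li : L `<=` cod i by move=> y /= Ly; have [] := nr y (le_trans Ly rE).
have cq : continuous (norm0 x) by move=> y; exact: (qf_smooth (G i y0) y0 [::] (y := y) I).1.
have cL : compact L.
  have Lc : closed L.
    apply: (@closed_comp _ _ (norm0 x) [set t | t <= r ^+ 2]); last exact: closed_le.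
    by move=> y _; exact: cq.
  apply: (subclosed_compact Lc (@compact_norm_le R n y0 (Num.sqrt (C * r ^+ 2)))).
  move=> y /= Ly; rewrite -[leLHS]ger0_norm// -sqrtr_sqr ler_wsqrtr//.
  by apply: (le_trans (HC _)); rewrite ler_wpM2l// ltW.
pose F y := (4 * r)^-1 * theta tau (r ^+ 2 - norm0 x y).
have sF : smooth_on setT F.
  apply: (smoothM openT); first exact: smooth_on_cst.
  apply: (smooth_theta openT tau0); apply: (smoothB openT); first exact: smooth_on_cst.
  exact: qf_smooth.
have F0 y : ~ L y -> F y = 0.
  by move=> /negP; rewrite -ltNge => rq; rewrite /F theta_le0 ?mulr0// subr_le0 ltW.
pose K := psi i @` L; have cK : compact K := compact_psi cL Li.
pose f z := if pselect (dom i z) then F (phi i z) else 0.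
have fE y : cod i y -> f (psi i y) = F y.
  by move=> iy; rewrite /f; case: pselect => [|/(_ (dom_psi iy))//]; rewrite psiK.
have f0 z : ~ K z -> f z = 0.
  move=> Kz; rewrite /f; case: pselect => // iz; apply: F0 => Lz; apply: Kz.
  by exists (phi i z) => //; exact: phiK.
have sf : smooth_fun f.
  apply: (smooth_fun_extend (i := i) cK) => //.
    by move=> _ [y Ly <-]; apply: dom_psi; exact: Li.
  apply: (smooth_eq (@cod_open _ _ M i) (f := F)) => [y iy|]; first by rewrite /= fE.
  by apply: (smooth_onS (O := setT)).
have r40 : 0 < (4 * r)^-1 by rewrite invr_gt0 mulr_gt0.
exists f; split => //.
- by move=> z; rewrite /f; case: pselect => // iz; rewrite mulr_ge0 ?theta_ge0// ltW.
- have -> : f x = F y0 by rewrite -(fE y0 cx) (phiK (chart_atP x)).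
  have -> : r / 8 = (4 * r)^-1 * (r ^+ 2 - tau) by rewrite /tau; field; rewrite gt_eqF.
  rewrite ler_pM2l// /norm0 subrr /qf !mul0mx mxE subr0; exact: theta_ge.
- move=> z v; have [Kz|Kz] := pselect (K z); last first.
    by rewrite (dform_out v cK f0 Kz) expr0n /=; apply: posdef_qf_ge0; exact: metric_posdef.
  have [y Ly <-] := Kz; have iy := Li y Ly.
  rewrite -[leRHS]mul1r; apply: (gradient_bound (c := 1) sf iy) => B; rewrite mul1r.
  have E : \near y, F y = (f \o psi i) y.
    by have := cod_nbhs iy; apply: filterS => w iw /=; rewrite fE.
  rewrite -(near_eq_derive _ E).
  have dq : differentiable (fun y => r ^+ 2 - norm0 x y) y.
    apply: (smooth_on_differentiable openT) => //.
    by apply: (smoothB openT); [exact: smooth_on_cst|exact: qf_smooth].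
  have [d1 D1] := derive_comp1 B dq (theta_derive tau0 (r ^+ 2 - norm0 x y)).
  have e1 := derive_mul B (differentiable_cst (4 * r)^-1 y) d1.
  have Dq : 'D_B (fun y => r ^+ 2 - norm0 x y) y = - (2 * qf (G i y0) (y - y0) B).
    rewrite -[LHS]/('D_B (cst (r ^+ 2) - norm0 x) y).
    rewrite deriveB; [|exact: derivable_cst|].
      by rewrite derive_cst sub0r /norm0 derive_qf//; case: G0.
    by apply: diff_derivable; exact: (smooth_on_differentiable openT (qf_smooth _ _)).
  rewrite (etrans e1 (congr2 _ (congr1 _ (etrans D1 (congr1 _ Dq))) (congr2 _ (derive_cst _ _ _) erefl))).
  have := theta'_itv tau0 (r ^+ 2 - norm0 x y).
  set t := theta' _ _ => /andP[t0 t1] /=; rewrite mul0r addr0.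
  have cs := posdef_cauchy (y - y0) B G0.
  have [_ _ /(_ B)[lo _]] := nr y (le_trans Ly rE).
  have qB := posdef_qf_ge0 B G0.
  have -> : ((4 * r)^-1 * (t * - (2 * qf (G i y0) (y - y0) B))) ^+ 2 =
    t ^+ 2 * (qf (G i y0) (y - y0) B ^+ 2 / (4 * r ^+ 2)) by field; rewrite gt_eqF.
  apply: (@le_trans _ _ (qf (G i y0) (y - y0) B ^+ 2 / (4 * r ^+ 2))).
    have t2 : t ^+ 2 <= 1 by rewrite exprn_ile1.
    by apply: ler_piMl => //; rewrite divr_ge0 ?sqr_ge0// mulr_ge0 ?sqr_ge0.
  rewrite ler_pdivrMr ?mulr_gt0 ?exprn_gt0//.
  apply: (le_trans cs); apply: (@le_trans _ _ (r ^+ 2 * qf (G i y0) B B)).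
    by rewrite ler_wpM2r.
  rewrite [leRHS](_ : _ = r ^+ 2 * (4 * qf (G i y) B B)); last by ring.
  by rewrite ler_wpM2l ?sqr_ge0.
- exists K; split => //.
  + by move=> _ [y Ly <-]; have [] := nr y (le_trans Ly rE).
  + by move=> _ [y Ly <-]; exists y.
Qed.

(** The flow integral is localized with these functions: being exactly 1 near a point, they replace
    a partition of unity. *)
Lemma plateau_exists x O : nbhs x O -> exists b : M -> R, [/\ smooth_fun b,
  \forall z \near x, b z = 1 & exists K, [/\ compact K, K `<=` O & forall z, ~ K z -> b z = 0]].
Proof.
move=> Ox; have [r r0 nr] := normal_radius_exists Ox.
have [f [sf f0 fx _ [K [cK KO _ fK]]]] := bump_exists nr r0 (lexx r).
pose a := f x / 2; have fx0 : 0 < f x by rewrite (lt_le_trans _ fx)// divr_gt0.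
have a0 : 0 < a by rewrite divr_gt0.
(* Equal to 1 where f >= a, since [theta] vanishes on nonpositive numbers, and to 0 where f = 0. *)
pose b z := 1 - theta 1 (a - f z) / theta 1 a.
have ta : theta 1 a != 0 by rewrite gt_eqF// theta_gt0.
exists b; split.
- move=> i; apply: (smoothB (@cod_open _ _ M i)); first exact: smooth_on_cst.
  apply: (smoothM (@cod_open _ _ M i)); last exact: smooth_on_cst.
  apply: (smooth_theta (@cod_open _ _ M i)) => //.
  apply: (smoothB (@cod_open _ _ M i)); [exact: smooth_on_cst|exact: sf].
- have := smooth_fun_continuous sf (x := x) => /cvgrPdist_lt/(_ a a0).
  apply: filterS => z /=; rewrite ltr_norml => /andP[_ zx].
  rewrite /b theta_le0 ?mul0r ?subr0//.
  by move: zx; rewrite /a; lra.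
- by exists K; split => // z /fK fz; rewrite /b fz subr0 divff ?subrr.
Qed.

End Radius.
End Bumps.

(** * Divergence of a parallel field in a chart *)

Section Determinant.
Context {R : realType} {n : nat}.

(** Jacobi's formula: the Leibniz rule differentiates one row at a time, and expanding along that
    row produces the adjugate. *)
Lemma derive_det (A : 'rV[R]_n -> 'M[R]_n) y v :
  (forall a b, differentiable (fun z => A z a b) y) ->
  'D_v (fun z => \det (A z)) y =
  \tr ((\matrix_(a, b) 'D_v (fun z => A z a b) y) *m \adj (A y)).
Proof.
move=> dA; pose D : 'M[R]_n := \matrix_(a, b) 'D_v (fun z => A z a b) y; rewrite -/D.
have dprod (s : 'S_n) := @derive_bigprod _ _ _ (index_enum 'I_n)
  (fun l z => A z l (s l)) y v (fun l => dA _ _) (index_enum_uniq _).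
have d1 (s : 'S_n) : differentiable (fun z => (-1) ^+ s * \prod_(i < n) A z i (s i)) y.
  by apply: differentiableM; [exact: (differentiable_cst ((-1) ^+ s : R) y)|exact: (dprod s).1].
transitivity (\sum_(s : 'S_n) 'D_v (fun z => (-1) ^+ s * \prod_(i < n) A z i (s i)) y).
  exact: (derive_bigsum _ _ _ d1).2.
have E (s : 'S_n) : 'D_v (fun z => (-1) ^+ s * \prod_(i < n) A z i (s i)) y =
  \sum_i (-1) ^+ s * (D i (s i) * \prod_(j | j != i) A y j (s j)).
  have e := derive_mul v (differentiable_cst ((-1) ^+ s : R) y) (dprod s).1.
  apply: (etrans e); rewrite (dprod s).2 derive_cst mul0r addr0 mulr_sumr.
  by apply: eq_bigr => i _; rewrite mxE.
rewrite (eq_bigr _ (fun s _ => E s)) exchange_big /mxtrace; apply: eq_bigr => i _.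
(* A y with its row i replaced by the derivative. *)
pose B : 'M[R]_n := \matrix_(j, b) if j == i then D i b else A y j b.
transitivity (\det B).
  apply: eq_bigr => s _; congr (_ * _); rewrite [RHS](bigD1 i)//= [B i _]mxE eqxx; congr (_ * _).
  by apply: eq_bigr => j ji; rewrite mxE (negbTE ji).
rewrite (expand_det_row B i) [RHS]mxE; apply: eq_bigr => j _.
rewrite [B i j]mxE eqxx [(\adj _) _ _]mxE; congr (_ * (_ * \det _)).
by apply/matrixP => a b; rewrite !mxE eq_sym (negbTE (neq_lift _ _)).
Qed.

End Determinant.

Section Divergence.
Context {R : realType} {n : nat} {M : smoothManifold R n}.
Variables (g : M -> 'M[R]_n) (gm : riemannian_metric g).
Variables (eta : kfield M 1) (etaO : Omega eta) (par : parallel g eta).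
Local Notation G := (local_metric g).
Local Notation u := (lsharp g ^~ eta).
Local Notation J := (Jsharp g eta).

Definition voldens (i : chart M) y : R := Num.sqrt (\det (G i y)).

Lemma voldens_gt0 i y : cod i y -> 0 < voldens i y.
Proof. by move=> iy; rewrite sqrtr_gt0 det_metric_gt0. Qed.

Lemma voldens_smooth i : smooth_on (cod i) (voldens i).
Proof.
apply: (smooth_sqrt (@cod_open _ _ M i) (det_metric_smooth gm (i := i))) => y iy.
exact: det_metric_gt0.
Qed.

Lemma voldens_differentiable i y : cod i y -> differentiable (voldens i) y.
Proof. exact: (smooth_on_differentiable (@cod_open _ _ M i) (voldens_smooth (i := i))). Qed.

(** Jacobi's formula with the Killing equation: both halves of JG + (JG)^T have the same trace
    against the adjugate. *)
Lemma derive_det_metric i y : cod i y ->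
  'D_(u i y) (fun z => \det (G i z)) y = - (2 * (\det (G i y) * \tr (J i y))).
Proof.
move=> iy; rewrite derive_det; last by move=> a b; exact: G_differentiable.
have -> : (\matrix_(a, b) 'D_(u i y) (fun z => G i z a b) y) = - (J i y *m G i y + (J i y *m G i y)^T).
  by apply/matrixP => c d; rewrite mxE (killing gm etaO par)// [RHS]mxE [in RHS]mxE [_^T c d]mxE.
rewrite mulNmx raddfN /= mulmxDl mxtraceD -mulmxA mul_mx_adj trmx_mul G_trmx//.
rewrite [\tr (G i y *m _ *m _)]mxtrace_mulC mulmxA mul_adj_mx mul_mx_scalar mul_scalar_mx !mxtraceZ mxtrace_tr.
by rewrite mulr_natl mulr2n.
Qed.

(** Differentiates the square of the density, which is the determinant, and divides by twice the
    positive density. *)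
Lemma derive_voldens i y : cod i y ->
  'D_(u i y) (voldens i) y = - (voldens i y * \tr (J i y)).
Proof.
move=> iy; have w0 := voldens_gt0 iy; have dw := voldens_differentiable iy.
have E : \near y, \det (G i y) = (fun z => voldens i z * voldens i z) y.
  have := cod_nbhs iy; apply: filterS => z iz; rewrite -expr2 sqr_sqrtr//.
  by rewrite ltW// det_metric_gt0.
have H := derive_det_metric iy.
rewrite (near_eq_derive _ E) (derive_mul _ dw dw) in H.
have e2 : \det (G i y) = voldens i y * voldens i y by exact: nbhs_singleton E.
rewrite e2 in H; have w00 : voldens i y != 0 by rewrite gt_eqF.
have {}H : voldens i y * ('D_(u i y) (voldens i) y + voldens i y * \tr (J i y)) = 0 by lra.
by move/eqP: H; rewrite mulf_eq0 (negbTE w00) /= addr_eq0 => /eqP.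
Qed.

(** U is divergence free: by [derive_voldens] the derivative of the density along U cancels the
    trace of the Jacobian of U, so only the derivative of h survives. *)
Lemma divergence i y (h : 'rV[R]_n -> R) : cod i y -> differentiable h y ->
  \sum_a partial a (fun z => voldens i z * u i z 0 a * h z) y =
  voldens i y * 'D_(u i y) h y.
Proof.
move=> iy dh; have dw := voldens_differentiable iy.
have du a := lsharp_differentiable gm etaO a iy.
have dwu a : differentiable (fun z => voldens i z * u i z 0 a) y by apply: differentiableM.
have E a : partial a (fun z => voldens i z * u i z 0 a * h z) y =
   voldens i y * (u i y 0 a * partial a h y) +
   h y * (voldens i y * J i y a a + u i y 0 a * partial a (voldens i) y).
  rewrite /partial (derive_mul _ (dwu a) dh) (derive_mul _ dw (du a)) JsharpE; ring.
rewrite (eq_bigr _ (fun a _ => E a)) big_split /= -!mulr_sumr big_split /= -mulr_sumr.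
rewrite -(differentiable_deriveE (u i y) dh) -(differentiable_deriveE (u i y) dw).
by rewrite derive_voldens// [X in _ + _ * X](_ : _ = 0) ?mulr0 ?addr0// /mxtrace subrr.
Qed.

Lemma dform_sharp i y (h : M -> R) : smooth_fun h -> cod i y ->
  dform h (psi i y) (sharp g eta (psi i y)) = 'D_(u i y) (h \o psi i) y.
Proof.
by move=> sh iy; rewrite (sharp_local gm etaO iy) -[LHS]/(localf i (dform h) y (u i y)) localf_dform.
Qed.

End Divergence.

(** * Integration in a chart *)

Section ChartIntegral.
Context {R : realType} {n : nat} {M : smoothManifold R n}.
Variables (g : M -> 'M[R]_n) (gm : riemannian_metric g).
Variables (vol : {measure set (borelM M) -> \bar R}) (gvol : riemannian_volume g vol).
Context d (T : measurableType d) (mu : {sigma_finite_measure set T -> \bar R})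
  (vec : T -> 'rV[R]_n) (model : rV_model mu vec).

Lemma borel_open (A : set M) : open A -> measurable (A : set (borelM M)).
Proof. by move=> Ao; apply: sub_sigma_algebra. Qed.

Lemma borel_closed (A : set M) : closed A -> measurable (A : set (borelM M)).
Proof.
move=> Ac; rewrite -(setCK (A : set (borelM M))); apply: measurableC.
by apply: borel_open; exact: closed_openC.
Qed.

Lemma continuous_borel (f : M -> R) : continuous f ->
  measurable_fun [set: borelM M] (f : borelM M -> R).
Proof.
move=> /continuousP cf; apply: (measurability _ (RGenOpens.measurableE R)).
move=> _ [_ [a [b ->] <-]]; rewrite setTI; apply: borel_open.
by apply: cf; exact: interval_open.
Qed.

Lemma vec_open_measurable O : open O -> measurable (vec @^-1` O).
Proof. by case: model => mO _ _ _; exact: mO. Qed.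

Lemma vec_cod_measurable i : measurable (vec @^-1` (@cod _ _ M i)).
Proof. by apply: vec_open_measurable; exact: cod_open. Qed.

Lemma psi_vec_measurable i :
  measurable_fun (vec @^-1` (cod i)) (fun t => psi i (vec t) : borelM M).
Proof.
apply: (@measurability d _ T (borelM M) _ _ (@open M) erefl).
move=> _ [A Ao <-].
have := vec_open_measurable (psi_open (i := i) Ao); congr measurable.
Qed.

(** The density of the volume in the chart i, cut to 0 off its image, so that integrals run over all
    of T although [psi i] is meaningful only on the image. *)
Definition wdens i t : R := \1_(cod i) (vec t) * voldens g i (vec t).

Lemma wdens_ge0 i t : 0 <= wdens i t.
Proof. by rewrite mulr_ge0// sqrtr_ge0. Qed.

Lemma measurable_on_cod i (F : 'rV[R]_n -> R) : (forall y, cod (M := M) i y -> {for y, continuous F}) ->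
  measurable_fun (vec @^-1` (@cod _ _ M i)) (fun t => F (vec t)).
Proof.
move=> cF; apply: (measurability _ (RGenOpens.measurableE R)).
move=> _ [_ [a [b ->] <-]].
have : open [set y | cod (M := M) i y /\ `]a, b[%classic (F y)].
  rewrite openE => y [iy Fy]; apply: filterI; first exact: cod_nbhs.
  by apply: (cF y iy); apply: open_nbhs_nbhs; split => //; exact: interval_open.
by move=> /vec_open_measurable; congr measurable; apply/seteqP; split => t /= [].
Qed.

Lemma chart_measurable i (f : borelM M -> \bar R) : measurable_fun [set: borelM M] f ->
  measurable_fun [set: T] (fun t => (f (psi i (vec t)) * (wdens i t)%:E)%E).
Proof.
move=> mf.
have -> : (fun t => (f (psi i (vec t)) * (wdens i t)%:E)%E) =
    (fun t => f (psi i (vec t)) * (voldens g i (vec t))%:E)%E \_ (vec @^-1` (cod i)).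
  apply/funext => t; rewrite patchE /wdens indicE.
  have -> : (t \in vec @^-1` cod i) = (vec t \in cod i) by apply/idP/idP; rewrite !inE.
  by case: (vec t \in cod i); rewrite /= ?mul1r// mul0r mule0.
apply/(measurable_restrictT _ _).1; first exact: vec_cod_measurable.
apply: emeasurable_funM.
  exact: (measurableT_comp mf (@psi_vec_measurable i)).
apply/measurable_EFinP; apply: measurable_on_cod => y iy.
exact: (voldens_smooth gm [::] iy).1.
Qed.

Lemma chart_volume i (A : set (borelM M)) : measurable A -> A `<=` @dom _ _ M i ->
  vol A = (\int[mu]_t (\1_A (psi i (vec t)) * wdens i t)%:E)%E.
Proof.
move=> mA Ai; rewrite (gvol mA Ai).
have E y : \1_(phi i @` A) y * Num.sqrt (\det (local_metric g i y)) =
   \1_A (psi i y) * (\1_(cod i) y * voldens g i y).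
  rewrite mulrA; congr (_ * _); rewrite !indicE -natrM mulnb; congr ((nat_of_bool _)%:R).
  apply/idP/andP => [/set_mem[x Ax <-]|[/set_mem Ay /set_mem iy]].
    by rewrite phiK; [split; apply/mem_set => //; exact: cod_phi (Ai _ Ax)|exact: Ai].
  by apply/mem_set; exists (psi i y) => //; exact: psiK.
have mE : measurable_fun [set: T]
    (fun t => (\1_(phi i @` A) (vec t) * Num.sqrt (\det (local_metric g i (vec t))))%:E).
  under eq_fun do rewrite E EFinM.
  by apply: (@chart_measurable i (fun x => (\1_A x)%:E)); apply/measurable_EFinP; exact: measurable_indic.
case: model => _ mI _ _; by rewrite mI//; apply: eq_integral => t _; rewrite E.
Qed.

Import HBNNSimple.

(** First stage of the passage from sets to functions: simple functions here, then nonnegative ones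
    by monotone convergence, then signed ones by positive and negative parts. *)
Lemma chart_integral_nnsfun i (h : {nnsfun (borelM M) >-> R}) : (forall x, ~ dom i x -> h x = 0) ->
  (\int[vol]_x (h x)%:E = \int[mu]_t ((h (psi i (vec t)))%:E * (wdens i t)%:E))%E.
Proof.
move=> h0.
have mi r : measurable_fun [set: T]
    (fun t => ((\1_(h @^-1` [set r]) (psi i (vec t)))%:E * (wdens i t)%:E)%E).
  by apply: (@chart_measurable i (fun x => (\1_(h @^-1` [set r]) x)%:E)); apply/measurable_EFinP; exact: measurable_indic.
under [LHS]eq_integral do rewrite fimfunE -fsumEFin//.
rewrite [LHS]ge0_integral_fsum//; last 2 first.
  - by move=> r; exact/measurable_EFinP/measurableT_comp.
  - by move=> k x _; rewrite EFinM nnfun_muleindic_ge0.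
under [RHS]eq_integral.
  move=> t _; rewrite fimfunE -fsumEFin// ge0_mule_fsuml; last first.
    by move=> r; rewrite EFinM nnfun_muleindic_ge0.
  over.
rewrite [RHS]ge0_integral_fsum//; last 2 first.
  - move=> r; under eq_fun do rewrite EFinM -muleA.
    by apply: emeasurable_funM => //.
  - move=> r t _; rewrite mule_ge0//; last by rewrite lee_fin wdens_ge0.
    by rewrite EFinM nnfun_muleindic_ge0.
apply: eq_fsbigr => r _; rewrite integralZl_indic_nnsfun//.
rewrite integral_indic// setIT.
(* The fibre over 0 need not lie in the chart, so [chart_volume] does not apply to it; its
   contribution is 0 on both sides. *)
have [->|r0] := eqVneq r 0.
  by rewrite mul0e integral0_eq// => t _; rewrite mul0r mul0e.
have [rn|rp] := ltP r 0.
  rewrite preimage_nnfun0// measure0 mule0 integral0_eq// => t _.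
  by rewrite indic0 mulr0 mul0e.
rewrite (@chart_volume i)//; last first.
  by move=> x /= hx; apply/not_notP => /h0; rewrite hx; apply/eqP.
under [RHS]eq_integral do rewrite EFinM -muleA.
rewrite ge0_integralZl//; last by move=> t _; rewrite mule_ge0// lee_fin ?wdens_ge0.
Qed.

Lemma chart_integral_ge0 i (f : borelM M -> \bar R) : measurable_fun [set: borelM M] f ->
  (forall x, 0 <= f x)%E -> (forall x, ~ dom i x -> f x = 0%E) ->
  (\int[vol]_x f x = \int[mu]_t (f (psi i (vec t)) * (wdens i t)%:E))%E.
Proof.
move=> mf f0 fi; pose f_ := nnsfun_approx measurableT mf.
have fle k x : ((f_ k x)%:E <= f x)%E by rewrite /f_ nnsfun_approxE le_approx.
transitivity (limn (fun k => \int[vol]_x (f_ k x)%:E))%E.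
  rewrite -monotone_convergence//=.
  - by apply: eq_integral => x _; apply/esym/cvg_lim => //; exact: cvg_nnsfun_approx.
  - by move=> k; apply: measurableT_comp.
  - by move=> k x _; rewrite lee_fin.
  - by move=> x _ a b ab; rewrite lee_fin//; exact/lefP/nd_nnsfun_approx.
transitivity (limn (fun k => \int[mu]_t ((f_ k (psi i (vec t)))%:E * (wdens i t)%:E)))%E.
  congr (limn _); apply/funext => k; apply: chart_integral_nnsfun => x /fi fx.
  have := fle k x; rewrite fx lee_fin => fk.
  by apply/eqP; rewrite eq_le fk /=.
rewrite -monotone_convergence//=.
- apply: eq_integral => t _; apply/cvg_lim => //.
  have := @cvg_nnsfun_approx _ _ R setT measurableT f mf (fun x _ => f0 x) (psi i (vec t)) I.
  by move=> c; apply: cvgeZr.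
- move=> k; apply: (@chart_measurable i (fun x => (f_ k x)%:E)).
  exact: measurableT_comp.
- by move=> k t _; rewrite mule_ge0// lee_fin ?wdens_ge0.
- move=> t _ a b ab; apply: lee_wpmul2r; first by rewrite lee_fin wdens_ge0.
  have /lefP := @nd_nnsfun_approx _ _ R _ measurableT f mf a b ab.
  by rewrite lee_fin.
Qed.

Lemma chart_integral i (f : borelM M -> \bar R) : measurable_fun [set: borelM M] f ->
  (forall x, ~ dom i x -> f x = 0%E) ->
  (\int[vol]_x f x = \int[mu]_t (f (psi i (vec t)) * (wdens i t)%:E))%E.
Proof.
move=> mf fi; rewrite integralE [RHS]integralE; congr (_ - _)%E.
- rewrite (@chart_integral_ge0 i)//.
  + by apply: eq_integral => t _; rewrite !funeposE maxe_pMl ?mul0e// lee_fin wdens_ge0.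
  + exact: measurable_funepos.
  + by move=> x /fi fx; rewrite funeposE fx maxxx.
- rewrite (@chart_integral_ge0 i)//.
  + by apply: eq_integral => t _; rewrite !funenegE maxe_pMl ?mul0e ?mulNe// lee_fin wdens_ge0.
  + exact: measurable_funeneg.
  + by move=> x /fi fx; rewrite funenegE fx oppe0 maxxx.
Qed.

End ChartIntegral.

(** * The divergence theorem *)

Section Integration.
Context {R : realType} {n : nat} {M : smoothManifold R n}.
Variables (g : M -> 'M[R]_n) (gm : riemannian_metric g).
Variables (vol : {measure set (borelM M) -> \bar R}) (gvol : riemannian_volume g vol).
Context d (T : measurableType d) (mu : {sigma_finite_measure set T -> \bar R})
  (vec : T -> 'rV[R]_n) (model : rV_model mu vec).

Lemma volume_chart_ball i (y0 : 'rV[R]_n) r c C : 0 < r -> 0 <= c ->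
  (forall y, `|y - y0| < r -> cod (M := M) i y /\ c <= voldens g i y <= C) ->
  exists O : set M, [/\ open O, forall x, O x <-> dom i x /\ `|phi i x - y0| < r &
    ((c * (r *+ 2) ^+ n)%:E <= vol O <= (C * (r *+ 2) ^+ n)%:E)%E].
Proof.
move=> r0 c0 H; pose B := [set y | `|y - y0| < r].
pose O := [set x | dom i x /\ B (phi i x)].
have Oop : open O.
  rewrite openE => x [ix Bx]; apply: phi_near => //; apply: open_nbhs_nbhs.
  by split => //; exact: open_norm_lt.
exists O; split => //.
rewrite (chart_volume gm gvol model (i := i)); [|exact: borel_open|by move=> x []].
have E t : \1_O (psi i (vec t)) * wdens g vec i t = voldens g i (vec t) * \1_B (vec t).
  rewrite /wdens mulrA mulrC; congr (_ * _); rewrite !indicE -natrM mulnb.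
  congr ((nat_of_bool _)%:R); apply/andP/idP => [[/set_mem[_ By] /set_mem iy]|/set_mem By].
    by apply/mem_set; move: By; rewrite /= psiK.
  have iy := (H _ By).1; split; apply/mem_set => //.
  by split; [exact: dom_psi|rewrite psiK].
have mB : measurable (vec @^-1` B) := vec_open_measurable model (@open_norm_lt _ _ y0 r).
have muB : mu (vec @^-1` B) = ((r *+ 2) ^+ n)%:E by case: (model) => _ _ mBall _; exact: mBall.
have BE a : (\int[mu]_t (a * \1_B (vec t))%:E = (a * (r *+ 2) ^+ n)%:E)%E.
  have mi : mu.-integrable [set: T] (fun t => (\1_B (vec t))%:E).
    apply/integrableP; split.
      by apply/measurable_EFinP; exact: (measurable_indic mB).
    under eq_integral do rewrite gee0_abs ?lee_fin//.
    rewrite (_ : (fun t => _) = (fun t => (\1_(vec @^-1` B) t)%:E))//.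
    rewrite integral_indic// setIT; apply: (le_lt_trans _ (ltry ((r *+ 2) ^+ n))).
    by rewrite -muB.
  under eq_integral do rewrite EFinM.
  rewrite integralZl//= (_ : (fun t => _) = (fun t => (\1_(vec @^-1` B) t)%:E))//.
  rewrite integral_indic// setIT EFinM; congr (_ * _)%E.
  exact: muB.
have mi a : measurable_fun [set: T] (fun t => (a * \1_B (vec t))%:E).
  apply/measurable_EFinP; apply: measurable_funM => //.
  exact: (measurable_indic mB).
have mw : measurable_fun [set: T] (fun t => (\1_O (psi i (vec t)) * wdens g vec i t)%:E).
  have mf : measurable_fun [set: borelM M] (fun x : borelM M => (\1_O x)%:E : \bar R).
    by apply/measurable_EFinP; apply: measurable_indic; exact: borel_open.
  exact: (chart_measurable gm model i mf).
have le t : (c * \1_B (vec t) <= \1_O (psi i (vec t)) * wdens g vec i t <= C * \1_B (vec t)).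
  rewrite E indicE; case: (boolP (vec t \in B)) => [/set_mem By|_]; rewrite ?mulr1 ?mulr0 ?lexx//.
  exact: (H _ By).2.
rewrite -!BE; apply/andP; split; apply: ge0_le_integral => //.
- by move=> t _; rewrite lee_fin mulr_ge0.
- by move=> t _; rewrite lee_fin; case/andP: (le t).
- by move=> t _; rewrite lee_fin mulr_ge0// wdens_ge0.
- by move=> t _; rewrite lee_fin; case/andP: (le t).
Qed.

Lemma half_double_bounds (p q : R) : - (q / 2) < p - q -> p - q < q / 2 -> q / 2 <= p <= q * 2.
Proof. by move=> *; apply/andP; split; lra. Qed.

(** By continuity the density stays between half and twice its value at x on a small coordinate
    ball. Finiteness gives finite volume of compact sets, positivity the final lower bound. *)
Lemma volume_nbhs x (A : set M) : nbhs x A ->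
  exists O : set M, [/\ open O, O x, O `<=` A & (0 < vol O < +oo)%E].
Proof.
move=> Ax; pose i := chart_at x; have ix : dom i x := chart_atP x.
pose y0 := phi i x; have iy := cod_phi ix; have v0 := voldens_gt0 gm iy.
have cw : {for y0, continuous (voldens g i)} := (voldens_smooth gm [::] iy).1.
have v2 : 0 < voldens g i y0 / 2 by rewrite divr_gt0.
have := psi_near iy (A := A); rewrite phiK// => /(_ Ax) N.
have /nbhs_norm_ex[r r0 Hr] : nbhs y0 ([set y | cod i y /\ A (psi i y)] `&`
    [set y | `|voldens g i y - voldens g i y0| < voldens g i y0 / 2]).
  by apply: filterI => //; exact: near_dist.
have [y yr|O [Oop OE /andP[Ol Ou]]] := @volume_chart_ball i y0 r (voldens g i y0 / 2) (voldens g i y0 * 2) r0 (ltW v2).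
  have [[iyy _]] := Hr y yr; rewrite /= ltr_norml => /andP[h1 h2].
  by split => //; exact: half_double_bounds.
exists O; split => //.
- by apply/OE; split => //; rewrite subrr normr0.
- by move=> z /OE[iz zr]; have [[_]] := Hr _ zr; rewrite phiK.
- apply/andP; split; last by apply: le_lt_trans Ou _; exact: ltry.
  by apply: lt_le_trans Ol; rewrite lte_fin mulr_gt0// exprn_gt0// mulrn_wgt0.
Qed.

Lemma compact_finite_cover (K : set M) (U : M -> set M) : compact K -> (forall x, open (U x)) ->
  (forall x, U x x) -> exists s : seq M, forall z, K z -> exists2 x, x \in s & U x z.
Proof.
move=> cK Uop Ux; have : cover_compact K by rewrite -compact_cover.
move=> /(_ M setT U)[//||D' _ KD]; first by move=> x Kx; exists x.
by exists (finmap.enum_fset D') => z /KD[x xD Uz]; exists x.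
Qed.

Lemma volume_compact (K : set M) : compact K -> (vol K < +oo)%E.
Proof.
move=> cK.
have H x : exists O : set M, [/\ open O, O x & (vol O < +oo)%E].
  case: (volume_nbhs (@filterT _ (nbhs x) _)) => O [Oop Ox _ /andP[_ Oy]].
  by exists O.
have [U HU] := choice H.
have [s Ks] : exists s : seq M, forall z, K z -> exists2 x, x \in s & U x z.
  by apply: compact_finite_cover => // x; have [] := HU x.
have mO x : measurable (U x : set (borelM M)) by apply: borel_open; have [] := HU x.
have mK : measurable (K : set (borelM M)) by apply: borel_closed; exact: compact_closedM.
pose V := \big[setU/set0]_(x <- s) (U x : set (borelM M)).
have KV : K `<=` V.
  by move=> z /Ks[x xs Uz]; rewrite /V -bigcup_seq; exists x.
have mV : measurable V by apply: bigsetU_measurable => x _; exact: mO.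
apply: (@le_lt_trans _ _ (vol V)); first by apply: le_measure; rewrite ?inE.
rewrite /V; elim: s {Ks V KV mV} => [|x s IH]; first by rewrite big_nil measure0 ltry.
rewrite big_cons; apply: (@le_lt_trans _ _ (vol (U x) + vol (\big[setU/set0]_(j <- s) (U j : set (borelM M)))))%E.
  by apply: measureU2 => //; apply: bigsetU_measurable => y _; exact: mO.
by apply: lte_add_pinfty => //; have [] := HU x.
Qed.

Definition csupp (h : M -> R) := exists2 K : set M, compact K & forall x, ~ K x -> h x = 0.

Lemma continuous_csupp_integrable (f : M -> R) : continuous f -> csupp f ->
  vol.-integrable [set: borelM M] (fun x => (f x)%:E).
Proof.
move=> cf [K cK fK].
have mK : measurable (K : set (borelM M)) by apply: borel_closed; exact: compact_closedM.
have /compact_bounded[C [_ HC]] : compact (f @` K).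
  by apply: continuous_compact => //; exact: continuous_subspaceT.
pose C' := `|C| + 1.
have C0 : 0 <= C' by rewrite addr_ge0.
apply: (@le_integrable _ (borelM M) R vol _ measurableT _
  (fun t => (C' * \1_(K : set (borelM M)) t)%:E)).
- by apply/measurable_EFinP; exact: continuous_borel.
- move=> x _; rewrite !abse_EFin lee_fin.
  have [Kx|Kx] := pselect (K x).
    rewrite indicE mem_set// mulr1 [leRHS]ger0_norm//; apply: HC; last by exists x.
    by rewrite (le_lt_trans (ler_norm C))// ltrDl.
  by rewrite fK ?normr0.
- apply/integrableP; split.
    by apply/measurable_EFinP/measurable_funM => //; exact: measurable_indic.
  under eq_integral => t _ do rewrite abse_EFin ger0_norm ?mulr_ge0// EFinM.
  rewrite ge0_integralZl//; last by apply/measurable_EFinP; exact: measurable_indic.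
  rewrite integral_indic// setIT; apply: lte_mul_pinfty => //.
  exact: volume_compact.
Qed.

Section Divergence.
Variables (eta : kfield M 1) (etaO : Omega eta) (par : parallel g eta).
Local Notation u := (lsharp g ^~ eta).
Local Notation flow h := (fun x => dform h x (sharp g eta x)).

Lemma flow_smooth (h : M -> R) : smooth_fun h -> smooth_fun (flow h).
Proof. by move=> sh; exact: (pairing_smooth gm (dform_Omega sh) etaO). Qed.

Lemma flow_csupp (h : M -> R) : csupp h -> csupp (flow h).
Proof. by move=> [K cK hK]; exists K => // x Kx; exact: (dform_out _ cK hK Kx). Qed.

Lemma flow_integrable (h : M -> R) : smooth_fun h -> csupp h ->
  vol.-integrable [set: borelM M] (fun x => (flow h x)%:E).
Proof.
move=> sh ch; apply: continuous_csupp_integrable; last exact: flow_csupp.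
by apply: smooth_fun_continuous; exact: flow_smooth.
Qed.

(** In the chart, the density times U h is the sum of the a-th partial derivatives of density * u^a
    * h; each has compact support and integrates to 0. *)
Lemma integral_flow_chart i (K : set M) (h : M -> R) : smooth_fun h -> compact K ->
  K `<=` dom i -> (forall x, ~ K x -> h x = 0) ->
  (\int[vol]_x (flow h x)%:E = 0)%E.
Proof.
move=> sh cK Ki hK.
have mf : measurable_fun [set: borelM M] (fun x : borelM M => (flow h x)%:E : \bar R).
  by apply/measurable_EFinP; apply: continuous_borel; apply: smooth_fun_continuous; exact: flow_smooth.
rewrite (chart_integral gm gvol model mf (i := i)); last first.
  by move=> x ix; rewrite (dform_out _ cK hK)// => /Ki.
pose L := phi i @` K.
have cL : compact L.
  apply: continuous_compact => //; apply: continuous_in_subspaceT => x /set_mem Kx.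
  by apply: phi_continuous; exact: Ki.
have oL : open (~` L) by apply: closed_openC; apply: compact_closed => //; exact: norm_hausdorff.
have Li : L `<=` cod i by move=> _ [x Kx <-]; apply: cod_phi; exact: Ki.
(* Extension by 0 outside the chart, smooth on the whole space because the compact image L of the
   support lies inside the chart. *)
pose H a y := if pselect (cod i y) then voldens g i y * u i y 0 a * (h \o psi i) y else 0.
have HE a y : cod i y -> H a y = voldens g i y * u i y 0 a * (h \o psi i) y.
  by rewrite /H; case: pselect.
have H0 a y : ~ L y -> H a y = 0.
  rewrite /H; case: pselect => // iy Ly /=; rewrite hK ?mulr0// => Kh; apply: Ly.
  by exists (psi i y) => //; exact: psiK.
have co := @cod_open _ _ M i.
have sH a : smooth_on setT (H a).
  move=> s y _; have [iy|iy] := pselect (cod i y).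
    suff : smooth_on (cod i) (H a) by apply.
    apply: (smooth_eq co (f := fun y => voldens g i y * u i y 0 a * (h \o psi i) y)).
      by move=> z iz; rewrite HE.
    apply: (smoothM co); last exact: sh.
    apply: (smoothM co); [exact: (voldens_smooth gm)|exact: (lsharp_smooth gm)].
  suff : smooth_on (~` L) (H a) by apply => /Li.
  apply: (smooth_eq oL (f := cst 0)); last exact: smooth_on_cst.
  by move=> z Lz; rewrite H0.
have [r r0 Hr] : exists2 r, 0 < r & forall y, L y -> `|y| < r.
  have /compact_bounded[C [_ HC]] := cL.
  exists (`|C| + 2) => [|y Ly]; first by rewrite ltr_wpDl.
  apply: (@le_lt_trans _ _ (`|C| + 1)); last by rewrite ltrD2l ltr1n.
  by apply: HC => //; rewrite (le_lt_trans (ler_norm C))// ltrDl.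
have C1 a : C1_bounded_support a r (H a).
  split.
  - by move=> y; exact: (sH a [::] y I).1.
  - by move=> y; exact: (smooth_on_partial a (sH a) [::] I).1.
  - by move=> y; exact: ((sH a [::] y I).2 a).
  - by move=> y ry; apply: H0 => /Hr; rewrite ltNge ry.
have E t : (flow h (psi i (vec t)) * wdens g vec i t) = \sum_a partial a (H a) (vec t).
  rewrite /wdens indicE; case: (boolP (vec t \in cod i)) => [/set_mem iy|/negP iy].
    rewrite mul1r (dform_sharp gm etaO sh iy) mulrC.
    rewrite -(divergence gm etaO par iy (smooth_fun_differentiable sh iy)).
    by apply: eq_bigr => a _; apply: (partial_eq_on a co _ iy) => z iz; rewrite HE.
  rewrite mul0r mulr0 big1// => a _.
  rewrite (partial_eq_on a oL (g := cst 0)); first by rewrite /partial derive_cst.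
    by move=> z Lz; rewrite H0.
  by move=> /Li/mem_set.
transitivity (\int[mu]_t (\sum_a (partial a (H a) (vec t))%:E))%E.
  by apply: eq_integral => t _; rewrite sumEFin -E EFinM.
rewrite integral_sum//; last first.
  move=> a; case: (model) => mO _ mB _; have [_ cp _ _] := C1 a.
  exact: (model_integrable mO mB cp (C1_bounded_support_partial (C1 a))).
by rewrite big1// => a _; case: (model) => _ _ _; apply; exact: C1.
Qed.

Lemma dformD (h1 h2 : M -> R) x v : smooth_fun h1 -> smooth_fun h2 ->
  dform (fun z => h1 z + h2 z) x v = dform h1 x v + dform h2 x v.
Proof.
move=> s1 s2; have cx := cod_phi (chart_atP x).
rewrite /dform -[LHS]/('D_v ((h1 \o psi (chart_at x)) + (h2 \o psi (chart_at x))) _).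
by rewrite deriveD//; apply: diff_derivable; exact: smooth_fun_differentiable.
Qed.

(** Induction on a finite list of plateau functions covering the support: h = h b + h (1 - b), where
    h b lives in one chart and h (1 - b) vanishes wherever b = 1, hence is covered by the rest of
    the list. *)
Lemma integral_flow (h : M -> R) : smooth_fun h -> csupp h ->
  (\int[vol]_x (flow h x)%:E = 0)%E.
Proof.
move=> sh ch.
have P x : exists b : M -> R, [/\ smooth_fun b, \forall z \near x, b z = 1 &
    exists K, [/\ compact K, K `<=` dom (chart_at x) & forall z, ~ K z -> b z = 0]].
  exact: (plateau_exists gm (dom_nbhs (chart_atP x))).
have [b Hb] := choice P.
pose U x := ([set z | b x z = 1])^°.
have [s Hs] : exists s : seq M, forall z, h z != 0 -> exists2 x, x \in s & b x z = 1.
  have [K cK hK] := ch.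
  have [s Ks] : exists s : seq M, forall z, K z -> exists2 x, x \in s & U x z.
    apply: compact_finite_cover => // x; first exact: open_interior.
    by have [] := Hb x.
  exists s => z hz; have Kz : K z by apply/not_notP => /hK hz0; rewrite hz0 eqxx in hz.
  by have [x xs Uz] := Ks z Kz; exists x => //; exact: (interior_subset Uz).
elim: s h sh ch Hs => [|x s IH] h sh ch Hs.
  rewrite integral0_eq// => z _; rewrite dform_near0//; apply: nearW => y.
  by apply/eqP/negPn/negP => /Hs[].
have [sb _ [K [cK Ki bK]]] := Hb x.
pose h1 z := h z * b x z; pose h2 z := h z * (1 - b x z).
have s1 : smooth_fun h1 by exact: smooth_funM.
have sc : smooth_fun (fun z => 1 - b x z) := smooth_funB (smooth_fun_cst 1) sb.
have s2 : smooth_fun h2 by exact: smooth_funM.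
have cc f : csupp (fun z => h z * f z).
  by have [K' cK' hK'] := ch; exists K' => // z /hK' ->; rewrite mul0r.
have E z : (flow h z)%:E = ((flow h1 z)%:E + (flow h2 z)%:E)%E.
  rewrite -EFinD -(dformD _ _ s1 s2); congr ((dform _ _ _)%:E); apply/funext => y.
  by rewrite /h1 /h2; ring.
under eq_integral do rewrite E.
rewrite (integralD measurableT (flow_integrable s1 (cc _)) (flow_integrable s2 (cc _))).
rewrite (integral_flow_chart s1 cK Ki); last by move=> z /bK bz; rewrite /h1 bz mulr0.
rewrite add0e; apply: (IH h2 s2 (cc _)) => z; rewrite /h2 mulf_eq0 negb_or => /andP[hz bz].
have [y] := Hs z hz; rewrite inE => /orP[/eqP->|ys] by1; last by exists y.
by move: bz; rewrite by1 subrr eqxx.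
Qed.

End Divergence.

End Integration.

(** * Curves and the Riemannian distance *)

Section RealContinuity.
Context {R : realType}.

Lemma near_continuous (V : normedModType R) (f h : R -> V) t : (\forall s \near t, f s = h s) ->
  {for t, continuous f} -> {for t, continuous h}.
Proof.
move=> fh cf; have E : f t = h t := nbhs_singleton fh.
suff : h @ t --> f t by rewrite E.
exact: cvg_trans (near_eq_cvg fh) cf.
Qed.

Lemma continuousM_at (f h : R -> R) t : {for t, continuous f} -> {for t, continuous h} ->
  {for t, continuous (fun s => f s * h s)}.
Proof. by move=> cf ch; exact: (cvgM cf ch). Qed.

Lemma continuous_sum_at (I : Type) (r : seq I) (F : I -> R -> R) t :
  (forall i, {for t, continuous (F i)}) -> {for t, continuous (fun s => \sum_(i <- r) F i s)}.
Proof.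
move=> cF; elim: r => [|i r IH].
  rewrite (_ : (fun s => _) = cst 0); last by apply/funext => s; rewrite big_nil.
  exact: cst_continuous.
rewrite (_ : (fun s => _) = (fun s => F i s + \sum_(j <- r) F j s)); last first.
  by apply/funext => s; rewrite big_cons.
by apply: cvgD; [exact: cF|exact: IH].
Qed.

End RealContinuity.

Section CurveCalculus.
Context {R : realType} {n : nat}.

Lemma derive_curve m (y : R -> 'rV[R]_n) (h : 'rV[R]_n -> 'rV[R]_m) t :
  derivable y t 1 -> differentiable h (y t) ->
  derivable (h \o y) t 1 /\ 'D_1 (h \o y) t = 'D_('D_1 y t) h (y t).
Proof.
move=> /derivable1_diffP dy dh.
have dc : differentiable (h \o y) t by exact: differentiable_comp.
by split; [exact/derivable1_diffP|rewrite !deriveE// diff_comp].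
Qed.

Lemma derive_curve1 (y : R -> 'rV[R]_n) (h : 'rV[R]_n -> R) t :
  derivable y t 1 -> differentiable h (y t) ->
  derivable (h \o y) t 1 /\ 'D_1 (h \o y) t = 'D_('D_1 y t) h (y t).
Proof.
move=> /derivable1_diffP dy dh.
have dc : differentiable (h \o y) t by exact: differentiable_comp.
by split; [exact/derivable1_diffP|rewrite !deriveE// diff_comp].
Qed.

Lemma continuous_comp_at (y : R -> 'rV[R]_n) (h : 'rV[R]_n -> R) t : {for t, continuous y} ->
  {for y t, continuous h} -> {for t, continuous (fun s => h (y s))}.
Proof. by move=> cy ch; exact: (continuous_comp cy ch). Qed.

Lemma continuous_coord_at (y : R -> 'rV[R]_n) t a : {for t, continuous y} ->
  {for t, continuous (fun s => y s 0 a)}.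
Proof.
move=> cy.
exact: (@continuous_comp _ _ _ y (fun z : 'rV[R]_n => z 0 a) t cy (@coord_continuous _ _ _ _ _ _)).
Qed.

Lemma continuous_rV_at (y : R -> 'rV[R]_n) t : (forall a, {for t, continuous (fun s => y s 0 a)}) ->
  {for t, continuous y}.
Proof.
move=> cy; apply/(@cvgrPdist_lt _ _ _ _ (nbhs_filter t)) => e e0.
have : \forall s \near t, forall a, `|y t 0 a - y s 0 a| < e / 2.
  apply: (@filter_forall _ _ (fun a s => `|y t 0 a - y s 0 a| < e / 2) _ (nbhs_filter t)) => a.
  have c : (fun s => y s 0 a) @ t --> y t 0 a := cy a.
  by move/cvgrPdist_lt: c; apply; rewrite divr_gt0.
apply: filterS => s ys; apply: (@le_lt_trans _ _ (e / 2)).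
  apply: rV_norm_le => [|a]; first by rewrite divr_ge0// ltW.
  by have := ys a; rewrite !mxE => /ltW.
by rewrite ltr_pdivrMr// ltr_pMr// ltr1n.
Qed.

Lemma continuous_qf_at (A : R -> 'M[R]_n) (v : R -> 'rV[R]_n) t :
  (forall a b, {for t, continuous (fun s => A s a b)}) -> {for t, continuous v} ->
  {for t, continuous (fun s => qf (A s) (v s) (v s))}.
Proof.
move=> cA cv.
rewrite (_ : (fun s => _) = (fun s => \sum_a \sum_b v s 0 a * (A s a b * v s 0 b))); last first.
  by apply/funext => s; rewrite qfE.
apply: continuous_sum_at => a; apply: continuous_sum_at => b.
apply: continuousM_at; first exact: continuous_coord_at.
by apply: continuousM_at; [exact: cA|exact: continuous_coord_at].
Qed.

End CurveCalculus.

Section Curves.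
Context {R : realType} {n : nat} {M : smoothManifold R n}.
Variables (g : M -> 'M[R]_n) (gm : riemannian_metric g).
Local Notation G := (local_metric g).

Section OneCurve.
Variables (c : R -> M) (cc : c1_curve c).
Local Notation y i := (fun s => phi i (c s)).
Local Notation y' i := (fun s => 'D_1 (y i) s).

Lemma curve_near i t : dom i (c t) -> \forall s \near t, dom i (c s).
Proof. by move=> it; have [cc1 _] := cc; apply: cc1; exact: dom_nbhs. Qed.

Lemma curve_derivable i t : dom i (c t) -> derivable (y i) t 1.
Proof. by move=> it; have [_ /(_ i t it)[]] := cc. Qed.

Lemma curve_continuous i t : dom i (c t) -> {for t, continuous (y i)}.
Proof.
move=> it; apply: differentiable_continuous; apply/derivable1_diffP.
exact: curve_derivable.
Qed.

Lemma curve_velocity_continuous i t : dom i (c t) -> {for t, continuous (y' i)}.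
Proof.
move=> it; have cv := (cc.2 i t it).2.
apply: (near_continuous (f := derive1 (y i)) _ cv).
by near=> s; rewrite derive1E.
Unshelve. all: by end_near.
Qed.

Lemma velocity_chart i t : dom i (c t) -> velocity c t = y' i t *m frame i (c t).
Proof.
move=> it; rewrite /velocity derive1E; set j := chart_at (c t).
have E : \forall s \near t, (trans i j \o y i) s = phi j (c s).
  by apply: filterS (curve_near it) => s si; rewrite /trans /= phiK.
have oij : ovl i j (y i t).
  by apply/ovlP; rewrite phiK//; split; [exact: cod_phi|exact: chart_atP].
rewrite -(near_eq_derive _ E).
rewrite (derive_curve (curve_derivable it) (trans_differentiable oij)).2.
by rewrite (derive_trans _ oij) frameE.
Qed.

Lemma speed_chart i t : dom i (c t) ->
  gdot g (c t) (velocity c t) (velocity c t) = qf (G i (y i t)) (y' i t) (y' i t).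
Proof.
by move=> it; rewrite (velocity_chart it) /gdot /qf /local_metric phiK// trmx_mul !mulmxA.
Qed.

Lemma speed_continuous : continuous (fun t => Num.sqrt (gdot g (c t) (velocity c t) (velocity c t))).
Proof.
move=> t; have it := chart_atP (c t); set i := chart_at (c t) in it.
suff cq : {for t, continuous (fun t => gdot g (c t) (velocity c t) (velocity c t))}.
  by apply: (continuous_comp cq); exact: sqrt_continuous.
apply: (near_continuous (f := fun s => qf (G i (y i s)) (y' i s) (y' i s))).
  by apply: filterS (curve_near it) => s si; rewrite (speed_chart si).
apply: continuous_qf_at; last exact: curve_velocity_continuous.
move=> a b; apply: (continuous_comp_at (h := fun z => G i z a b) (curve_continuous it)).
exact: (local_metric_smooth gm a b [::] (cod_phi it)).1.
Qed.

Section Along.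
Variables (f : M -> R) (sf : smooth_fun f).

Lemma derive_along i t : dom i (c t) ->
  derivable (f \o c) t 1 /\ 'D_1 (f \o c) t = 'D_(y' i t) (f \o psi i) (y i t).
Proof.
move=> it.
have E : \forall s \near t, ((f \o psi i) \o y i) s = (f \o c) s.
  by apply: filterS (curve_near it) => s si; rewrite /= phiK.
have df := smooth_fun_differentiable sf (cod_phi it).
have [d e] := derive_curve1 (curve_derivable it) df.
split; first exact: (near_eq_derivable E d).
by rewrite -(near_eq_derive _ E) e.
Qed.

Lemma derive_along_dform t : 'D_1 (f \o c) t = dform f (c t) (velocity c t).
Proof.
have it := chart_atP (c t); rewrite (derive_along it).2 (velocity_chart it).
rewrite -(localf_dform _ sf (cod_phi it)) /localf phiK//.
Qed.

Lemma derive_along_continuous : continuous (fun t => 'D_1 (f \o c) t).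
Proof.
move=> t; have it := chart_atP (c t); set i := chart_at (c t) in it.
apply: (near_continuous (f := fun s => \sum_a (y' i s) 0 a * partial a (f \o psi i) (y i s))).
  apply: filterS (curve_near it) => s si.
  by rewrite (derive_along si).2 (derive_chartE _ sf (cod_phi si)).
apply: continuous_sum_at => a; apply: continuousM_at.
  by apply: continuous_coord_at; exact: curve_velocity_continuous.
apply: (continuous_comp_at (h := partial a (f \o psi i)) (curve_continuous it)).
exact: (smooth_on_partial a (sf (i := i)) [::] (cod_phi it)).1.
Qed.

(** The increment is the integral of df along the curve, and df is at most the speed. *)
Lemma curve_lipschitz : (forall z v, dform f z v ^+ 2 <= gdot g z v v) ->
  ((f (c 1) - f (c 0))%:E <= curve_length g c)%E.
Proof.
move=> df; have d t := (derive_along (chart_atP (c t))).1.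
have cd : {within `[0, 1], continuous (fun t => 'D_1 (f \o c) t)}.
  by apply: continuous_subspaceT; exact: derive_along_continuous.
rewrite EFinB -(@continuous_FTC2 R (fun t => 'D_1 (f \o c) t) (f \o c))//; last 2 first.
- have cf t : {for t, continuous (f \o c)}.
    by apply: differentiable_continuous; apply/derivable1_diffP; exact: d.
  by split; [move=> t _; exact: d|exact: cvg_at_right_filter (cf _)|exact: cvg_at_left_filter (cf _)].
- by move=> t _; rewrite derive1E.
apply: le_integral => //.
- by apply: continuous_compact_integrable => //; exact: segment_compact.
- apply: continuous_compact_integrable; first exact: segment_compact.
  by apply: continuous_subspaceT; exact: speed_continuous.
- move=> t _; rewrite lee_fin derive_along_dform (le_trans (ler_norm _))//.
  by rewrite -sqrtr_sqr ler_wsqrtr.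
Qed.

End Along.
End OneCurve.

Lemma path_lipschitz (f : M -> R) x z L : smooth_fun f ->
  (forall z v, dform f z v ^+ 2 <= gdot g z v v) -> pw_c1_path g x z L ->
  ((f z - f x)%:E <= L)%E.
Proof.
move=> sf df; elim => [w|c w L' cc _ IH]; first by rewrite subrr.
have -> : f w - f (c 0) = (f (c 1) - f (c 0)) + (f w - f (c 1)) by ring.
by rewrite EFinD; apply: leeD => //; exact: curve_lipschitz.
Qed.

Lemma path_cat x w z L L' : pw_c1_path g x w L -> pw_c1_path g w z L' ->
  pw_c1_path g x z (L + L')%E.
Proof.
elim => [u|c u K cc _ IH] H; first by rewrite add0e.
by rewrite -addeA; apply: pw_c1_path_cons => //; exact: IH.
Qed.

(** Directed: symmetry of the distance is never invoked, and both directions are carried along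
    instead of reversing curves. *)
Definition joined x z (r : R) := exists2 L, pw_c1_path g x z L & (L <= r%:E)%E.

Lemma joined_cat x w z r r' : joined x w r -> joined w z r' -> joined x z (r + r').
Proof.
move=> [L p Lr] [L' p' Lr']; exists (L + L')%E; first exact: path_cat p p'.
by rewrite EFinD leeD.
Qed.

Lemma joined_refl x : joined x x 0.
Proof. by exists 0%E => //; exact: pw_c1_path_nil. Qed.

Lemma joined_curve c r : c1_curve c -> (curve_length g c <= r%:E)%E -> joined (c 0) (c 1) r.
Proof.
move=> cc cr; exists (curve_length g c + 0)%E; last by rewrite adde0.
by apply: pw_c1_path_cons => //; exact: pw_c1_path_nil.
Qed.

Lemma joined_dist x z r : joined x z r -> (riemannian_dist g x z <= r%:E)%E.
Proof. by move=> [L p Lr]; apply: le_trans Lr; exact: ereal_inf_lbound. Qed.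

Lemma dist_joined x z (r : R) : (riemannian_dist g x z < r%:E)%E -> joined x z r.
Proof. by move=> /ereal_inf_lt[L p /ltW Lr]; exists L. Qed.

Lemma joined_lipschitz (f : M -> R) x z r : smooth_fun f ->
  (forall z v, dform f z v ^+ 2 <= gdot g z v v) -> joined x z r -> f z - f x <= r.
Proof.
move=> sf df [L p Lr]; rewrite -lee_fin; apply: le_trans Lr; exact: (path_lipschitz sf df p).
Qed.

Section Segment.
(** A [c1_curve] is C^1 on the whole line while the segment is known to stay in the chart only for
    parameters in [0, 1]; hence a reparametrization s with all its values in [0, 1]. *)
Variables (i : chart M) (y0 v : 'rV[R]_n) (s : R -> R) (B : R).
Hypotheses (s01 : forall t, 0 <= s t <= 1) (ds : forall t, derivable s t 1)
  (cs : continuous (fun t => 'D_1 s t)) (sB : forall t, `|'D_1 s t| <= B)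
  (iv : forall t, 0 <= t <= 1 -> cod i (y0 + t *: v)).
Let y (t : R) : 'rV[R]_n := y0 + s t *: v.
Let c (t : R) : M := psi i (y t).

Let iy t : cod i (y t). Proof. exact: iv. Qed.

Let yE : y = cst y0 + (fun t => s t *: v). Proof. by apply/funext => t. Qed.

Let sv (t : R) : is_derive t 1 (fun t => s t *: v) ('D_1 s t *: v).
Proof.
have dds : differentiable s t by apply/derivable1_diffP.
have dd : differentiable (fun t => s t *: v) t by exact: differentiableZl.
split; first by apply/derivable1_diffP.
by rewrite !deriveE// diffZl.
Qed.

Let dy (t : R) : derivable y t 1.
Proof. by rewrite yE; apply: derivableD; [exact: derivable_cst|case: (sv t)]. Qed.

Let Dy (t : R) : 'D_1 y t = 'D_1 s t *: v.
Proof.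
rewrite yE deriveD; [|exact: derivable_cst|by case: (sv t)].
by rewrite derive_cst add0r; case: (sv t).
Qed.

Let cy (t : R) : {for t, continuous y}.
Proof. by apply: differentiable_continuous; apply/derivable1_diffP. Qed.

Lemma segment_continuous : continuous c.
Proof. move=> t; have cp := psi_continuous (iy t).
exact: (continuous_comp (@cy t) cp). Qed.

Let chart_derive j t : dom j (c t) ->
  derivable (fun s => phi j (c s)) t 1 /\
  'D_1 (fun s => phi j (c s)) t = 'D_1 s t *: (v *m Jac i j (y t)).
Proof.
move=> jt; have oij : ovl i j (y t) by apply/ovlP.
have [d e] := derive_curve (@dy t) (trans_differentiable oij).
by split => //; rewrite [LHS]e (derive_trans _ oij) Dy -scalemxAl.
Qed.

Lemma segment_c1 : c1_curve c.
Proof.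
split; first exact: segment_continuous.
move=> j t jt; split; first exact: (chart_derive jt).1.
have N : \forall w \near t, dom j (c w) := @segment_continuous t _ (dom_nbhs jt).
apply: (near_continuous (f := fun w => 'D_1 s w *: (v *m Jac i j (y w)))).
  by apply: filterS N => w jw; rewrite derive1E (chart_derive jw).2.
apply: continuous_rV_at => b.
rewrite (_ : (fun w => _) = (fun w => 'D_1 s w * \sum_a v 0 a * Jac i j (y w) a b)); last first.
  by apply/funext => w; rewrite mxE mxE.
apply: continuousM_at; first exact: cs.
apply: continuous_sum_at => a; apply: continuousM_at; first exact: cst_continuous.
apply: (continuous_comp_at (h := fun z => Jac i j z a b) (@cy t)).
by apply: (Jac_smooth a b [::] _).1; apply/ovlP.
Qed.

Lemma segment_length C : (forall t, 0 <= t <= 1 -> qf (G i (y0 + t *: v)) v v <= C ^+ 2) -> 0 <= C ->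
  (curve_length g c <= (B * C)%:E)%E.
Proof.
move=> qC C0; have cc := segment_c1.
have B0 : 0 <= B := le_trans (normr_ge0 _) (sB 0).
apply: (@le_trans _ _ (\int[@lebesgue_measure R]_(t in `[0%R, 1%R]) (cst (B * C)%:E t))%E); last first.
  by rewrite integral_cst//= lebesgue_measure_itv/= lte01 oppr0 adde0 mule1.
apply: ge0_le_integral => //.
- apply/measurable_EFinP; apply: subspace_continuous_measurable_fun => //.
  by apply: continuous_subspaceT; exact: speed_continuous.
- move=> t _; rewrite lee_fin.
  have it : dom i (c t) by apply: dom_psi; exact: iy.
  rewrite (speed_chart cc it).
  have -> : 'D_1 (fun s0 => phi i (c s0)) t = 'D_1 s t *: v.
    by rewrite (chart_derive it).2 Jac_id ?mulmx1//; exact: iy.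
  rewrite /c psiK; last exact: iy.
  have -> : qf (G i (y t)) ('D_1 s t *: v) ('D_1 s t *: v) = 'D_1 s t ^+ 2 * qf (G i (y t)) v v.
    by rewrite /qf linearZ /= -!scalemxAl -!scalemxAr !mxE; ring.
  rewrite -(ger0_norm (mulr_ge0 B0 C0)) -sqrtr_sqr ler_wsqrtr// exprMn.
  apply: ler_pM; rewrite ?sqr_ge0//.
  + by apply: posdef_qf_ge0; apply: local_metric_posdef => //; exact: iy.
  + by rewrite -real_normK ?num_real// ler_pXn2r// ?nnegrE.
  + exact: qC.
Qed.

End Segment.
End Curves.

(** * Exhaustion functions of a complete metric *)

Section Ramp.
Context {R : realType}.

(** A smooth map of the line into [0, 1] fixing 0 and 1, used to parametrize segments; its speed is
    at most pi / 2 < 2. *)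
Definition ramp (t : R) : R := (1 - cos (pi * t)) / 2.

Lemma ramp_derive (t : R) : is_derive t 1 ramp (pi / 2 * sin (pi * t)).
Proof.
have dp : is_derive t 1 (fun t : R => pi * t) pi.
  have := is_deriveZ pi (is_derive_id t (1 : R)).
  by rewrite [X in is_derive _ _ _ X](_ : _ = pi)// /GRing.scale /= mulr1.
have dc : is_derive t 1 (cos \o (fun t : R => pi * t)) (- sin (pi * t) * pi).
  exact: (is_derive1_comp (is_derive_cos (pi * t)) dp).
have := is_deriveZ (2^-1 : R) (is_deriveB (is_derive_cst (1 : R) t (1 : R)) dc).
rewrite (_ : 2^-1 \*: _ = ramp); last first.
  by apply/funext => w; rewrite /ramp /= mulrC.
by rewrite [X in is_derive _ _ _ X](_ : _ = pi / 2 * sin (pi * t))// /GRing.scale /=; field.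
Qed.

Lemma ramp_D : (fun t : R => 'D_1 ramp t) = (fun t => pi / 2 * sin (pi * t)).
Proof. by apply/funext => t; case: (ramp_derive t). Qed.

Lemma ramp_continuous_D : continuous (fun t : R => 'D_1 ramp t).
Proof.
suff E t : {for t, continuous (fun t : R => pi / 2 * sin (pi * t))} by rewrite ramp_D => t; exact: E.
apply: continuousM_at; first exact: cst_continuous.
have c1 : {for t, continuous (fun t : R => pi * t)}.
  by apply: continuousM_at; [exact: cst_continuous|exact: cvg_id].
exact: (continuous_comp c1 (@continuous_sin _ _)).
Qed.

Lemma ramp_D_le (t : R) : `|'D_1 ramp t| <= 2.
Proof.
rewrite -[X in `|X|]/((fun t : R => 'D_1 ramp t) t) ramp_D normrM.
have p0 : (0 : R) <= pi / 2 by rewrite divr_ge0// ltW// pi_gt0.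
rewrite ger0_norm// -[leRHS]mulr1; apply: ler_pM => //.
  by rewrite ltW// pihalf_lt2.
by rewrite ler_norml sin_geN1 sin_le1.
Qed.

Lemma ramp_itv (t : R) : 0 <= ramp t <= 1.
Proof. by rewrite /ramp; have := cos_geN1 (pi * t); have := cos_le1 (pi * t); lra. Qed.

Lemma ramp0 : ramp 0 = 0.
Proof. by rewrite /ramp mulr0 cos0 subrr mul0r. Qed.

Lemma ramp1 : ramp 1 = 1.
Proof. by rewrite /ramp mulr1 cospi opprK divff. Qed.

End Ramp.

Section Completeness.
Context {R : realType} {n : nat} {M : smoothManifold R n}.
Variables (g : M -> 'M[R]_n) (gm : riemannian_metric g).
Local Notation G := (local_metric g).

Lemma joined_le x z r r' : joined g x z r -> r <= r' -> joined g x z r'.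
Proof. by move=> [L p Lr] rr; exists L => //; apply: (le_trans Lr); rewrite lee_fin. Qed.

Lemma joined_segment i (y0 v : 'rV[R]_n) C : 0 <= C ->
  (forall t, 0 <= t <= 1 -> cod i (y0 + t *: v)) ->
  (forall t, 0 <= t <= 1 -> qf (G i (y0 + t *: v)) v v <= C ^+ 2) ->
  joined g (psi i y0) (psi i (y0 + v)) (2 * C).
Proof.
move=> C0 iv qC; have dr (t : R) : derivable ramp t 1 by case: (ramp_derive t).
have cc := segment_c1 (@ramp_itv R) dr ramp_continuous_D iv.
have cl := segment_length gm (@ramp_itv R) dr ramp_continuous_D (@ramp_D_le R) iv qC C0.
have := joined_curve cc cl.
by rewrite ramp0 ramp1 scale0r addr0 scale1r.
Qed.

(** The factor 4 is 2 for the speed of [ramp] times 2 for comparing g with the metric frozen at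
    x. *)
Lemma joined_normal x O r y : normal_radius g x O r -> 0 <= r -> norm0 g x y <= r ^+ 2 ->
  joined g x (psi (chart_at x) y) (4 * r) /\ joined g (psi (chart_at x) y) x (4 * r).
Proof.
move=> nr r0 yr; pose i := chart_at x; pose y0 := phi i x; pose v := y - y0.
have xE : psi i y0 = x by exact: phiK (chart_atP x).
have cx : cod i y0 := cod_phi (chart_atP x).
have q0 : 0 <= qf (G i y0) v v by apply: posdef_qf_ge0; exact: local_metric_posdef.
have near t : 0 <= t <= 1 -> cod i (y0 + t *: v) /\ qf (G i (y0 + t *: v)) v v <= (2 * r) ^+ 2.
  move=> /andP[t0 t1].
  have nt : norm0 g x (y0 + t *: v) <= r ^+ 2.
    rewrite /norm0 -/i -/y0 (addrC y0) addrK.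
    have -> : qf (G i y0) (t *: v) (t *: v) = t ^+ 2 * qf (G i y0) v v.
      by rewrite /qf linearZ /= -!scalemxAl -!scalemxAr !mxE; ring.
    apply: le_trans yr; rewrite /norm0 -/i -/y0 -/v ler_piMl// exprn_ile1//.
  have [iy _ /(_ v)[_ qv]] := nr _ nt; split => //.
  apply: (le_trans qv); rewrite exprMn; have -> : (2 ^+ 2 : R) = 4 by ring.
  by rewrite ler_pM2l.
have r2 : 0 <= 2 * r by rewrite mulr_ge0.
have e4 : 4 * r = 2 * (2 * r) by ring.
have yE : y0 + v = y by rewrite /v addrC subrK.
split; rewrite e4.
- have := @joined_segment i y0 v (2 * r) r2 (fun t t01 => (near t t01).1) (fun t t01 => (near t t01).2).
  by rewrite xE yE.
- have flip t : y + t *: (- v) = y0 + (1 - t) *: v by apply/rowP => a; rewrite !mxE; ring.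
  have t1 (t : R) : 0 <= t <= 1 -> 0 <= 1 - t <= 1 by lra.
  have := @joined_segment i y (- v) (2 * r) r2 _ _.
  rewrite [y + - v](_ : _ = y0) ?xE; last by rewrite -yE addrK.
  apply => t /t1 t01; rewrite flip; first exact: (near _ t01).1.
  have -> : qf (G i (y0 + (1 - t) *: v)) (- v) (- v) = qf (G i (y0 + (1 - t) *: v)) v v.
    by rewrite /qf linearN /= !mulNmx mulmxN opprK.
  exact: (near _ t01).2.
Qed.

Lemma dform_cst (c : R) (x : M) v : dform (fun=> c) x v = 0.
Proof. by rewrite /dform (_ : _ \o _ = cst c)// derive_cst. Qed.

Lemma dformB (h1 h2 : M -> R) x v : smooth_fun h1 -> smooth_fun h2 ->
  dform (fun z => h1 z - h2 z) x v = dform h1 x v - dform h2 x v.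
Proof.
move=> s1 s2; have cx := cod_phi (chart_atP x).
rewrite /dform -[LHS]/('D_v ((h1 \o psi (chart_at x)) - (h2 \o psi (chart_at x))) _).
by rewrite deriveB//; apply: diff_derivable; exact: smooth_fun_differentiable.
Qed.

Lemma smooth_fun_theta tau (h : M -> R) : 0 < tau -> smooth_fun h ->
  smooth_fun (fun z => theta tau (h z)).
Proof. by move=> t0 sh i; apply: (smooth_theta (@cod_open _ _ M i) t0); exact: sh. Qed.

Lemma dform_theta tau (h : M -> R) x v : 0 < tau -> smooth_fun h ->
  dform (fun z => theta tau (h z)) x v = theta' tau (h x) * dform h x v.
Proof.
move=> t0 sh; have ix := chart_atP x; have cx := cod_phi ix.
have [_ e] := derive_comp1 v (smooth_fun_differentiable sh cx)
  (theta_derive t0 ((h \o psi (chart_at x)) (phi (chart_at x) x))).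
by rewrite /dform [LHS]e /= phiK.
Qed.

Definition admissible (f : M -> R) := [/\ smooth_fun f, forall z, 0 <= f z, csupp f &
  forall z v, dform f z v ^+ 2 <= gdot g z v v].

Lemma gdot_ge0 (x : M) v : 0 <= gdot g x v v.
Proof. by apply: posdef_qf_ge0; exact: metric_posdef. Qed.

Lemma theta_homo tau (s t : R) : 0 < tau -> s <= t -> theta tau s <= theta tau t.
Proof.
move=> t0 st; have [s0|s0] := leP s 0; first by rewrite theta_le0// theta_ge0.
have t1 : 0 < t := lt_le_trans s0 st.
rewrite /theta !flatp1//; apply: ler_pM; [exact: ltW|exact: expR_ge0|exact: st|].
by rewrite ler_expR lerN2 ler_pM2l// lef_pV2.
Qed.

Lemma admissible0 : admissible (fun=> 0).
Proof.
split => //; first exact: smooth_fun_cst.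
  by exists set0 => //; exact: compact0.
by move=> z v; rewrite dform_cst expr0n gdot_ge0.
Qed.

(** f1 + theta (f2 - f1) is a smooth substitute for the maximum; its gradient is a convex
    combination of the two gradients, so the Lipschitz bound survives. *)
Lemma admissible_max tau f1 f2 : 0 < tau -> admissible f1 -> admissible f2 ->
  exists f, [/\ admissible f, forall z, f1 z <= f z & forall z, f2 z - tau <= f z].
Proof.
move=> t0 [s1 p1 [K1 c1 z1] d1] [s2 p2 [K2 c2 z2] d2].
have sd : smooth_fun (fun z => f2 z - f1 z) by exact: smooth_funB.
have st := smooth_fun_theta t0 sd.
have f1f z : f1 z <= f1 z + theta tau (f2 z - f1 z) by rewrite lerDl theta_ge0.
exists (fun z => f1 z + theta tau (f2 z - f1 z)); split; [|exact: f1f|]; last first.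
  by move=> z; have := theta_ge t0 (f2 z - f1 z); lra.
split; first exact: smooth_funD.
- by move=> z; apply: le_trans (f1f z).
- exists (K1 `|` K2); first exact: compactU.
  by move=> z /not_orP[/z1 -> /z2 ->]; rewrite add0r subrr theta_le0.
- move=> z v; rewrite (dformD _ _ s1 st) (dform_theta _ _ t0 sd) (dformB _ _ s2 s1).
  have := theta'_itv t0 (f2 z - f1 z); have := d1 z v; have := d2 z v.
  move: (theta' _ _) (dform f1 z v) (dform f2 z v) (gdot g z v v) => t a b q bq aq /andP[t0' t1].
  (* The square of a convex combination is the combination of the squares minus a nonnegative
     term. *)
  have -> : (a + t * (b - a)) ^+ 2 = (1 - t) * a ^+ 2 + t * b ^+ 2 - t * (1 - t) * (b - a) ^+ 2 by ring.
  have e : q = (1 - t) * q + t * q by ring.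
  rewrite {1}e; have h1 : 0 <= t * (1 - t) * (b - a) ^+ 2.
    by rewrite mulr_ge0 ?sqr_ge0// mulr_ge0// subr_ge0.
  have h2 : (1 - t) * a ^+ 2 <= (1 - t) * q by rewrite ler_wpM2l// subr_ge0.
  have h3 : t * b ^+ 2 <= t * q by rewrite ler_wpM2l.
  by lra.
Qed.

(** Compactness leaves finitely many functions, combined by approximate maxima. *)
Lemma admissible_cover (K : set M) a e : compact K -> 0 < e ->
  (forall z, K z -> exists2 f, admissible f & a < f z) ->
  exists2 f, admissible f & forall z, K z -> a - e <= f z.
Proof.
move=> cK e0 H.
have H' z : exists f, admissible f /\ (K z -> a < f z).
  have [Kz|Kz] := pselect (K z); last by exists (fun=> 0); split => //; exact: admissible0.
  by have [f af az] := H z Kz; exists f.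
have [F HF] := choice H'.
(* For z outside K the neighbourhood is the complement of K, so that the cover is indexed by all
   points. *)
pose U z := [set w | K z /\ a < F z w \/ ~ K z /\ ~ K w].
have Uop z : open (U z).
  have [Kz|Kz] := pselect (K z); last first.
    rewrite (_ : U z = ~` K); first by apply: closed_openC; exact: compact_closedM.
    by apply/seteqP; split => w /=; [case=> [[/Kz//]|[_ //]]|move=> ?; right].
  rewrite (_ : U z = F z @^-1` [set t | a < t]); last first.
    by apply/seteqP; split => w /=; [case=> [[_ //]|[/(_ Kz)//]]|move=> ?; left].
  have [[sF _ _ _] _] := HF z.
  by apply: open_comp; [move=> w _; exact: smooth_fun_continuous|exact: open_gt].
have Uz z : U z z.
  have [Kz|Kz] := pselect (K z); [left|right]; split => //.
  by have [_] := HF z; apply.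
have [s Hs] := compact_finite_cover cK Uop Uz.
have [f af fs] : exists2 f, admissible f & forall x, x \in s -> forall z, F x z - e <= f z.
  (* The error is general in the induction: each maximum spends half of it and leaves half to the
     rest of the list. *)
  elim: s e e0 {Hs} => [|x s IH] e e0; first by exists (fun=> 0) => //; exact: admissible0.
  have e2 : 0 < e / 2 by rewrite divr_gt0.
  have [f af fs] := IH _ e2; have [aF _] := HF x.
  have [f' [af' ff' Ff']] := admissible_max e2 af aF.
  exists f' => // y; rewrite inE => /orP[/eqP ->|ys] z; first by have := Ff' z; lra.
  by have := fs y ys z; have := ff' z; lra.
exists f => // z Kz; have [x xs [[_ ax]|[]//]] := Hs z Kz.
by have := fs x xs z; lra.
Qed.

(* Otherwise a function close to r on a ball, truncated there to be constant,
   could be raised by a bump while staying 1-Lipschitz. *)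
Lemma local_decrease x r0 r : normal_radius g x setT r0 -> 0 < r0 ->
  (forall f, admissible f -> f x <= r) ->
  exists y, [/\ joined g x y (4 * r0), joined g y x (4 * r0) &
    forall f, admissible f -> f y <= r - r0 / 32].
Proof.
move=> nr r00 fr; apply/not_notP => N.
have [b [sb pb bx db [K [cK _ Kn bK]]]] := bump_exists gm nr r00 (lexx r0).
have H z : K z -> exists2 f, admissible f & r - r0 / 32 < f z.
  move=> /Kn[y <- yr]; have [j1 j2] := joined_normal nr (ltW r00) yr.
  apply/not_notP => N'; apply: N; exists (psi (chart_at x) y); split => // f af.
  by rewrite leNgt; apply/negP => fy; apply: N'; exists f.
have r32 : 0 < r0 / 32 by rewrite divr_gt0.
have [f af fK] := admissible_cover cK r32 H.
have ab : admissible b by split => //; exists K.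
(* On the ball f >= r - r0/32 - r0/32 = a. If a <= 0, the bump alone, at least r0/8 at x, exceeds
   r. *)
pose a := r - r0 / 16.
have aK z : K z -> a <= f z by move=> /fK; rewrite /a; lra.
have [a0|a0] := leP a 0.
  by have := fr b ab; move: a0 bx; rewrite /a; lra.
have [sf pf [L cL fL] df] := af.
have sa : smooth_fun (fun z => a - f z) := smooth_funB (smooth_fun_cst a) sf.
pose tau := r0 / 32.
have st := smooth_fun_theta r32 sa.
(* A smooth version of min(f, a): it vanishes with f and is constant where f >= a, in particular on
   K. So the gradients of T and of the bump are never both nonzero. *)
pose T z := theta tau a - theta tau (a - f z).
have sT : smooth_fun T := smooth_funB (smooth_fun_cst (theta tau a)) st.
have dT z v : dform T z v = theta' tau (a - f z) * dform f z v.
  rewrite /T (dformB _ _ (smooth_fun_cst _) st) (dform_theta _ _ r32 sa).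
  by rewrite (dformB _ _ (smooth_fun_cst _) sf) !dform_cst; ring.
have aT : admissible (fun z => T z + b z).
  split; first exact: smooth_funD.
  - move=> z; rewrite addr_ge0// subr_ge0; apply: theta_homo => //; have := pf z; lra.
  - exists (K `|` L); first exact: compactU.
    by move=> z /not_orP[/bK bz /fL fz]; rewrite bz /T fz subr0 subrr addr0.
  - move=> z v; rewrite (dformD _ _ sT sb) dT.
    have [Kz|Kz] := pselect (K z).
      by rewrite theta'_le0 ?mul0r ?add0r// subr_le0; exact: aK.
    rewrite (dform_out _ cK bK Kz) addr0 exprMn.
    have /andP[t0 t1] := theta'_itv r32 (a - f z).
    apply: (le_trans _ (df z v)); rewrite ler_piMl ?sqr_ge0// exprn_ile1//.
have Kx : K x.
  by apply/not_notP => /bK b0; move: bx; rewrite b0; lra.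
(* At x the sum is at least (a - r0/32) + r0/8 = r + r0/32, which exceeds r. *)
have := fr _ aT; rewrite /T (theta_le0 _ (_ : a - f x <= 0)); last by rewrite subr_le0; exact: aK.
by have := theta_ge r32 a; move: bx; rewrite /a /tau; lra.
Qed.

(* If all admissible functions were bounded by r at x, greedy descents from (x, r)
   would form a Cauchy sequence with a limit that still admits a descent. *)
Definition level (p : M * R) := forall f, admissible f -> f p.1 <= p.2.

(** One application of [local_decrease] moves by 4 r0 and drops by r0/32, a ratio of 128. The ratio
    256 leaves room for reaching the centre of a ball before descending from it: a move of 8 r0 for
    the same drop. *)
Definition descent (p q : M * R) := [/\ level q, q.2 < p.2,
  joined g p.1 q.1 (256 * (p.2 - q.2)) & joined g q.1 p.1 (256 * (p.2 - q.2))].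

Lemma level_ge0 p : level p -> 0 <= p.2.
Proof. by move=> /(_ _ admissible0). Qed.

Lemma descent_exists p : level p -> exists q, descent p q.
Proof.
move=> lp; have [r r0 nr] := normal_radius_exists gm (@filterT _ (nbhs p.1) _).
have [y [j1 j2 ly]] := local_decrease nr r0 lp.
have r32 : 0 < r / 32 by rewrite divr_gt0.
exists (y, p.2 - r / 32); split => //=; first by rewrite ltrBlDr ltrDl.
  by apply: joined_le j1 _; lra.
by apply: joined_le j2 _; lra.
Qed.

(** Drops are bounded because levels are nonnegative, the zero function being admissible; some
    descent then achieves more than half of the supremum. *)
Lemma greedy_descent p : level p -> exists q, descent p q /\
  forall q', descent p q' -> p.2 - q'.2 <= 2 * (p.2 - q.2).
Proof.
move=> lp; pose E := [set s : R | exists2 q, descent p q & s = p.2 - q.2].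
have [q0 d0] := descent_exists lp.
have hE : has_sup E.
  split; first by exists (p.2 - q0.2); exists q0.
  exists p.2 => _ [q [/level_ge0 q2 _ _ _] ->]; lra.
have s0 : 0 < sup E.
  apply: (@lt_le_trans _ _ (p.2 - q0.2)); first by case: d0 => _; rewrite subr_gt0.
  by apply: ub_le_sup; [case: hE|exists q0].
have s2 : 0 < sup E / 2 by rewrite divr_gt0.
have [_ [q dq ->] qs] := sup_adherent s2 hE.
exists q; split => // q' dq'.
have : p.2 - q'.2 <= sup E by apply: ub_le_sup; [case: hE|exists q'].
by move: qs; lra.
Qed.

Lemma exhaustion (gc : complete_metric g) x r : exists2 f, admissible f & r <= f x.
Proof.
apply/not_notP => N.
have l0 : level (x, r).
  by move=> f af /=; rewrite leNgt; apply/negP => /ltW rf; apply: N; exists f.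
have step (p : {p | level p}) : exists q : {q | level q}, descent (sval p) (sval q) /\
    forall q', descent (sval p) q' -> (sval p).2 - q'.2 <= 2 * ((sval p).2 - (sval q).2).
  have [q [dq gq]] := greedy_descent (svalP p).
  by have [lq _ _ _] := dq; exists (exist _ q lq).
have [next Hn] := choice step.
pose w k := sval (iter k next (exist _ (x, r) l0)).
have lw k : level (w k) := svalP (iter k next (exist _ (x, r) l0)).
have dw k : descent (w k) (w k.+1) := (Hn _).1.
have gw k q' : descent (w k) q' -> (w k).2 - q'.2 <= 2 * ((w k).2 - (w k.+1).2) := (Hn _).2 q'.
pose rr k := (w k).2.
have rdec : nonincreasing_seq rr.
  by apply/nonincreasing_seqP => k; have [_ /ltW] := dw k.
have jw a b : (a <= b)%N -> joined g (w a).1 (w b).1 (256 * (rr a - rr b)) /\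
    joined g (w b).1 (w a).1 (256 * (rr a - rr b)).
  elim: b => [|b IH].
    by rewrite leqn0 => /eqP ->; rewrite subrr mulr0; split; exact: joined_refl.
  rewrite leq_eqVlt => /predU1P[->|ab]; first by rewrite subrr mulr0; split; exact: joined_refl.
  have [j1 j2] := IH ab; have [_ _ k1 k2] := dw b.
  have -> : 256 * (rr a - rr b.+1) = 256 * (rr a - rr b) + 256 * (rr b - rr b.+1) by ring.
  split; first exact: joined_cat j1 k1.
  by rewrite addrC; exact: joined_cat k2 j2.
have cr : cvgn rr.
  apply: nonincreasing_is_cvgn => //; exists 0 => _ [k _ <-]; exact: level_ge0.
pose rs := limn rr.
have rge k : rs <= rr k by exact: nonincreasing_cvgn_ge.
have small e : 0 < e -> exists N, forall k, (N <= k)%N -> rr k < rs + e.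
  move=> e0; have /cvgrPdist_lt/(_ _ e0)[N' _ HN] := cr.
  exists N' => k /HN /=; rewrite distrC ltr_norml => /andP[_]; rewrite -/rs; lra.
have cauchy e : 0 < e -> exists N, forall p q, (N <= p)%N -> (N <= q)%N ->
    (riemannian_dist g (w p).1 (w q).1 < e%:E)%E.
  move=> e0; have [N' HN] := small (e / 256) (divr_gt0 e0 (ltr0Sn _ _)).
  have b p q : (N' <= p)%N -> 256 * (rr p - rr q) < e.
    by move=> /HN; have := rge q; lra.
  exists N' => p q Np Nq; have [pq|/ltnW qp] := leqP p q.
    by apply: le_lt_trans (joined_dist (jw p q pq).1) _; rewrite lte_fin b.
  by apply: le_lt_trans (joined_dist (jw q p qp).2) _; rewrite lte_fin b.
have [z zlim] := gc _ cauchy.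
have near e : 0 < e -> exists N, forall k, (N <= k)%N -> joined g (w k).1 z e.
  move=> e0; have /fine_cvgP[fin] := zlim.
  move=> /cvgrPdist_lt/(_ _ e0) H; have [N' _ HN] := filterI fin H.
  exists N' => k /HN[/= fk]; rewrite sub0r normrN => dk; apply: dist_joined.
  by rewrite -(fineK fk) lte_fin (le_lt_trans (ler_norm _)).
(* The bound passes to the limit because admissible functions are 1-Lipschitz along the paths from
   the sequence to z. *)
have lz : level (z, rs).
  move=> f [sf pf cf df] /=; apply/ler_addgt0Pr => e e0.
  have e2 : 0 < e / 2 by rewrite divr_gt0.
  have [N1 H1] := small _ e2; have [N2 H2] := near _ e2.
  pose k := maxn N1 N2.
  have := joined_lipschitz gm sf df (H2 k (leq_maxr _ _)).
  have := H1 k (leq_maxl _ _); have := lw k f (And4 sf pf cf df); rewrite -/(rr k); lra.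
have [r1 r10 nr] := normal_radius_exists gm (@filterT _ (nbhs z) _).
have [y [j1 j2 ly]] := local_decrease nr r10 lz.
(* This bump links distance and chart: b >= r1/8 at z and b is 1-Lipschitz, so points joined to z
   within r1/16 have b nonzero and lie in the normal ball of z. *)
have [b [sb pb bz db [K [cK _ Kn bK]]]] := bump_exists gm nr r10 (lexx r1).
have r16 : 0 < r1 / 16 by rewrite divr_gt0.
have [N1 H1] := near _ r16.
(* From the k-th term a drop of at least r1/32 is available, whereas greediness allows at most twice
   the actual drop, which is less than 2 (r1/64). *)
have r64 : 0 < r1 / 64 by rewrite divr_gt0.
have [N2 H2] := small _ r64.
pose k := maxn N1 N2.
have bk : b (w k).1 != 0.
  have bl := joined_lipschitz gm sb db (H1 k (leq_maxl _ _)).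
  by rewrite gt_eqF//; lra.
have /Kn[y' y'E yr] : K (w k).1 by apply/not_notP => /bK b0; rewrite b0 eqxx in bk.
have [i1 i2] := joined_normal nr (ltW r10) yr; rewrite y'E in i1 i2.
have rk := H2 k (leq_maxr _ _); have rk1 := rge k.+1; have rk0 := rge k.
have dk : descent (w k) (y, rs - r1 / 32).
  split => //=; rewrite -/(rr k); first lra.
    by apply: joined_le (joined_cat i2 j1) _; lra.
  by apply: joined_le (joined_cat j2 i1) _; lra.
have := gw k _ dk; rewrite /= -/(rr k) -/(rr k.+1); lra.
Qed.

End Completeness.

(** * The energy estimate *)

Section ContractionBound.
Context {R : realType} {n : nat}.

Lemma posdef1 : posdef (1%:M : 'M[R]_n).
Proof.
split; first exact: trmx1.
move=> v v0; rewrite mulmx1 mxE; under eq_bigr do rewrite [v^T _ _]mxE -expr2.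
have /rV0Pn[a va] := v0; rewrite (bigD1 a)//= ltr_pwDl ?exprn_even_gt0//.
by apply: sumr_ge0 => b _; exact: sqr_ge0.
Qed.

Lemma qf1 (v w : 'rV[R]_n) : qf 1%:M v w = \sum_a v 0 a * w 0 a.
Proof. by rewrite /qf mulmx1 mxE; apply: eq_bigr => a _; rewrite mxE. Qed.

(** In orthonormal components this is Cauchy-Schwarz in the contracted slot, for each value of the
    remaining indices. *)
Lemma Sdot_contract_le k (G : 'M[R]_n) (w : 'M[R]_(k.+1, n) -> R) (v : 'rV[R]_n) :
  posdef G -> multilinear_rows w ->
  Sdot (invmx G) (fun B : 'M[R]_(k, n) => w (col_mx v B)) (fun B => w (col_mx v B)) <=
  qf G v v * Sdot (invmx G) w w.
Proof.
move=> Gp wl; have [P Pu GP] := posdef_inv Gp; have Gu := posdef_unitmx Gp.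
have wvl : multilinear_rows (fun B : 'M[R]_(k, n) => w (col_mx v B)).
  rewrite (_ : (fun B => _) = (fun B => w (ins_row 0 v B))); first exact: multilinear_ins.
  by apply/funext => B; rewrite ins_row0.
rewrite GP !Sdot_base_change// !Sdot1 (sum_consi 0).
(* The components of v in the orthonormal basis formed by the rows of P. *)
pose t := v *m invmx P.
have tE : qf G v v = qf 1%:M t t.
  have GE : G = invmx P *m (invmx P)^T.
    have E : invmx G *m (invmx P *m (invmx P)^T) = 1%:M.
      by rewrite GP mulmx1 !mulmxA mulmxK// -trmx_mul mulVmx// trmx1.
    by rewrite -[LHS]mulmx1 -E (mulmxA G) mulmxV// mul1mx.
  by rewrite /qf /t mulmx1 trmx_mul {1}GE !mulmxA.
rewrite tE exchange_big mulr_sumr; apply: ler_sum => I _.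
pose x : 'rV[R]_n := \row_a w (stdrows R (consi 0 a I) *m P).
have -> : w (col_mx v (stdrows R I *m P)) = qf 1%:M t x.
  have vE : v = t *m P by rewrite /t mulmxKV.
  rewrite qf1 -ins_row0 {1}vE -mul_ins_row.
  rewrite mul_ins_row [t *m P](_ : _ = \sum_a t 0 a *: (stdvec R a *m P)); last first.
    by rewrite {1}(row_sum_delta t) mulmx_suml; apply: eq_bigr => a _; rewrite -scalemxAl.
  rewrite w_ins_sum//; apply: eq_bigr => a _.
  by rewrite w_insZ// [x 0 a]mxE stdrows_consi mul_ins_row.
have -> : \sum_a w (stdrows R (consi 0 a I) *m P) * w (stdrows R (consi 0 a I) *m P) = qf 1%:M x x.
  by rewrite qf1; apply: eq_bigr => a _; rewrite mxE.
by rewrite -expr2; apply: posdef_cauchy; exact: posdef1.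
Qed.

End ContractionBound.

Section FormBounds.
Context {R : realType} {n : nat} {M : smoothManifold R n}.
Variables (g : M -> 'M[R]_n) (gm : riemannian_metric g).

(** Positivity of the norms of b + c and b - c, handled together through a sign s with s^2 = 1. *)
Lemma form_dot_amgm k (b c : kfield M k) x : multilinear_rows (b x) -> multilinear_rows (c x) ->
  `|form_dot g b c x| <= 2^-1 * (form_dot g b b x + form_dot g c c x).
Proof.
move=> bl cl.
have H (s : R) : s ^+ 2 = 1 -> 0 <= form_dot g b b x + form_dot g c c x + 2 * s * form_dot g b c x.
  move=> s2; pose e : kfield M k := fun z A => b z A + s * c z A.
  have el : multilinear_rows (e x).
    move=> A B C l p q rA rB rC; rewrite /e (bl A B C l p q)// (cl A B C l p q)//; ring.
  have := form_dot_ge0 gm el; rewrite [in X in _ + X](form_dotC gm b c) !form_dotE.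
  have -> : e x = (fun B => b x B + s * c x B) by [].
  rewrite SdotDl !SdotDr SdotZl !SdotZr SdotZl.
  rewrite -[X in Sdot X (b x) (c x)]trmxK Sdot_trmx trmx_inv (Defs.metric_sym _ gm).
  by move=> h; apply: le_trans h _; rewrite le_eqVlt; apply/orP; left; apply/eqP; ring: s2.
have h1 := H 1 (expr1n _ _).
have h2 : 0 <= form_dot g b b x + form_dot g c c x + 2 * (-1) * form_dot g b c x.
  by apply: H; rewrite sqrrN expr1n.
by rewrite ler_norml; apply/andP; split; lra.
Qed.

(** The factor k+1 comes from the normalizations 1/k! and 1/(k+1)!, as Cauchy-Schwarz is applied to
    the full tensor rather than to increasing indices. Any constant independent of h suffices. *)
Lemma form_dot_contract_le k (w : kfield M 1) (alpha : kfield M k.+1) x :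
  Omega w -> multilinear_rows (alpha x) ->
  form_dot g (contract (sharp g w) alpha) (contract (sharp g w) alpha) x <=
  w x (sharp g w x) * (k.+1%:R * form_dot g alpha alpha x).
Proof.
move=> wO al; rewrite (sharpP _ _ gm wO) !form_dotE.
have H := Sdot_contract_le (sharp g w x) (metric_posdef gm x) al.
have f0 : (0 : R) < k`!%:R by rewrite ltr0n fact_gt0.
have -> : gdot g x (sharp g w x) (sharp g w x) *
    (k.+1%:R * ((k.+1`!%:R)^-1 * Sdot (invmx (g x)) (alpha x) (alpha x))) =
    k`!%:R^-1 * (qf (g x) (sharp g w x) (sharp g w x) * Sdot (invmx (g x)) (alpha x) (alpha x)).
  rewrite factS natrM -[qf _ _ _]/(gdot g x (sharp g w x) (sharp g w x)).
  move: (gdot _ _ _ _) (Sdot _ _ _) => p s; field.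
  by rewrite (gt_eqF f0) /= gt_eqF// ltr_pwDl.
by rewrite ler_pM2l// invr_gt0.
Qed.

(** At v = grad h the hypothesis reads |grad h|^4 <= |grad h|^2. *)
Lemma dform_sharp_le1 (h : M -> R) x : smooth_fun h ->
  (forall v, dform h x v ^+ 2 <= gdot g x v v) -> dform h x (sharp g (dform h) x) <= 1.
Proof.
move=> sh dh; have := dh (sharp g (dform h) x).
rewrite -(sharpP _ _ gm (dform_Omega sh)); set s := dform h x _ => ss.
by rewrite leNgt; apply/negP => s1; move: ss; rewrite leNgt expr2 ltr_pMr ?s1// (lt_trans ltr01).
Qed.

Lemma dformM (h1 h2 : M -> R) x v : smooth_fun h1 -> smooth_fun h2 ->
  dform (fun z => h1 z * h2 z) x v = h1 x * dform h2 x v + dform h1 x v * h2 x.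
Proof.
move=> s1 s2; have ix := chart_atP x; have cx := cod_phi ix.
have e := derive_mul v (smooth_fun_differentiable s1 cx) (smooth_fun_differentiable s2 cx).
by rewrite /dform [LHS]e /= phiK.
Qed.

End FormBounds.

Section Vanishing.
Context {R : realType} {n : nat} {M : smoothManifold R n}.
Variables (g : M -> 'M[R]_n) (gm : riemannian_metric g) (gc : complete_metric g).
Variables (vol : {measure set (borelM M) -> \bar R}) (gvol : riemannian_volume g vol).
Context d (T : measurableType d) (mu : {sigma_finite_measure set T -> \bar R})
  (vec : T -> 'rV[R]_n) (model : rV_model mu vec).
Variables (eta : kfield M 1) (etaO : Omega eta) (par : parallel g eta).
Variables (c : R) (c0 : 0 < c) (enc : forall x, enorm g eta x = c).
Local Notation U := (sharp g eta).

(** The natural bound is the square root of c; 1 + c dominates it and avoids the root. *)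
Lemma dform_U_le (h : M -> R) x : (forall v, dform h x v ^+ 2 <= gdot g x v v) ->
  `|dform h x (U x)| <= 1 + c.
Proof.
move=> /(_ (U x)); rewrite -(sharpP _ _ gm etaO) -/(enorm g eta x) enc => H.
rewrite -ler_sqr ?nnegrE ?addr_ge0// ?ltW// real_normK ?num_real//.
by apply: (le_lt_trans H); rewrite expr2; nra.
Qed.

Section Density.
Variables (Q : M -> R) (sQ : smooth_fun Q) (Q0 : forall x, 0 <= Q x)
  (Qoo : (\int[vol]_x (Q x)%:E < +oo)%E).

Lemma density_integrable : vol.-integrable [set: borelM M] (fun x => (Q x)%:E).
Proof.
apply/integrableP; split.
  by apply/measurable_EFinP; apply: continuous_borel; exact: smooth_fun_continuous.
by under eq_integral do rewrite gee0_abs ?lee_fin//.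
Qed.

Lemma dominated_integrable (f : M -> R) C : continuous f -> (forall x, `|f x| <= C * Q x) ->
  vol.-integrable [set: borelM M] (fun x => (f x)%:E).
Proof.
move=> cf fQ.
apply: (@le_integrable _ (borelM M) R vol _ measurableT _ (fun x => (C%:E * (Q x)%:E)%E)).
- by apply/measurable_EFinP; exact: continuous_borel.
- move=> x _; rewrite -EFinM !abse_EFin lee_fin; apply: (le_trans (fQ x)); exact: ler_norm.
- by apply: integrableZl => //; exact: density_integrable.
Qed.

(** Here Q stands for |alpha|^2. It is integrable but its derivative along U is not known to be, so
    that derivative is moved onto h; the outcome involves only |U h| <= 1 + c. *)
Lemma energy_bound (h rem : M -> R) C : admissible g h -> 0 <= C -> continuous rem ->
  (forall x, `|rem x| <= C * Q x) ->
  (\int[vol]_x (rem x + h x * (2^-1 * dform Q x (U x) + c * Q x))%:E = 0)%E ->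
  (\int[vol]_x (c * (h x * Q x))%:E <= (C + (1 + c))%:E * \int[vol]_x (Q x)%:E)%E.
Proof.
move=> [sh ph ch dh] C0 crem remQ I0.
have irem := dominated_integrable crem remQ.
have iQ := density_integrable.
have cc (f : M -> R) : csupp (fun x => h x * f x).
  by have [K cK hK] := ch; exists K => // x /hK ->; rewrite mul0r.
have shQ : smooth_fun (fun x => h x * Q x) := smooth_funM sh sQ.
have sdh : smooth_fun (fun x => dform h x (U x)) := flow_smooth gm etaO sh.
have cdh : csupp (fun x => dform h x (U x)) := flow_csupp g eta ch.
(* What remains of the energy after subtracting half of U (h Q), whose integral is 0. *)
pose P2 x := c * (h x * Q x) - 2^-1 * (Q x * dform h x (U x)).
have sP2 : smooth_fun P2.
  apply: smooth_funB; first exact: (smooth_funM (smooth_fun_cst c) shQ).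
  exact: (smooth_funM (smooth_fun_cst 2^-1) (smooth_funM sQ sdh)).
have iP2 : vol.-integrable [set: borelM M] (fun x => (P2 x)%:E).
  apply: (continuous_csupp_integrable gm gvol model).
    by apply: smooth_fun_continuous; exact: sP2.
  have [K cK hK] := ch; exists K => // x Kx.
  by rewrite /P2 hK// (dform_out _ cK hK Kx); ring.
have iflow := flow_integrable gm gvol model etaO shQ (cc Q).
have ihQ : vol.-integrable [set: borelM M] (fun x => (c * (h x * Q x))%:E).
  apply: (continuous_csupp_integrable gm gvol model).
    by apply: smooth_fun_continuous; exact: (smooth_funM (smooth_fun_cst c) shQ).
  by have [K cK hK] := ch; exists K => // x /hK ->; ring.
have iP : vol.-integrable [set: borelM M] (fun x => ((rem x)%:E + (P2 x)%:E)%E) by exact: integrableD.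
have P0 : (\int[vol]_x ((rem x)%:E + (P2 x)%:E) = 0)%E.
  rewrite -[RHS]I0.
  transitivity (\int[vol]_x (((rem x)%:E + (P2 x)%:E) +
      (2^-1)%:E * (dform (fun z => h z * Q z) x (U x))%:E))%E.
    rewrite (integralD measurableT iP (integrableZl measurableT 2^-1 iflow)).
    by rewrite (integralZl measurableT iflow) (integral_flow gm gvol model etaO par shQ (cc Q)) mule0 adde0.
  apply: eq_integral => x _; rewrite -EFinM -!EFinD; congr (_%:E).
  by rewrite (dformM _ _ sh sQ) /P2; field.
apply: (@le_trans _ _ (\int[vol]_x (((rem x)%:E + (P2 x)%:E) + (C + (1 + c))%:E * (Q x)%:E))%E); last first.
  rewrite (integralD measurableT iP (integrableZl measurableT (C + (1 + c)) iQ)).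
  by rewrite P0 add0e integralZl.
apply: le_integral => //; first exact: (integrableD measurableT iP (integrableZl measurableT (C + (1 + c)) iQ)).
move=> x _; rewrite -EFinM -!EFinD lee_fin /P2.
have := remQ x; have := dform_U_le (dh x); have := Q0 x.
rewrite !ler_norml; move: (Q x) (rem x) (dform h x (U x)) => q r t q0 /andP[_ t1] /andP[r1 _].
have qt : q * t <= q * (1 + c) by rewrite ler_wpM2l.
have qc : 0 <= q * (1 + c) by rewrite mulr_ge0// addr_ge0// ltW.
lra.
Qed.

(** If Q(x0) > 0, then Q is bounded below on a neighbourhood V of positive volume on which h can be
    made arbitrarily large, against an upper bound independent of h. *)
Lemma density_vanishes C : 0 <= C ->
  (forall h, admissible g h -> exists rem : M -> R, [/\ continuous rem,
     forall x, `|rem x| <= C * Q x &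
     (\int[vol]_x (rem x + h x * (2^-1 * dform Q x (U x) + c * Q x))%:E = 0)%E]) ->
  forall x, Q x = 0.
Proof.
move=> C0 H x0; apply/eqP; rewrite eq_le Q0 andbT leNgt; apply/negP => Qx.
pose m := Q x0 / 2; have m0 : 0 < m by rewrite divr_gt0.
have [r0 r00 nr] := normal_radius_exists gm (@filterT _ (nbhs x0) _).
(* Points of the normal ball of radius r are joined to x0 within 4 r <= 1, so h drops by at most 1
   from its value 1 + t at x0. *)
pose r := Num.min r0 (1 / 4); have rp : 0 < r by rewrite lt_min r00/= divr_gt0.
have r4 : 4 * r <= 1 by have : r <= 1 / 4; [rewrite ge_min lexx orbT|lra].
have rr0 : r <= r0 by rewrite /r ge_min lexx.
have nr' : normal_radius g x0 setT r.
  move=> y yr; apply: nr; apply: (le_trans yr).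
  by rewrite ler_pXn2r// nnegrE ltW.
have N1 : \forall z \near x0, dom (chart_at x0) z /\ norm0 g x0 (phi (chart_at x0) z) < r ^+ 2.
  apply: (phi_near (A := [set y | norm0 g x0 y < r ^+ 2]) (chart_atP x0)).
  pose G0 := local_metric g (chart_at x0) (phi (chart_at x0) x0).
  have cq : {for phi (chart_at x0) x0, continuous (norm0 g x0)} :=
    (qf_smooth G0 (phi (chart_at x0) x0) [::] (y := phi (chart_at x0) x0) I).1.
  have r20 : 0 < r ^+ 2 by rewrite exprn_gt0.
  apply: filterS (near_dist cq r20) => y /=.
  have -> : norm0 g x0 (phi (chart_at x0) x0) = 0 by rewrite /norm0 subrr /qf !mul0mx mxE.
  by rewrite subr0; apply: le_lt_trans; exact: ler_norm.
have N2 : \forall z \near x0, m <= Q z.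
  have cQ : Q @ x0 --> Q x0 := smooth_fun_continuous sQ (x := x0).
  move/cvgrPdist_lt: cQ => /(_ m m0); apply: filterS => z /=.
  by rewrite ltr_norml /m => /andP[_]; lra.
have [V [Vop Vx VA /andP[v0 voo]]] := volume_nbhs gm gvol model (filterI N1 N2).
have iQ := density_integrable.
pose N := fine (\int[vol]_x (Q x)%:E).
have NE : (\int[vol]_x (Q x)%:E = N%:E)%E.
  rewrite fineK// ge0_fin_numE//; apply: integral_ge0 => x _; exact: Q0.
have N0 : 0 <= N by rewrite -lee_fin -NE; apply: integral_ge0 => x _; rewrite lee_fin.
pose v := fine (vol V); have vE : vol V = v%:E by rewrite fineK// ge0_fin_numE.
have vp : 0 < v by rewrite -lte_fin -vE.
pose D := C + (1 + c); have D0 : 0 <= D by rewrite !addr_ge0// ltW.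
(* Chosen so that the lower bound c t m vol(V) exceeds the upper bound D N by exactly 1. *)
pose t := (D * N + 1) / (c * m * v).
have cmv : 0 < c * m * v by rewrite !mulr_gt0.
have t0 : 0 <= t by rewrite divr_ge0 ?addr_ge0 ?mulr_ge0// ltW.
have [h ah hr] := exhaustion gm gc x0 (1 + t).
have [sh ph ch dh] := ah.
have [rem [cr rQ I0]] := H h ah.
have := energy_bound ah C0 cr rQ I0; rewrite NE -EFinM -/D => up.
have hO z : V z -> t <= h z /\ m <= Q z.
  move=> /VA[[iz nz] mz]; split => //.
  have [_ j2] := joined_normal gm nr' (ltW rp) (ltW nz).
  rewrite phiK// in j2; have := joined_lipschitz gm sh dh j2; lra.
have mO : measurable (V : set (borelM M)) by exact: borel_open.
have lo : ((c * (t * m))%:E * vol V <= \int[vol]_x (c * (h x * Q x))%:E)%E.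
  have iV : measurable_fun setT (fun x : borelM M => (\1_(V : set (borelM M)) x : R)%:E).
    by apply/measurable_EFinP; exact: measurable_indic.
  have ctm : 0 <= c * (t * m) by exact: mulr_ge0 (ltW c0) (mulr_ge0 t0 (ltW m0)).
  rewrite -(setIT (V : set (borelM M))) -(integral_indic vol measurableT mO).
  rewrite -(ge0_integralZl_EFin vol measurableT _ iV ctm); last by move=> x _; rewrite lee_fin.
  apply: ge0_le_integral => //.
  - by move=> x _; rewrite -EFinM lee_fin mulr_ge0.
  - by under eq_fun do rewrite -EFinM; apply/measurable_EFinP; apply: measurable_funM => //; exact: measurable_indic.
  - apply/measurable_EFinP; apply: continuous_borel; apply: smooth_fun_continuous.
    exact: (smooth_funM (smooth_fun_cst c) (smooth_funM sh sQ)).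
  - move=> x _; rewrite -EFinM lee_fin indicE; case: (boolP (x \in (V : set M))) => [/set_mem Oxx|_].
      have [h1 h2] := hO x Oxx; rewrite mulr1 ler_pM2l//.
      by apply: ler_pM => //; exact: ltW.
    by rewrite mulr0; exact: mulr_ge0 (ltW c0) (mulr_ge0 (ph x) (Q0 x)).
have := le_trans lo up; rewrite vE -EFinM lee_fin.
have -> : c * (t * m) * v = D * N + 1 by rewrite /t; field; rewrite !gt_eqF.
by rewrite gerDl ler10.
Qed.

End Density.

(** The remainder is <beta, i_(grad h) alpha>. The arithmetic-geometric bound gives half the sum of
    |beta|^2 <= c (k+1) |alpha|^2 and |i_(grad h) alpha|^2 <= (k+1) |alpha|^2, hence the
    constant. *)
Lemma remainder_exists k (alpha : kfield M k.+1) : Omega2 g vol alpha -> d_eta eta alpha = 0 ->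
  delta_eta g vol eta alpha 0 -> forall h, admissible g h -> exists rem : M -> R,
  [/\ continuous rem,
      forall x, `|rem x| <= (2^-1 * (c + 1) * k.+1%:R) * form_dot g alpha alpha x &
      (\int[vol]_x (rem x + h x * (2^-1 * dform (form_dot g alpha alpha) x (U x) +
         c * form_dot g alpha alpha x))%:E = 0)%E].
Proof.
move=> [aO aoo] closed [gam [gamO cod] gamE] h [sh ph ch dh].
pose b := contract U alpha; have bO : Omega b := contract_Omega gm etaO aO.
pose Q := form_dot g alpha alpha.
have sQ : smooth_fun Q := form_dot_smooth gm aO aO.
have dO := dform_Omega sh; have eO := contract_Omega gm dO aO.
have al x : multilinear_rows (alpha x) by case: aO.
have Q0 x : 0 <= Q x := form_dot_ge0 gm (al x).
pose rem := form_dot g b (contract (sharp g (dform h)) alpha).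
have crem : continuous rem by apply: smooth_fun_continuous; exact: form_dot_smooth.
have remQ x : `|rem x| <= (2^-1 * (c + 1) * k.+1%:R) * Q x.
  have bl : multilinear_rows (b x) by case: bO.
  have el : multilinear_rows (contract (sharp g (dform h)) alpha x) by case: eO.
  have am := form_dot_amgm gm bl el.
  have b1 := form_dot_contract_le gm etaO (al x); rewrite -/(enorm g eta x) enc in b1.
  have b2 := form_dot_contract_le gm dO (al x).
  have kQ : 0 <= k.+1%:R * Q x by rewrite mulr_ge0.
  have b3 := le_trans b2 (ler_wpM2r kQ (dform_sharp_le1 gm sh (dh x))).
  apply: (le_trans am); rewrite -/b in b1 *; move: b1 b3; rewrite -/Q.
  move: (form_dot g b b x) (form_dot g _ _ x) (Q x) (k.+1%:R) => p q r s; lra.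
exists rem; split => //.
pose B := form_dot g b b.
pose W x := 2^-1 * dform Q x (U x) + c * Q x.
have sB : smooth_fun B := form_dot_smooth gm bO bO.
have sW : smooth_fun W.
  apply: smooth_funD; first exact: (smooth_funM (smooth_fun_cst 2^-1) (flow_smooth gm etaO sQ)).
  exact: (smooth_funM (smooth_fun_cst c) sQ).
have icsupp (f : M -> R) : smooth_fun f -> vol.-integrable [set: borelM M] (fun x => (h x * f x)%:E).
  move=> sf; apply: (continuous_csupp_integrable gm gvol model).
    by apply: smooth_fun_continuous; exact: smooth_funM.
  by have [K cK hK] := ch; exists K => // x /hK ->; rewrite mul0r.
have irem := dominated_integrable sQ Q0 aoo crem remQ.
have hbO : Omega (fun x A => h x * b x A) := Omega_scale sh bO.
have hbc : compactly_supported (fun x (A : 'M[R]_(k, n)) => h x * b x A).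
  by have [K cK hK] := ch; exists K => // x /hK h0; apply/funext => A; rewrite h0 mul0r.
(* The weak codifferential is tested against h beta, which is compactly supported although beta is
   not. *)
have := cod _ hbO hbc; rewrite /L2_dot.
(* From 0 = gam + i_U alpha the codifferential of alpha is - beta. *)
have gE : gam = fun x A => -1 * b x A.
  apply/funext => x; apply/funext => A; rewrite mulN1r; apply/eqP; rewrite -addr_eq0; apply/eqP.
  by have := congr1 (fun f : kfield M k => f x A) gamE.
have -> : (\int[vol]_x (form_dot g (fun x A => h x * b x A)%R gam x)%:E =
           \int[vol]_x (h x * - B x)%:E)%E.
  apply: eq_integral => x _; congr (_%:E); rewrite gE /B !form_dotE.
  by rewrite SdotZl SdotZr; ring.
have -> : (\int[vol]_x (form_dot g (ext_d (fun x A => h x * b x A)%R) alpha x)%:E =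
           \int[vol]_x ((rem x)%:E + (h x * (W x - B x))%:E))%E.
  apply: eq_integral => x _; rewrite -EFinD; congr (_%:E).
  have := energy_pointwise gm etaO par aO closed x sh; rewrite enc -/b -/B -/rem -/Q => E.
  by rewrite -[LHS](addrK (h x * B x)) E /W; ring.
move=> E.
(* Adding h |beta|^2 back to both sides removes the |beta|^2 terms: the one in d (h beta) and the
   one from the codifferential. *)
transitivity (\int[vol]_x (((rem x)%:E + (h x * (W x - B x))%:E) + (h x * B x)%:E))%E.
  by apply: eq_integral => x _; rewrite -!EFinD; congr (_%:E); rewrite /W /Q; ring.
have sWB : smooth_fun (fun x => W x - B x) := smooth_funB sW sB.
have sNB : smooth_fun (fun x => - B x).
  rewrite (_ : (fun x => _) = (fun x => -1 * B x)); last by apply/funext => x; rewrite mulN1r.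
  exact: (smooth_funM (smooth_fun_cst _) sB).
rewrite (integralD measurableT (integrableD measurableT irem (icsupp _ sWB)) (icsupp _ sB)) E.
rewrite -(integralD measurableT (icsupp _ sNB) (icsupp _ sB)) integral0_eq// => x _.
by rewrite -EFinD mulrN addNr.
Qed.

Lemma harmonic_eq0 k (alpha : kfield M k) : harmonic2 g vol eta k alpha -> alpha = 0.
Proof.
move=> [[aO aoo] closed cod].
have al x : multilinear_rows (alpha x) by case: aO.
have sQ := form_dot_smooth gm aO aO.
have Q0 x := form_dot_ge0 gm (al x).
suff QE x : form_dot g alpha alpha x = 0.
  by apply/funext => x; apply: (form_dot_le0 gm (al x)); rewrite QE.
case: k alpha aO aoo closed cod al sQ Q0 => [|k] alpha aO aoo closed cod al sQ Q0.
  (* In degree 0 the integrand vanishes pointwise, so the remainder and the constant C are 0. *)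
  apply: (density_vanishes sQ Q0 aoo (lexx 0)) => h _; exists (fun=> 0); split.
  - by move=> z; exact: cst_continuous.
  - by move=> z; rewrite normr0 mul0r.
  - apply: integral0_eq => z _; rewrite -(enc z) (energy_pointwise0 gm etaO par z aO closed).
    by rewrite mulr0 addr0.
apply: (density_vanishes sQ Q0 aoo _ (remainder_exists (conj aO aoo) closed cod)).
by rewrite !mulr_ge0// addr_ge0// ltW.
Qed.

End Vanishing.

(** * The zero form is harmonic *)

Section Zero.
Context {R : realType} {n : nat} {M : smoothManifold R n}.
Variables (g : M -> 'M[R]_n) (vol : {measure set (borelM M) -> \bar R}) (eta : kfield M 1).

Lemma Omega0 k : Omega (0 : kfield M k).
Proof.
split => [x A B C l b c _ _ _|x A l m _ _ //|i B].
  by rewrite /= !mulr0 addr0.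
exact: smooth_on_cst.
Qed.

Lemma form_dot0r k (alpha : kfield M k) x : form_dot g alpha 0 x = 0.
Proof. by rewrite /form_dot big1 ?mulr0// => I _; rewrite big1// => J _; rewrite mulr0. Qed.

Lemma L2_dot0r k (alpha : kfield M k) : L2_dot g vol alpha 0 = 0%E.
Proof. by apply: integral0_eq => x _; rewrite form_dot0r. Qed.

Lemma harmonic0 k : harmonic2 g vol eta k 0.
Proof.
split.
- by split; [exact: Omega0|rewrite L2_dot0r ltry].
- apply/funext => x; apply/funext => A.
  have e1 : ext_d (0 : kfield M k) x A = 0.
    rewrite /ext_d big1// => j _.
    rewrite (_ : (fun y => _) = cst 0); last exact/funext.
    by rewrite derive_cst mulr0.
  have e2 : wedge1 eta (0 : kfield M k) x A = 0 by rewrite /wedge1 big1// => j _; rewrite mulr0.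
  by rewrite /d_eta -[LHS]/(ext_d 0 x A + wedge1 eta 0 x A) e1 e2 addr0.
- case: k => //= k; exists 0; last by apply/funext => x; apply/funext => A; rewrite /= addr0.
  split; first exact: Omega0.
  by move=> alpha _ _; rewrite !L2_dot0r.
Qed.

End Zero.

Theorem theorem2p2 (R : realType) (n : nat) (M : smoothManifold R n)
  (Mconn : connected [set: M])
  (g : M -> 'M[R]_n) (gmetric : riemannian_metric g)
  (gcomplete : complete_metric g)
  (vol : {measure set (borelM M) -> \bar R})
  (gvol : riemannian_volume g vol)
  (eta : kfield M 1) (eta_form : Omega eta)
  (eta_closed : ext_d eta = 0) (eta_neq0 : eta <> 0)
  (eta_parallel : parallel g eta)
  (k : nat) :
  harmonic2 g vol eta k = [set 0].
Proof.
have [d [T [mu [vec model]]]] := @rV_model_exists R n.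
(* One point with [eta] nonzero suffices: there the squared norm is positive, and it is the same at
   every point. *)
have [x [A etaA]] : exists x A, eta x A != 0.
  apply: contrapT => eta0; apply: eta_neq0; apply/funext => x; apply/funext => A.
  by apply/eqP; apply/negPn/negP => etaA; apply: eta0; exists x, A.
have enc z : enorm g eta z = enorm g eta x by exact: enorm_cst.
apply/seteqP; split => [alpha|_ ->]; last exact: harmonic0.
exact: (harmonic_eq0 gmetric gcomplete gvol model eta_form eta_parallel
  (enorm_gt0 gmetric eta_form etaA) enc).
Qed.
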